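(* Let $n\ge2$, and let $f:\Gamma\to\mathbb{R}$ satisfy properties (a)-(e) of the context and be nondegenerate. Let $\Sigma\subset\mathbb{R}^{n+1}$ be a strictly convex complete $f$-translator with a single end, which is smoothly asymptotic to the bowl-type solution. Then $\Sigma$ is the bowl-type solution up to vertical translations.
   Context: Notation: $\mathbf{e}=(1,\ldots,1)\in\mathbb{R}^{n-1}$, $\Gamma_+=\{\lambda\in\mathbb{R}^n:\lambda_i>0\text{ for all }i\}$. The function $f$ is smooth on $\Gamma$ and the properties are: (a) $\Gamma\subset\mathbb{R}^n$ is an open symmetric cone containing $\Gamma_+$; (b) $f$ is positive and symmetric in its $n$ variables; (c) $\partial f/\partial\lambda_i>0$ on $\Gamma$ for every $i$; (d) $f$ is $1$-homogeneous: $f(c\lambda)=cf(\lambda)$ for $c>0$; (e) $f$ extends to a continuous function on $\overline{\Gamma}$ that vanishes on $\partial\Gamma$. $f$ is nondegenerate if $f(0,\mathbf{e})>0$ (so $(0,\mathbf{e})\in\Gamma$). A hypersurface $\Sigma\subset\mathbb{R}^{n+1}$ is an $f$-translator if $f(\lambda)=-\langle\nu,e_{n+1}\rangle$, where $\nu$ is a unit normal and $\lambda=(\lambda_1,\dots,\lambda_n)$ are the principal curvatures, with the sign convention that they are the eigenvalues of $d\nu$; for a graph $\{(x,u(x))\}$ with $\nu=(Du,-1)/\sqrt{1+|Du|^2}$ this reads $f(\lambda)=1/\sqrt{1+|Du|^2}$, with $\lambda_i\ge 0$ when $u$ is convex. $\Sigma$ is strictly convex if $\lambda\in\Gamma_+$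 at every point. A bowl-type solution is a complete, strictly convex, rotationally symmetric (about the $x_{n+1}$-axis) $f$-translator that is a graph. For nondegenerate $f$ it is known that it exists, is entire, and is unique up to vertical translation. The end of $\Sigma$ is smoothly asymptotic to the bowl-type solution if, outside a ball, $\Sigma$ can be expressed as the vertical graph of a function $u_\Sigma$ such that $$u_\Sigma(x)=\frac{|x|^2}{2f(0,\mathbf{e})}-\frac{\partial f}{\partial\lambda_1}(0,\mathbf{e})\ln(|x|)+O(|x|^{-1}),\quad |x|\to\infty.$$ *)

(* Defs.v *)
From HB Require Import structures.
From mathcomp Require Import all_boot all_order all_algebra.
From mathcomp Require Import all_fingroup.
From mathcomp Require Import all_classical all_reals all_analysis.
Set Implicit Arguments.
Unset Strict Implicit.
Unset Printing Implicit Defensive.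
Import Order.TTheory GRing.Theory Num.Theory.
Import numFieldNormedType.Exports.
Local Open Scope classical_set_scope.
Local Open Scope ring_scope.

(* R^n is 'rV[R]_n and R^(n+1) is the product R^n * R, with p.2 = x_(n+1).
   The library norms on these spaces are sup norms (same topology), so the
   Euclidean structure is introduced separately. *)
Notation ambient R n := ('rV[R]_n * R)%type.

Definition dotr (R : realType) (n : nat) (x y : 'rV[R]_n) : R :=
  \sum_(i < n) x 0 i * y 0 i.

Definition enormr (R : realType) (n : nat) (x : 'rV[R]_n) : R :=
  Num.sqrt (dotr x x).

Definition dot (R : realType) (n : nat) (p q : ambient R n) : R :=
  dotr p.1 q.1 + p.2 * q.2.

Definition enorm (R : realType) (n : nat) (p : ambient R n) : R :=
  Num.sqrt (dot p p).

Definition e_last (R : realType) (n : nat) : ambient R n := (0, 1).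

(* 'D_v1 ('D_v2 ... g) for vs = [:: v1; v2; ...] *)
Fixpoint iter_derive (R : realType) (V W : normedModType R)
    (vs : seq V) (g : V -> W) : V -> W :=
  if vs is v :: vs' then fun x => 'D_v (iter_derive vs' g) x else g.

(* C^oo on the open set U: all iterated directional derivatives exist and are
   continuous. *)
Definition smooth_on (R : realType) (V W : normedModType R)
    (U : set V) (g : V -> W) : Prop :=
  forall (vs : seq V) (x : V), U x ->
    (forall v : V, derivable (iter_derive vs g) x v) /\
    {for x, continuous (iter_derive vs g)}.

(* N is a smooth extension, to an open neighbourhood U of p, of the restriction
   of g to the subset S. *)
Definition smooth_extension (R : realType) (V W : normedModType R)
    (S : set V) (g : V -> W) (p : V) (U : set V) (N : V -> W) : Prop :=
  [/\ open U, U p, smooth_on U N & forall q, S q -> U q -> N q = g q].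

Definition smooth_on_subset (R : realType) (V W : normedModType R)
    (S : set V) (g : V -> W) : Prop :=
  forall p, S p -> exists (U : set V) (N : V -> W), smooth_extension S g p U N.

Definition local_equation (R : realType) (n : nat) (S : set (ambient R n))
    (p : ambient R n) (U : set (ambient R n)) (Phi : ambient R n -> R) : Prop :=
  [/\ open U, U p, smooth_on U Phi,
      exists w : ambient R n, 'D_w Phi p != 0
    & forall q, U q -> (S q <-> Phi q = 0)].

(* nonempty smooth embedded hypersurface (not assumed closed or connected) *)
Definition hypersurface (R : realType) (n : nat) (S : set (ambient R n)) : Prop :=
  S !=set0 /\
  forall p, S p ->
    exists (U : set (ambient R n)) (Phi : ambient R n -> R),
      local_equation S p U Phi.

(* The kernel of dPhi_p, which does not depend on the local equation Phi. *)
Definition tangent_space (R : realType) (n : nat) (S : set (ambient R n))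
    (p : ambient R n) : set (ambient R n) :=
  [set w | exists (U : set (ambient R n)) (Phi : ambient R n -> R),
     local_equation S p U Phi /\ 'D_w Phi p = 0].

Definition unit_normal (R : realType) (n : nat) (S : set (ambient R n))
    (nu : ambient R n -> ambient R n) : Prop :=
  smooth_on_subset S nu /\
  forall p, S p ->
    enorm (nu p) = 1 /\ forall w, tangent_space S p w -> dot (nu p) w = 0.

(* d(nu)_p(w) = z for w tangent to S at p; the value is computed from a local
   smooth extension of nu and does not depend on it since w is tangent. *)
Definition dnormal (R : realType) (n : nat) (S : set (ambient R n))
    (nu : ambient R n -> ambient R n) (p w z : ambient R n) : Prop :=
  exists (U : set (ambient R n)) (N : ambient R n -> ambient R n),
    smooth_extension S nu p U N /\ 'D_w N p = z.

(* The eigenvalues of d(nu)_p on T_pS, listed with multiplicity: d(nu)_p is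
   self-adjoint, so the lists are those attached to orthonormal eigenbases, and
   two of them differ by a permutation. *)
Definition principal_curvatures (R : realType) (n : nat)
    (S : set (ambient R n)) (nu : ambient R n -> ambient R n)
    (p : ambient R n) : set 'rV[R]_n :=
  [set lam | exists v : 'I_n -> ambient R n,
     [/\ forall i, tangent_space S p (v i),
         forall i j, dot (v i) (v j) = (i == j)%:R
       & forall i, dnormal S nu p (v i) (lam 0 i *: v i)]].

Definition Gamma_plus (R : realType) (n : nat) : set 'rV[R]_n :=
  [set lam | forall i, 0 < lam 0 i].

Definition strictly_convex (R : realType) (n : nat) (S : set (ambient R n))
    (nu : ambient R n -> ambient R n) : Prop :=
  forall p, S p ->
    exists lam, principal_curvatures S nu p lam /\ Gamma_plus lam.

Definition translator (R : realType) (n : nat) (Gamma : set 'rV[R]_n)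
    (f : 'rV[R]_n -> R) (S : set (ambient R n))
    (nu : ambient R n -> ambient R n) : Prop :=
  forall p, S p ->
    exists lam, [/\ principal_curvatures S nu p lam, Gamma lam
                  & f lam = - dot (nu p) (e_last R n)].

(* C^1 curves [0,1] -> S from p to q (restrictions of C^1 curves on R).  They
   may have zero velocity, so that concatenations can be reparametrised to C^1
   and the infimum of lengths is the usual Riemannian distance. *)
Definition C1_curve (R : realType) (n : nat) (S : set (ambient R n))
    (p q : ambient R n) : set (R -> ambient R n) :=
  [set c : R -> ambient R n |
   [/\ forall t : R, derivable c t 1, continuous (derive1 c),
               forall t : R, 0 <= t <= 1 -> S (c t), c 0 = p & c 1 = q]].

Definition curve_length (R : realType) (n : nat) (c : R -> ambient R n) : \bar R :=
  (\int[lebesgue_measure]_(t in `[0%R, 1%R]) (enorm (derive1 c t))%:E)%E.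

(* Riemannian distance of the metric induced on S (+oo between points in
   different components) *)
Definition intrinsic_dist (R : realType) (n : nat) (S : set (ambient R n))
    (p q : ambient R n) : \bar R :=
  ereal_inf [set curve_length c | c in C1_curve S p q].

Definition complete_hypersurface (R : realType) (n : nat)
    (S : set (ambient R n)) : Prop :=
  forall x : nat -> ambient R n, (forall k, S (x k)) ->
    (forall e : R, 0 < e -> exists N : nat, forall i j : nat,
        (N <= i)%N -> (N <= j)%N -> (intrinsic_dist S (x i) (x j) < e%:E)%E) ->
    exists2 p, S p & forall e : R, 0 < e -> exists N : nat, forall i : nat,
        (N <= i)%N -> (intrinsic_dist S (x i) p < e%:E)%E.

(* C is a connected component of S \ K that is not relatively compact in S *)
Definition noncompact_component (T : topologicalType) (S K C : set T) : Prop :=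
  (exists2 p, (S `\` K) p & C = connected_component (S `\` K) p) /\
  ~ (exists L : set T, [/\ compact L, L `<=` S & C `<=` L]).

Definition single_end (T : topologicalType) (S : set T) : Prop :=
  forall K : set T, compact K -> K `<=` S ->
    exists! C : set T, noncompact_component S K C.

Definition symmetric_set (R : realType) (n : nat) (Gamma : set 'rV[R]_n) : Prop :=
  forall (s : 'S_n) (lam : 'rV[R]_n), Gamma lam -> Gamma (col_perm s lam).

Definition cone (R : realType) (n : nat) (Gamma : set 'rV[R]_n) : Prop :=
  forall (c : R) (lam : 'rV[R]_n), 0 < c -> Gamma lam -> Gamma (c *: lam).

(* f is a total function, of which only the values on Gamma matter. *)
Record admissible (R : realType) (n : nat) (Gamma : set 'rV[R]_n)
    (f : 'rV[R]_n -> R) : Prop := Admissible {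
  adm_smooth : smooth_on Gamma f;
  adm_open : open Gamma;
  adm_sym_set : symmetric_set Gamma;
  adm_cone : cone Gamma;
  adm_Gamma_plus : @Gamma_plus R n `<=` Gamma;
  adm_pos : forall lam, Gamma lam -> 0 < f lam;
  adm_sym : forall (s : 'S_n) lam, Gamma lam -> f (col_perm s lam) = f lam;
  adm_incr : forall (i : 'I_n) lam, Gamma lam -> 0 < 'D_(delta_mx 0 i) f lam;
  adm_homog : forall (c : R) (lam : 'rV[R]_n),
    0 < c -> Gamma lam -> f (c *: lam) = c * f lam;
  adm_boundary : exists g : 'rV[R]_n -> R,
    [/\ {within closure Gamma, continuous g},
        forall lam, Gamma lam -> g lam = f lam
      & forall lam, (closure Gamma `\` Gamma°) lam -> g lam = 0]
}.

Definition e_first (R : realType) (n : nat) : 'rV[R]_n :=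
  \row_(i < n) ((i : nat) == 0%N)%:R.

(* (0, e) with e = (1, ..., 1) in R^(n-1) *)
Definition zero_e (R : realType) (n : nat) : 'rV[R]_n :=
  \row_(i < n) ((i : nat) != 0%N)%:R.

Definition nondegenerate_speed (R : realType) (n : nat) (Gamma : set 'rV[R]_n)
    (f : 'rV[R]_n -> R) : Prop :=
  Gamma (zero_e R n) /\ 0 < f (zero_e R n).

Definition graph_over (R : realType) (n : nat) (D : set 'rV[R]_n)
    (u : 'rV[R]_n -> R) : set (ambient R n) :=
  [set p | D p.1 /\ p.2 = u p.1].

Definition rotationally_symmetric (R : realType) (n : nat)
    (S : set (ambient R n)) : Prop :=
  forall Q : 'M[R]_n, Q *m Q^T = 1%:M -> \det Q = 1 ->
    forall (x : 'rV[R]_n) (t : R), S (x, t) -> S (x *m Q, t).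

Definition bowl_type (R : realType) (n : nat) (Gamma : set 'rV[R]_n)
    (f : 'rV[R]_n -> R) (S : set (ambient R n)) : Prop :=
  [/\ hypersurface S, complete_hypersurface S,
      exists nu, [/\ unit_normal S nu, strictly_convex S nu
                   & translator Gamma f S nu],
      rotationally_symmetric S
    & exists (D : set 'rV[R]_n) (u : 'rV[R]_n -> R), S = graph_over D u].

Definition vertical_translate (R : realType) (n : nat) (c : R)
    (S : set (ambient R n)) : set (ambient R n) :=
  [set ((p.1, p.2 + c) : ambient R n) | p in S].

(* The domain D of u is required to contain a neighbourhood of infinity, so that
   the expansion as |x| -> oo makes sense. *)
Definition asymptotic_to_bowl (R : realType) (n : nat) (f : 'rV[R]_n -> R)
    (S : set (ambient R n)) : Prop :=
  exists (r : R) (D : set 'rV[R]_n) (u : 'rV[R]_n -> R),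
    [/\ 0 < r,
        S `&` [set p | r < enorm p] = graph_over D u `&` [set p | r < enorm p],
        forall x, r < enormr x -> D x
      & exists C M : R, forall x, M < enormr x ->
          `|u x - (enormr x ^+ 2 / (2 * f (zero_e R n))
                   - 'D_(e_first R n) f (zero_e R n) * ln (enormr x))|
          <= C * (enormr x)^-1].

(* Main.v *)
Require Import Defs.
From mathcomp Require Import all_boot all_order all_algebra.
From mathcomp Require Import all_fingroup.
From mathcomp Require Import all_classical all_reals all_analysis.
From mathcomp Require Import ring lra.
Set Implicit Arguments.
Unset Strict Implicit.
Unset Printing Implicit Defensive.
Import Order.TTheory GRing.Theory Num.Theory.
Import numFieldNormedType.Exports.
Local Open Scope classical_set_scope.
Local Open Scope ring_scope.

(* Since f > 0, the normal of a translator is nowhere horizontal, so S is locally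
   the graph of a function u; in terms of q = Du and of the eigenvalues mu of D^2u
   relative to the metric 1 + q^T q, 1-homogeneity turns the equation into
   f(mu) = 1.

   S is an entire graph: extend the end of S, which is a graph, over half-spaces
   {x_0 > a} with decreasing a.  At a boundary point, convexity bounds the slope in
   the direction e_0 from above, and chords in the direction e_1 reaching the end
   of S bound u from above, so the graph has finite length over a segment normal to
   the boundary; by completeness it reaches a point of S, near which S continues
   the graph.  The single end excludes other components.

   S is rotationally symmetric: if Q is orthogonal, u and v(x) = u(xQ) solve the
   same equation and u - v -> 0 at infinity.  If u - v were positive somewhere, so
   would be u(sx)/s - v(x) for s > 1 close to 1, with an interior maximum on a large
   cube; but u(sx)/s solves f(mu) = s > 1, against ellipticity.  In particular S is
   a bowl-type solution.

   Uniqueness: the slope p of a radial solution satisfies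
   f(p'/(1+p^2), p/r, ..., p/r) = 1, hence p/r <= 1/f(0,e), so by completeness every
   bowl-type solution is entire.  For two slopes, where p1 > p2 the equation gives
   (atan p1 - atan p2)' < 0, while the difference vanishes at r = 0. *)

(** * Calculus *)

(** Smoothness is expressed by iterated directional derivatives, so the chain rule, the implicit
    function theorem and the Hessian are obtained direction by direction. The bridge to the equation
    is [mu = - lam / nu_2], with [nu_2] the vertical component of the normal: the division turns the
    Weingarten map into D^2u relative to the metric and absorbs the right-hand side.

    In the continuation, S may a priori have several sheets over a point, so every extension must be
    shown to agree with the earlier ones. Two sheets over a segment that agree at one end agree at
    the other, and each half-space reaches the region where S has one sheet. The boundary hyperplane
    is not compact, but away from a compact part of it the end of S already provides the extension;
    this gives a strip of uniform width.

    The radial equation is implicit in p' and singular at r = 0, so uniqueness rests on the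
    monotonicity of f instead of an ODE theorem. Rotational symmetry concerns only matrices of
    determinant 1; for n >= 2 these still act transitively on spheres. *)

Section calculus.
Context {R : realType} {V W : normedModType R}.

Lemma is_derive_line (g : V -> W) (p v : V) (t : R) (df : W) :
  is_derive (p + t *: v) v g df <-> is_derive t 1 (fun s : R => g (p + s *: v)) df.
Proof.
have E : (fun h : R => h^-1 *: ((g \o shift (p + t *: v)) (h *: v) - g (p + t *: v))) =
  (fun h : R => h^-1 *: (((fun s : R => g (p + s *: v)) \o shift t) (h *: (1 : R)) -
        g (p + t *: v))).
  apply/funext => h /=; congr (_ *: (g _ - _)).
  by rewrite [_ *: 1]mulr1 scalerDl addrCA.
by split=> -[d <-]; split; rewrite /derivable/derive ?E// -E.
Qed.

End calculus.

Section calculus_real.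
Context {R : realType} {V : normedModType R}.
Implicit Types (g : V -> R) (p v w : V).

Lemma is_derive_mulr (c t : R) : is_derive t (1 : R) (fun s : R => s * c) c.
Proof.
have -> : (fun s : R => s * c) = c *: (id : R -> R).
  by apply/funext => s; rewrite mulrC.
by have := @is_deriveZ R R R id c t 1 1 (is_derive_id t 1); rewrite [c *: 1]mulr1.
Qed.

Lemma is_derive_dirZ g p v (c df : R) :
  is_derive p v g df -> is_derive p (c *: v) g (c * df).
Proof.
move=> H; have := @is_derive_line R V R g p (c *: v) 0 (c * df).
rewrite scale0r addr0 => -[_]; apply.
have -> : (fun s : R => g (p + s *: (c *: v))) =
   (fun s : R => g (p + s *: v)) \o (fun s => s * c).
  by apply/funext => s /=; rewrite scalerA.
rewrite mulrC; apply: (@is_derive1_comp R (fun s : R => g (p + s *: v)) (fun s => s * c)).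
  rewrite mul0r; apply: (is_derive_line g p v 0 df).1; by rewrite scale0r addr0.
exact: is_derive_mulr.
Qed.

Lemma mvt_line g p v (t : R) :
  (forall a : R, 0 <= a <= 1 -> derivable g (p + (a * t) *: v) v) ->
  exists2 a : R, 0 <= a <= 1 & g (p + t *: v) - g p = t * 'D_v g (p + (a * t) *: v).
Proof.
move=> dg.
have D (a : R) : 0 <= a <= 1 ->
   is_derive a (1 : R) (fun s : R => g (p + (s * t) *: v)) ('D_v g (p + (a * t) *: v) * t).
  move=> a01; have := derivableP (dg a a01).
  move=> /(is_derive_line g p v (a * t) _).1 H.
  apply: (@is_derive1_comp _ (fun s => g (p + s *: v)) (fun s => s * t)).
  exact: is_derive_mulr.
have [||a a01] := @MVT_segment R (fun s : R => g (p + (s * t) *: v))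
   (fun a => 'D_v g (p + (a * t) *: v) * t) 0 1 ler01.
- move=> x; rewrite in_itv/= => /andP[x0 x1]; apply: D; rewrite !ltW//.
- apply: derivable_within_continuous => x; rewrite in_itv/= => x01.
  by have [] := D x x01.
- rewrite mul1r mul0r scale0r addr0 subr0 mulr1 => E.
  by exists a; rewrite // mulrC.
Qed.

(** The mean value theorem in the direction [w], along a moving base point. The secant slope [k]
    takes the limit value wherever [rho] vanishes, so that the product formula survives zeros of
    [rho]. Both the chain rule and the implicit derivative rest on it. *)
Lemma secant_cvg g p v w (rho : R -> R) :
  (\forall q \near p, derivable g q w) -> {for p, continuous ('D_w g)} ->
  rho 0 = 0 -> {for 0, continuous rho} ->
  exists k : R -> R,
    (forall t, g (p + t *: v + rho t *: w) - g (p + t *: v) = rho t * k t) /\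
    k @ (0:R) --> 'D_w g p.
Proof.
move=> gw gwc rho0 rhoc.
have rhoc0 : rho @ (0:R) --> (0:R) by rewrite -[X in _ --> X]rho0; exact: rhoc.
have small (Q : set V) : (\forall q \near p, Q q) -> \forall t \near (0:R),
    forall a : R, 0 <= a <= 1 -> Q (p + t *: v + (a * rho t) *: w).
  move=> /nbhs_ballP[e /= e0 eQ].
  have : (fun t : R => `|t| * `|v| + `|rho t| * `|w|) @ (0 : R) --> (0 : R).
    rewrite -[X in _ --> X]addr0 -[X in _ --> X + _](mul0r `|v|) -[X in _ --> _ + X](mul0r `|w|).
    apply: cvgD; apply: cvgMr_tmp.
      by rewrite -[X in _ --> X](@normr0 _ R); apply: cvg_norm; exact: cvg_id.
    by rewrite -[X in _ --> X](@normr0 _ R); apply: cvg_norm.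
  move=> /cvgr_lt /(_ _ e0); apply: filterS => t te a /andP[a0 a1].
  apply: eQ; rewrite -ball_normE /ball_/= -addrA opprD addrA subrr sub0r normrN.
  apply: le_lt_trans te; apply: (le_trans (ler_normD _ _)).
  rewrite !normrZ lerD2l ?normrM (ger0_norm a0) ler_wpM2r// ler_piMl//.
pose k (t : R) := if rho t == 0 then 'D_w g p
   else (g (p + t *: v + rho t *: w) - g (p + t *: v)) / rho t.
have kE t : g (p + t *: v + rho t *: w) - g (p + t *: v) = rho t * k t.
  rewrite /k; case: ifPn => [/eqP->|r0]; first by rewrite scale0r addr0 subrr mul0r.
  by rewrite mulrCA divff// mulr1.
have kc : k @ (0:R) --> 'D_w g p.
  apply/cvgrPdist_lt => e e0.
  have /small : \forall q \near p, `|'D_w g p - 'D_w g q| < e.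
    by move/cvgrPdist_lt: gwc; apply.
  move: gw => /small; apply: filter_app2; near=> t => dt ct.
  rewrite /k; case: ifPn => [_|r0]; first by rewrite subrr normr0.
  have [|a a01 ->] := @mvt_line g (p + t *: v) w (rho t); first exact: dt.
  by rewrite mulrC mulKf//; apply: ct.
by exists k.
Unshelve. all: by end_near. Qed.

Lemma is_derive_quot g p v dv : is_derive p v g dv ->
  (fun h : R => h^-1 * (g (p + h *: v) - g p)) @ 0^' --> dv.
Proof.
case=> gv <-; move: gv; rewrite /derivable /derive => gv.
have -> : (fun h : R => h^-1 * (g (p + h *: v) - g p)) =
   (fun h : R => h^-1 *: ((g \o shift p) (h *: v) - g p)).
  by apply/funext => h /=; rewrite (addrC p).
exact: gv.
Qed.

Lemma quot_is_derive g p v dv :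
  (fun h : R => h^-1 * (g (p + h *: v) - g p)) @ 0^' --> dv -> is_derive p v g dv.
Proof.
have -> : (fun h : R => h^-1 * (g (p + h *: v) - g p)) =
   (fun h : R => h^-1 *: ((g \o shift p) (h *: v) - g p)).
  by apply/funext => h /=; rewrite (addrC p).
by move=> L; split; [apply/cvg_ex; eexists; exact: L | apply/cvg_lim].
Qed.

End calculus_real.

Section calculus_real2.
Context {R : realType} {V : normedModType R}.
Implicit Types (g : V -> R) (p v w : V).

(* Only [v] and [w] span the plane containing the curve, so the mean value
   theorem in these two directions is enough. *)
Lemma chain2 g p v w (rho : R -> R) (d dv : R) :
  is_derive p v g dv ->
  (\forall q \near p, derivable g q w) -> {for p, continuous ('D_w g)} ->
  rho 0 = 0 -> is_derive (0 : R) (1 : R) rho d ->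
  is_derive (0 : R) (1 : R) (fun t : R => g (p + t *: v + rho t *: w))
     (dv + d * 'D_w g p).
Proof.
move=> gv gw gwc rho0 rhod.
have rhoc : {for 0, continuous rho}.
  by apply/differentiable_continuous/derivable1_diffP; case: rhod.
have [k [kE kc]] := secant_cvg v gw gwc rho0 rhoc.
have rl := is_derive_quot rhod; have gl := is_derive_quot gv.
apply: quot_is_derive.
have -> : (fun h : R => h^-1 * (g (p + (0 + h *: (1 : R)) *: v + rho (0 + h *: (1:R)) *: w)
     - g (p + (0:R) *: v + rho 0 *: w))) =
    (fun h : R => h^-1 * (g (p + h *: v) - g p) +
       (h^-1 * (rho (0 + h *: (1:R)) - rho 0)) * k h).
  apply/funext => h /=; rewrite add0r [h *: 1]mulr1 rho0 !scale0r !addr0 subr0.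
  rewrite -mulrA -kE -mulrDr; congr (_ * _).
  by ring.
apply: cvgD => //; apply: cvgM => //.
exact: cvg_within_filter kc.
Qed.

(** Enough for the directional derivative at [p] to be linear in the direction, as the next lemmas
    show. *)
Definition c1_at g p :=
  forall v, (\forall q \near p, derivable g q v) /\ {for p, continuous ('D_v g)}.

Lemma c1_at_derivable g p v : c1_at g p -> derivable g p v.
Proof. by move=> /(_ v)[/nbhs_singleton]. Qed.

Lemma is_derive_dirD g p v w : c1_at g p ->
  is_derive p (v + w) g ('D_v g p + 'D_w g p).
Proof.
move=> gp; rewrite -[p]addr0 -(scale0r (v + w)); apply/is_derive_line.
have -> : (fun s : R => g (p + s *: (v + w))) = (fun t : R => g (p + t *: v + id t *: w)).
  by apply/funext => s; rewrite scalerDr addrA.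
rewrite scale0r addr0 -['D_w g p]mul1r; apply: chain2 => //.
- exact/derivableP/c1_at_derivable.
- by have [] := gp w.
- by have [] := gp w.
Qed.

Lemma derive_dirD g p v w : c1_at g p -> 'D_(v + w) g p = 'D_v g p + 'D_w g p.
Proof. by move=> gp; have := is_derive_dirD v w gp => -[]. Qed.

Lemma derive_dirZ g p v (c : R) : c1_at g p -> 'D_(c *: v) g p = c * 'D_v g p.
Proof.
by move=> gp; have := derivableP (@c1_at_derivable g p v gp) => /(is_derive_dirZ c)[].
Qed.

Lemma derive_dir_sum g p (I : finType) (c : I -> R) (v : I -> V) : c1_at g p ->
  'D_(\sum_i c i *: v i) g p = \sum_i c i * 'D_(v i) g p.
Proof.
move=> gp; elim/big_ind2: _ => [|x a y b|i _]; first by rewrite derive0.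
- by move=> <- <-; rewrite derive_dirD.
- by rewrite derive_dirZ.
Qed.

(** Linearity of [L] is stated in the shape of a difference quotient. It serves for coordinates and
    for scalar products with a fixed vector, which reduce vector-valued maps to real functions. *)
Lemma derive_functional (W : normedModType R) (L : W -> R) (N : V -> W) p v (z : W) :
  (forall a x y, L (a *: (x - y)) = a * (L x - L y)) -> continuous L ->
  is_derive p v N z -> is_derive p v (L \o N) (L z).
Proof.
move=> Ll Lc [Nd <-]; apply: quot_is_derive.
have -> : (fun h : R => h^-1 * ((L \o N) (p + h *: v) - (L \o N) p)) =
  L \o (fun h : R => h^-1 *: ((N \o shift p) (h *: v) - N p)).
  by apply/funext => h /=; rewrite Ll (addrC p).
apply: cvg_comp; first exact: Nd.
exact: Lc.
Qed.

Lemma smooth_on_c1 (W : normedModType R) (L : W -> R) (N : V -> W) (U : set V) p :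
  (forall a x y, L (a *: (x - y)) = a * (L x - L y)) -> continuous L ->
  open U -> U p -> smooth_on U N -> c1_at (L \o N) p.
Proof.
move=> Ll Lc Uo Up NU v.
have DN q : U q -> is_derive q v (L \o N) (L ('D_v N q)).
  by move=> Uq; apply: derive_functional => //; apply: derivableP; apply (NU [::] q Uq).1.
have Un : \forall q \near p, U q by exact: open_nbhs_nbhs.
split; first by apply: filterS Un => q /DN[].
have c : {for p, continuous (L \o 'D_v N)}.
  apply: continuous_comp; last exact: Lc.
  exact: (NU [:: v] p Up).2.
have DE q : U q -> (L \o 'D_v N) q = 'D_v (L \o N) q.
  by move=> /DN H; rewrite derive_val.
rewrite /prop_for/continuous_at /= -DE//.
apply: cvg_trans c; apply: near_eq_cvg.
by apply: filterS Un => q; exact: DE.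
Qed.

End calculus_real2.

(** Continuity of [g] suffices: along [x + t w] the increment [rho] of [g] satisfies [rho * k] =
    minus the increment of [Phi] in the direction [(w, 0)], and [k] tends to the nonzero vertical
    derivative, so [rho / t] converges. *)
Lemma is_derive_implicit {R : realType} (V : normedModType R) (Phi : V * R -> R) (g : V -> R)
    (x w : V) :
  c1_at Phi (x, g x) -> 'D_(0, 1) Phi (x, g x) != 0 ->
  {for x, continuous g} -> (\forall y \near x, Phi (y, g y) = 0) ->
  is_derive x w g (- 'D_(w, 0) Phi (x, g x) / 'D_(0, 1) Phi (x, g x)).
Proof.
move=> PC Pn0 gc gz; apply: quot_is_derive.
pose rho t := g (x + t *: w) - g x.
have xc : x + t *: w @[t --> (0:R)] --> x.
  rewrite -[X in _ --> X]addr0 -(scale0r w).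
  by apply: cvgD; [exact: cvg_cst| apply: cvgZr_tmp; exact: cvg_id].
have gxc : g (x + t *: w) @[t --> (0:R)] --> g x by apply: cvg_comp xc gc.
have rho0 : rho 0 = 0 by rewrite /rho scale0r addr0 subrr.
have rhoc : {for 0, continuous rho}.
  rewrite /prop_for/continuous_at rho0 -[X in _ --> X](subrr (g x)).
  by apply: cvgB; [exact: gxc|exact: cvg_cst].
have [k [kE kc]] := secant_cvg (w, 0) (PC (0, 1)).1 (PC (0, 1)).2 rho0 rhoc.
have pl := is_derive_quot (derivableP (@c1_at_derivable _ _ _ _ (w, 0) PC)).
have : (fun t : R => - (t^-1 * (Phi ((x, g x) + t *: (w, 0)) - Phi (x, g x))) / k t) @ 0^' -->
   - 'D_(w, 0) Phi (x, g x) / 'D_(0, 1) Phi (x, g x).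
  apply: cvgM; first exact: cvgN.
  by apply: cvgV; [exact: Pn0|exact: cvg_within_filter kc].
apply: cvg_trans; apply: near_eq_cvg; near=> t.
have kn0 : k t != 0.
  near: t; apply: cvg_within; move/cvgr_neq0: kc; apply; exact: Pn0.
have := kE t.
have -> : (x, g x) + t *: (w, 0) + rho t *: (0, 1) = (x + t *: w, g (x + t *: w)).
  apply: injective_projections => /=; first by rewrite scaler0 addr0.
  by rewrite [t *: 0]mulr0 addr0 [_ *: 1]mulr1 addrC subrK.
have -> : Phi (x + t *: w, g (x + t *: w)) = 0.
  near: t; apply: cvg_within; exact: xc _ gz.
have -> : Phi (x, g x) = 0 by exact: nbhs_singleton gz.
rewrite sub0r subr0 => E.
by rewrite -mulrN E mulrA mulfK.
Unshelve. all: by end_near. Qed.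

(** * Eigenvalues relative to the induced metric *)

Lemma sumr_gt0_at {R : realType} (I : finType) (F : I -> R) i :
  (forall j, 0 <= F j) -> 0 < F i -> 0 < \sum_j F j.
Proof. by move=> F0 Fi; rewrite (bigD1 i)//= ltr_pwDl// sumr_ge0. Qed.

Lemma rV_neq0 {R : realType} n (w : 'rV[R]_n) : w != 0 -> exists i, w 0 i != 0.
Proof.
move=> w0; apply/existsP; apply: contraR w0; rewrite negb_exists => /forallP w0.
by apply/eqP/rowP => i; rewrite mxE; apply/eqP; rewrite -[_ == _]negbK.
Qed.

Section spectrum.
Context {R : realType} {n : nat}.
Implicit Types (q w : 'rV[R]_n) (A : 'M[R]_n) (mu : 'rV[R]_n).

(* The first fundamental form of a graph with gradient [q]. *)
Definition metric q : 'M[R]_n := 1%:M + q^T *m q.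

(* [mu] lists the eigenvalues of the form [A] relative to [metric q]. *)
Definition spectrum q A mu := exists W : 'M[R]_n,
  W *m metric q *m W^T = 1%:M /\
  A = metric q *m W^T *m diag_mx mu *m W *m metric q.

Definition qform A w : R := (w *m A *m w^T) 0 0.

Lemma metric_sym q : (metric q)^T = metric q.
Proof. by rewrite /metric raddfD/= trmx1 trmx_mul trmxK. Qed.

Lemma spectrum_sym q A mu : spectrum q A mu -> A^T = A.
Proof.
move=> [W [_ ->]]; rewrite !trmx_mul metric_sym trmxK tr_diag_mx.
by rewrite !mulmxA.
Qed.

Lemma sqr_mx w : (w *m w^T) 0 0 = \sum_i w 0 i ^+ 2.
Proof. by rewrite mxE; apply: eq_bigr => i _; rewrite mxE expr2. Qed.

Lemma spectrum_qform q A W mu w (c := w *m metric q *m W^T) :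
  W *m metric q *m W^T = 1%:M ->
  A = metric q *m W^T *m diag_mx mu *m W *m metric q ->
  [/\ qform A w = \sum_i mu 0 i * c 0 i ^+ 2,
      qform (metric q) w = \sum_i c 0 i ^+ 2 & w = c *m W].
Proof.
move=> WM ->.
have MW : metric q *m (W^T *m W) = 1%:M.
  by rewrite mulmxA; apply: mulmx1C; rewrite mulmxA.
have cT : c^T = W *m metric q *m w^T by rewrite /c !trmx_mul trmxK metric_sym mulmxA.
split.
- rewrite /qform !mulmxA -/c -2!mulmxA (mulmxA W) -cT mxE.
  apply: eq_bigr => i _; rewrite mul_mx_diag !mxE; ring.
- rewrite -sqr_mx cT /qform /c.
  have -> : w *m metric q *m W^T *m (W *m metric q *m w^T) =
    w *m (metric q *m (W^T *m W)) *m (metric q *m w^T) by rewrite !mulmxA.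
  by rewrite MW mulmx1 mulmxA.
- by rewrite /c -!mulmxA MW mulmx1.
Qed.

Lemma metric_pos q w : w != 0 -> 0 < qform (metric q) w.
Proof.
move=> w0; rewrite /qform /metric mulmxDr mulmx1 mulmxDl mxE sqr_mx.
rewrite mulmxA -mulmxA -{2}(trmxK w) -trmx_mul mxE big_ord1 !mxE -expr2.
rewrite ltr_pwDl ?sqr_ge0//; have [i wi] := rV_neq0 w0.
apply: (@sumr_gt0_at _ _ _ i) => [j|]; first exact: sqr_ge0.
by rewrite exprn_even_gt0.
Qed.

(** Each [mu_i] is the value of the form [A] on a vector of the first basis, and the second basis
    shows the form to be positive. This links the curvature list given by the translator equation
    with the one given by strict convexity. *)
Lemma spectrum_pos q A mu mu' : spectrum q A mu -> spectrum q A mu' ->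
  Gamma_plus mu' -> Gamma_plus mu.
Proof.
move=> [W [WM AE]] [W' [WM' AE']] mu'0 i.
have [e1 e2 e3] := spectrum_qform (row i W) WM AE.
have [e1' e2' e3'] := spectrum_qform (row i W) WM' AE'.
have cE : row i W *m metric q *m W^T = delta_mx 0 i.
  by rewrite -!row_mul WM -row1 .
have n0 : row i W != 0.
  apply/eqP => r0; move: cE; rewrite r0 !mul0mx => /rowP/(_ i).
  by rewrite !mxE !eqxx => /eqP; rewrite eq_sym oner_eq0.
have -> : mu 0 i = qform A (row i W).
  rewrite e1 cE (bigD1 i)//= mxE !eqxx expr1n mulr1 big1 ?addr0// => j ji.
  by rewrite mxE eqxx (negbTE ji) expr0n mulr0.
rewrite e1'; move: e3'; set c := row i W *m metric q *m W'^T => e3'.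
have [j cj] : exists j, c 0 j != 0.
  by apply: rV_neq0; apply: contra_neq n0 => c0; rewrite e3' c0 mul0mx.
apply: (@sumr_gt0_at _ _ _ j) => [k|]; first by rewrite mulr_ge0 ?sqr_ge0 ?ltW.
by rewrite mulr_gt0// exprn_even_gt0.
Qed.

Lemma spectrumZ q A mu (s : R) : spectrum q A mu -> spectrum q (s *: A) (s *: mu).
Proof.
move=> [W [WM ->]]; exists W; split=> //.
have -> : diag_mx (s *: mu) = s *: diag_mx mu by rewrite linearZ.
by rewrite -!(scalemxAr, scalemxAl).
Qed.

Lemma spectrum_rot q A mu (Q : 'M[R]_n) : Q *m Q^T = 1%:M -> spectrum q A mu ->
  spectrum (q *m Q^T) (Q *m A *m Q^T) mu.
Proof.
move=> QQ [W [WM ->]]; exists (W *m Q^T).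
have QQ' : Q^T *m Q = 1%:M by apply: mulmx1C.
have -> : metric (q *m Q^T) = Q *m metric q *m Q^T.
  by rewrite /metric mulmxDr mulmxDl mulmx1 QQ trmx_mul trmxK !mulmxA.
have e1 (B : 'M[R]_n) : Q^T *m (Q *m B) = B by rewrite mulmxA QQ' mul1mx.
by rewrite !trmx_mul trmxK -!mulmxA !e1 mulmxA WM.
Qed.

Lemma sort_perm mu : exists s : 'S_n,
  forall i j : 'I_n, (i <= j)%N -> mu 0 (s j) <= mu 0 (s i).
Proof.
pose t := [tuple mu 0 i | i < n].
have st : size (sort >=%O t) == n by rewrite size_sort size_tuple.
have /tuple_permP[s sE] : perm_eq (Tuple st) t by rewrite perm_sort.
exists s => i j ij.
have nthE (k : 'I_n) : mu 0 (s k) = nth 0 (sort >=%O t) k.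
  rewrite [sort _ _]sE -tnth_nth tnth_mktuple tnth_mktuple//.
have := @sort_sorted R >=%O (fun x y => le_total y x) t.
move=> /(sorted_leq_nth (fun y x z => @ge_trans _ _ y x z) (fun x => lexx x) 0).
rewrite !nthE => /(_ i j); rewrite !inE size_sort size_tuple; exact.
Qed.

(* Courant-Fischer: if the k-th eigenvalues were in the wrong order, the span of
   the first k+1 eigenvectors of [A1] and that of the eigenvectors of [A2] from
   the k-th on would meet, by dimension. *)
Lemma spectrum_le q A1 A2 mu1 mu2 :
  spectrum q A1 mu1 -> spectrum q A2 mu2 ->
  (forall w, qform A1 w <= qform A2 w) ->
  exists s1 s2 : 'S_n, forall k, mu1 0 (s1 k) <= mu2 0 (s2 k).
Proof.
move=> [W1 [WM1 AE1]] [W2 [WM2 AE2]] leA.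
have [s1 hs1] := sort_perm mu1; have [s2 hs2] := sort_perm mu2.
exists s1, s2 => k; rewrite leNgt; apply/negP => lt21.
(* Columns [j < k] say that [w] has no component along the j-th eigenvector of [A2], columns [j > k]
   the same for [A1]. Column [k] is zero, so the determinant vanishes and some nonzero [w] meets all
   conditions. *)
pose K : 'M[R]_n := \matrix_(i, j) (if (j < k)%N then (metric q *m W2^T) i (s2 j)
   else if (k < j)%N then (metric q *m W1^T) i (s1 j) else 0).
have /det0P[w w0 wK] : \det K == 0.
  rewrite (expand_det_col _ k) big1// => i _.
  by rewrite mxE ltnn mul0r.
have wK0 j : \sum_i w 0 i * K i j = 0 by move/rowP: wK => /(_ j); rewrite !mxE.
have [e1 m1 _] := spectrum_qform w WM1 AE1.
have [e2 m2 _] := spectrum_qform w WM2 AE2.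
have := metric_pos q w0; have := leA w; rewrite e1 e2 => le12.
set c1 := w *m metric q *m W1^T in e1 m1 le12 *.
set c2 := w *m metric q *m W2^T in e2 m2 le12 *.
have z1 (j : 'I_n) : (k < j)%N -> c1 0 (s1 j) = 0.
  move=> kj; rewrite -(wK0 j).
  rewrite /c1 -mulmxA mxE; apply: eq_bigr => i _; congr (_ * _).
  by rewrite [RHS]mxE kj ltnNge (ltnW kj).
have z2 (j : 'I_n) : (j < k)%N -> c2 0 (s2 j) = 0.
  move=> kj; rewrite -(wK0 j).
  rewrite /c2 -mulmxA mxE; apply: eq_bigr => i _; congr (_ * _).
  by rewrite [RHS]mxE kj.
have h1 : mu1 0 (s1 k) * qform (metric q) w <= \sum_i mu1 0 i * c1 0 i ^+ 2.
  rewrite m1 mulr_sumr (reindex_inj (@perm_inj _ s1)) [leRHS](reindex_inj (@perm_inj _ s1))/=.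
  apply: ler_sum => j _; have [jk|kj] := leqP j k.
    by rewrite ler_wpM2r ?sqr_ge0// hs1.
  by rewrite z1// expr0n !mulr0.
have h2 : \sum_i mu2 0 i * c2 0 i ^+ 2 <= mu2 0 (s2 k) * qform (metric q) w.
  rewrite m2 mulr_sumr (reindex_inj (@perm_inj _ s2)) [leRHS](reindex_inj (@perm_inj _ s2))/=.
  apply: ler_sum => j _; have [kj|jk] := leqP k j.
    by rewrite ler_wpM2r ?sqr_ge0// hs2.
  by rewrite z2// expr0n !mulr0.
move=> m0; have := le_trans h1 (le_trans le12 h2).
by rewrite leNgt ltr_pM2r// lt21.
Qed.

End spectrum.

(** * Monotonicity of the speed and ellipticity *)

Section speed.
Context {R : realType} {n : nat} {Gamma : set 'rV[R]_n} {f : 'rV[R]_n -> R}.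
Hypothesis hf : admissible Gamma f.

Lemma speed_coord_mono (x : 'rV[R]_n) i (t : R) : 0 <= t ->
  (forall a, 0 <= a <= 1 -> Gamma (x + (a * t) *: delta_mx 0 i)) ->
  f x <= f (x + t *: delta_mx 0 i) /\ (0 < t -> f x < f (x + t *: delta_mx 0 i)).
Proof.
move=> t0 hG.
have [|a a01 E] := @mvt_line R _ f x (delta_mx 0 i) t.
  by move=> a a01; apply: (adm_smooth hf [::] (hG a a01)).1.
have D := adm_incr hf i (hG a a01).
split=> [|tp]; first by rewrite -subr_ge0 E mulr_ge0 // ltW.
by rewrite -subr_gt0 E mulr_gt0.
Qed.

(** The entries are raised one at a time. Starting in the positive cone keeps every intermediate
    point inside [Gamma], which need not be convex. *)
Lemma speed_mono (x y : 'rV[R]_n) : Gamma_plus x ->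
  (forall i, x 0 i <= y 0 i) -> f x <= f y.
Proof.
move=> x0 xy.
pose z k : 'rV[R]_n := \row_i (if (i < k)%N then y 0 i else x 0 i).
suff H k : (k <= n)%N -> f x <= f (z k).
  rewrite (_ : y = z n) ?H//.
  by apply/rowP => i; rewrite mxE ltn_ord.
elim: k => [_|k IH kn].
  by rewrite (_ : z 0%N = x)//; apply/rowP => i; rewrite mxE.
apply: le_trans (IH (ltnW kn)) _.
pose i := Ordinal kn.
have zE a : z k + a *: delta_mx 0 i = \row_j (z k 0 j + a *+ (j == i)).
  by apply/rowP => j; rewrite !mxE eqxx/= mulr_natr.
have -> : z k.+1 = z k + (y 0 i - x 0 i) *: delta_mx 0 i.
  rewrite zE; apply/rowP => j; rewrite !mxE ltnS leq_eqVlt -val_eqE/=.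
  case: eqP => [jk|_] /=.
    have -> : j = i by exact: val_inj.
    by rewrite /= ltnn mulr1n; ring.
  by rewrite mulr0n addr0.
apply: (speed_coord_mono _ _).1; first by rewrite subr_ge0.
move=> a /andP[a0 a1]; apply: (adm_Gamma_plus hf) => j; rewrite zE !mxE.
apply: ltr_pwDl.
  by case: ifP => _; [exact: lt_le_trans (x0 j) (xy j)|exact: x0].
by rewrite mulrn_wge0 // mulr_ge0// subr_ge0.
Qed.

Lemma speed_strict_mono (x y : 'rV[R]_n) i : Gamma_plus x ->
  (forall i, x 0 i <= y 0 i) -> x 0 i < y 0 i -> f x < f y.
Proof.
move=> x0 xy xyi.
have zE a : x + a *: delta_mx 0 i = \row_j (x 0 j + a *+ (j == i)).
  by apply/rowP => j; rewrite !mxE eqxx/= mulr_natr.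
have zp a : 0 <= a -> Gamma_plus (x + a *: delta_mx 0 i).
  by move=> a0 j; rewrite zE mxE ltr_pwDl// mulrn_wge0.
have d0 : 0 < y 0 i - x 0 i by rewrite subr_gt0.
apply: (@lt_le_trans _ _ (f (x + (y 0 i - x 0 i) *: delta_mx 0 i))).
  apply: (speed_coord_mono (ltW d0) _).2 => // a /andP[a0 a1].
  by apply/(adm_Gamma_plus hf)/zp; rewrite mulr_ge0// ltW.
apply: speed_mono; first by apply: zp; rewrite ltW.
move=> j; rewrite zE mxE; case: eqP => [->|_]; rewrite ?mulr1n ?mulr0n ?addr0//.
by rewrite addrC subrK.
Qed.

(** Ellipticity: Courant-Fischer orders the eigenvalues after permutations, and [f] is symmetric. *)
Lemma speed_spectrum_le q A1 A2 mu1 mu2 :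
  spectrum q A1 mu1 -> spectrum q A2 mu2 -> Gamma_plus mu1 -> Gamma_plus mu2 ->
  (forall w, qform A1 w <= qform A2 w) -> f mu1 <= f mu2.
Proof.
move=> S1 S2 p1 p2 leA; have [s1 [s2 H]] := spectrum_le S1 S2 leA.
rewrite -(adm_sym hf s1 (adm_Gamma_plus hf p1)).
rewrite -(adm_sym hf s2 (adm_Gamma_plus hf p2)).
by apply: speed_mono => k; rewrite !mxE.
Qed.

End speed.

(** * Translators are locally graphs *)

Lemma cvg_pair_nbhs {T : Type} {U V : topologicalType} {F : set_system T} {FF : Filter F}
    (f : T -> U) (g : T -> V) (x : U) (y : V) :
  f @ F --> x -> g @ F --> y -> (f t, g t) @[t --> F] --> (x, y).
Proof. by move=> fx gy; exact: (cvg_pair fx gy). Qed.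

(** Where S is the graph of u, the normal is proportional to (Du, -1), so this is Du. *)
Definition grad {R : realType} {n : nat} (nu : ambient R n -> ambient R n) p : 'rV[R]_n :=
  - (nu p).2^-1 *: (nu p).1.

Section local.
Context {R : realType} {n : nat} {S : set (ambient R n)}.
Context {nu : ambient R n -> ambient R n}.
Hypotheses (hS : hypersurface S) (hnu : unit_normal S nu).
Hypothesis hneg : forall p, S p -> (nu p).2 < 0.
Implicit Types (p q : ambient R n) (x y w : 'rV[R]_n).

Definition chart p (Phi : ambient R n -> R) := \forall q \near p,
  [/\ {for q, continuous Phi}, c1_at Phi q, 'D_(0, 1) Phi q != 0,
      S q <-> Phi q = 0 &
      S q -> forall v : ambient R n, 'D_v Phi q = 0 -> dot (nu q) v = 0].

Lemma chart_exists p : S p -> exists Phi, chart p Phi.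
Proof.
move=> Sp; have [U [Phi [Uo Up sm [w Dw] SU]]] := hS.2 p Sp.
exists Phi; have Un : \forall q \near p, U q by exact: open_nbhs_nbhs.
have c1 q : U q -> c1_at Phi q.
  move=> Uq v; split; last exact: (sm [:: v] q Uq).2.
  have : \forall q' \near q, U q' by exact: open_nbhs_nbhs.
  by apply: filterS => q' Uq'; exact: (sm [::] q' Uq').1.
have tan q : U q -> S q -> (exists v, 'D_v Phi q != 0) ->
    forall v : ambient R n, 'D_v Phi q = 0 -> dot (nu q) v = 0.
  move=> Uq Sq vq w' Dw'; apply: (hnu.2 q Sq).2.
  by exists U, Phi.
have E0 : 'D_(0, 1) Phi p != 0.
  apply/eqP => D0; have := tan p Up Sp (ex_intro _ w Dw) _ D0.
  rewrite /dot/= mulr1 /dotr big1 ?add0r; last by move=> i _; rewrite mxE mulr0.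
  by move=> z; have := hneg Sp; rewrite z ltxx.
have En : \forall q \near p, 'D_(0, 1) Phi q != 0.
  have := (c1 p Up (0, 1)).2; move=> /cvgr_neq0; exact.
move: Un En; apply: filterS2 => q Uq Eq; split => //.
- exact: (sm [::] q Uq).2.
- exact: c1.
- exact: SU.
- by move=> Sq; apply: tan => //; exists (0, 1).
Qed.

Lemma chart_slope p Phi w : S p -> chart p Phi ->
  - 'D_(w, 0) Phi p / 'D_(0, 1) Phi p = dotr (grad nu p) w.
Proof.
move=> Sp /nbhs_singleton[_ c1 E0 _ /(_ Sp) tan].
set d := - _ / _.
have : 'D_((w, 0) + d *: (0, 1)) Phi p = 0.
  by rewrite derive_dirD// derive_dirZ// /d mulfVK// subrr.
move=> /tan; rewrite /dot/= scaler0 !addr0 add0r [_ *: 1]mulr1 => E.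
have n0 : (nu p).2 != 0 by rewrite lt_eqF// hneg.
apply: (mulfI n0); apply/eqP; rewrite -subr_eq0; apply/eqP.
rewrite -E addrC; congr (_ + _).
rewrite /dotr mulr_sumr -sumrN; apply: eq_bigr => i _.
by rewrite !mxE; field.
Qed.

Lemma sheet_derive (g : 'rV[R]_n -> R) x w :
  {for x, continuous g} -> (\forall y \near x, S (y, g y)) ->
  is_derive x w g (dotr (grad nu (x, g x)) w).
Proof.
move=> gc gS; have Sx : S (x, g x) by exact: nbhs_singleton gS.
have [Phi ch] := chart_exists Sx.
rewrite -(chart_slope w Sx ch); have [_ c1 E0 _ _] := nbhs_singleton ch.
apply: is_derive_implicit => //.
have yc : (y, g y) @[y --> x] --> (x, g x) by exact: cvg_pair_nbhs (@cvg_id _ (nbhs x)) gc.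
have := yc _ ch; move: gS; apply: filterS2 => y Sy [_ _ _ SP _].
exact/SP.
Qed.

Definition window p (e eta : R) (phi : 'rV[R]_n -> R) :=
  [/\ 0 < e, 0 < eta,
      forall x, ball p.1 e x ->
        [/\ S (x, phi x), `|phi x - p.2| < eta & {for x, continuous phi}]
    & forall x t, ball p.1 e x -> `|t - p.2| < eta -> S (x, t) -> t = phi x].

(** Implicit function theorem by monotonicity. Multiplying [Phi] by its vertical derivative [c] at
    [p] makes it strictly increasing in [t] near [p], whatever the sign of [c]. Zeros over a given
    [x] are then unique, and they persist for nearby [x] by the intermediate value theorem. *)
Lemma window_exists p : S p -> exists e eta phi, window p e eta phi.
Proof.
move=> Sp; have [Phi ch] := chart_exists Sp.
have [_ c1p E0 SP0 _] := nbhs_singleton ch.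
set c := 'D_(0, 1) Phi p in E0.
have Pp0 : Phi p = 0 by exact/SP0.
have pos : \forall q \near p, 0 < c * 'D_(0, 1) Phi q.
  have h : {for p, continuous (fun q => c * 'D_(0, 1) Phi q)}.
    by apply: cvgMl_tmp; exact: (c1p (0, 1)).2.
  have /cvgr_gt : (fun q => c * 'D_(0, 1) Phi q) @ p --> c * c by exact: h.
  by apply; rewrite -expr2 exprn_even_gt0.
have /nbhs_ballP[d /= d0 hd] : \forall q \near p,
   [/\ {for q, continuous Phi}, c1_at Phi q, 0 < c * 'D_(0, 1) Phi q &
      S q <-> Phi q = 0].
  by move: pos ch; apply: filterS2 => q h [? ? ? ? ?].
pose F x t := c * Phi (x, t).
have inb x t : ball p.1 d x -> `|t - p.2| < d -> ball p d (x, t).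
  by move=> px tp; split; [exact: px|rewrite -ball_normE /ball_/= distrC].
have D x t : ball p.1 d x -> `|t - p.2| < d ->
    is_derive t (1 : R) (F x) (c * 'D_(0, 1) Phi (x, t)).
  move=> px tp; have [_ c1 _ _] := hd _ (inb _ _ px tp).
  have /derivableP/is_derive_line : derivable Phi ((x, 0) + t *: (0, 1)) (0, 1).
    rewrite (_ : _ + _ = (x, t)); first exact: c1_at_derivable.
    by apply: injective_projections; rewrite /= ?scaler0 ?addr0// add0r [_ *: 1]mulr1.
  have -> : (x, 0) + t *: (0, 1) = (x, t) :> ambient R n.
    by apply: injective_projections; rewrite /= ?scaler0 ?addr0// add0r [_ *: 1]mulr1.
  have -> : (fun s : R => Phi ((x, 0) + s *: (0, 1))) = (fun s => Phi (x, s)).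
    apply/funext => s; congr Phi.
    by apply: injective_projections; rewrite /= ?scaler0 ?addr0// add0r [_ *: 1]mulr1.
  by move=> /(@is_deriveZ _ _ _ _ c).
have Fmono x s t : ball p.1 d x -> `|s - p.2| < d -> `|t - p.2| < d -> s < t -> F x s < F x t.
  move=> px sp tp st.
  have rng r : s <= r <= t -> `|r - p.2| < d.
    move=> /andP[sr rt]; move: sp tp; rewrite !ltr_norml => /andP[s1 _] /andP[_ t2].
    by apply/andP; split; [exact: lt_le_trans s1 (lerB sr _)|exact: le_lt_trans (lerB rt _) t2].
  have [||r rst E] := @MVT R (F x) (fun r => c * 'D_(0, 1) Phi (x, r)) s t st.
  - move=> r; rewrite in_itv/= => /andP[sr rt]; apply: D => //; apply: rng.
    by rewrite !ltW.
  - apply: derivable_within_continuous => r; rewrite in_itv/= => rst.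
    by have [] := D x r px (rng _ rst).
  rewrite -subr_gt0 E mulr_gt0 ?subr_gt0//.
  move: rst; rewrite in_itv/= => /andP[sr rt].
  have /rng rd : s <= r <= t by rewrite !ltW.
  by have [] := hd _ (inb _ _ px rd).
have SF x t : ball p.1 d x -> `|t - p.2| < d -> S (x, t) <-> F x t = 0.
  move=> px tp; have [_ _ c0 SP] := hd _ (inb _ _ px tp).
  have cn0 : c != 0 by apply: contraTneq c0 => ->; rewrite mul0r ltxx.
  rewrite /F; split=> [/SP->|]; first by rewrite mulr0.
  by move/eqP; rewrite mulf_eq0 (negbTE cn0)/= => /eqP/SP.
have uniq x s t : ball p.1 d x -> `|s - p.2| < d -> `|t - p.2| < d ->
    S (x, s) -> S (x, t) -> s = t.
  move=> px sp tp /(SF _ _ px sp) Fs /(SF _ _ px tp) Ft.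
  case: (ltgtP s t) => // st.
    by have := Fmono x s t px sp tp st; rewrite Fs Ft ltxx.
  by have := Fmono x t s px tp sp st; rewrite Fs Ft ltxx.
(* Stated around any zero in the box and with any precision [ep]: at the centre it gives the
   existence of [phi], elsewhere its continuity. *)
have Loc x0 t0 (ep : R) : ball p.1 d x0 -> `|t0 - p.2| < d -> S (x0, t0) -> 0 < ep ->
    \forall x \near x0, exists2 t, `|t - t0| < ep & S (x, t).
  move=> px0 tp0 Sxt ep0.
  pose ep' := Num.min (ep / 2) ((d - `|t0 - p.2|) / 2).
  have ep'0 : 0 < ep' by rewrite lt_min !divr_gt0// subr_gt0.
  have ep'e : ep' < ep by rewrite gt_min ltr_pdivrMr// ltr_pMr// ltr1n.
  have rng r : `|r - t0| <= ep' -> `|r - p.2| < d.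
    move=> rt; rewrite -(subrKA t0); apply: le_lt_trans (ler_normD _ _) _.
    rewrite addrC -ltrBrDl; apply: le_lt_trans rt _.
    by rewrite gt_min [X in _ || X]ltr_pdivrMr// ltr_pMr ?subr_gt0// ltr1n orbT.
  have r1 : `|t0 - ep' - t0| <= ep' by rewrite addrAC subrr sub0r normrN gtr0_norm.
  have r2 : `|t0 + ep' - t0| <= ep' by rewrite addrAC subrr add0r gtr0_norm.
  have F0 : F x0 t0 = 0 by exact/SF.
  have cF t : `|t - t0| <= ep' -> F x t @[x --> x0] --> F x0 t.
    move=> tt; have [Pc _ _ _] := hd _ (inb _ _ px0 (rng _ tt)).
    have xt : (x, t) @[x --> x0] --> (x0, t).
      exact: (cvg_pair_nbhs (@cvg_id _ (nbhs x0)) (cvg_cst t)).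
    exact: cvgMl_tmp (cvg_comp _ _ xt Pc).
  have n1 : \forall x \near x0, F x (t0 - ep') < 0.
    move/cvgr_lt: (cF _ r1); apply; rewrite -F0; apply: Fmono => //; first exact: rng.
    by rewrite ltrBlDr ltrDl.
  have n2 : \forall x \near x0, 0 < F x (t0 + ep').
    move/cvgr_gt: (cF _ r2); apply; rewrite -F0; apply: Fmono => //; first exact: rng.
    by rewrite ltrDl.
  have n3 : \forall x \near x0, ball p.1 d x.
    by apply: open_nbhs_nbhs; split => //; exact: ball_open.
  move: n1 n2 n3; apply: filter_app3; near=> x => f1 f2 px.
  have rI t : t \in `[t0 - ep', t0 + ep'] -> `|t - t0| <= ep'.
    by rewrite in_itv/= ler_distl.
  have [|||t tI Ft] := @IVT R (F x) (t0 - ep') (t0 + ep') 0.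
  - by rewrite lerD2l ge0_cp// ltW.
  - apply: derivable_within_continuous => r /rI rt.
    by have [] := D x r px (rng _ rt).
  - rewrite ge_min le_max (ltW f1) (ltW f2) orbT//.
  exists t; first exact: le_lt_trans (rI _ tI) ep'e.
  by apply/SF => //; apply/rng/rI.
have p1 : ball p.1 d p.1 by exact: ballxx.
have d20 : 0 < d / 2 by rewrite divr_gt0.
have d2d : d / 2 < d by rewrite ltr_pdivrMr// ltr_pMr// ltr1n.
have p2 : `|p.2 - p.2| < d by rewrite subrr normr0.
have Sp' : S (p.1, p.2) by case: (p) Sp.
have /nbhs_ballP[e /= e0 he] := Loc p.1 p.2 (d / 2) p1 p2 Sp' d20.
pose phi x := xget 0 [set t | `|t - p.2| < d / 2 /\ S (x, t)].
have phiP x : ball p.1 (Num.min e d) x ->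
    [/\ ball p.1 d x, S (x, phi x) & `|phi x - p.2| < d / 2].
  move=> px; have [t t1 t2] : exists2 t, `|t - p.2| < d / 2 & S (x, t).
    by apply: he; apply: le_ball px; rewrite ge_min lexx.
  have [] : [set t | `|t - p.2| < d / 2 /\ S (x, t)] (phi x) by apply: xgetPex; exists t.
  by split=> //; apply: le_ball px; rewrite ge_min lexx orbT.
exists (Num.min e d), (d / 2), phi; split => //.
- by rewrite lt_min e0.
- move=> x px; have [pd Sx xd] := phiP x px; split=> //.
  rewrite /prop_for/continuous_at; apply/(@cvgrPdist_lt _ _ _ (nbhs x)) => ep ep0.
  pose ep' := Num.min ep (d / 2 - `|phi x - p.2|).
  have ep'0 : 0 < ep' by rewrite lt_min ep0 subr_gt0.
  have n1 := Loc x (phi x) ep' pd (lt_trans xd d2d) Sx ep'0.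
  have n2 : \forall y \near x, ball p.1 (Num.min e d) y.
    by apply: open_nbhs_nbhs; split => //; exact: ball_open.
  move: n1 n2; apply: filterS2 => y [t t1 Sy] /phiP[yd Sy' yd'].
  have -> : phi y = t.
    apply: (uniq y) => //; first exact: lt_trans d2d.
    apply: lt_trans d2d; rewrite -(subrKA (phi x)); apply: le_lt_trans (ler_normD _ _) _.
    by rewrite -ltrBrDr; apply: lt_le_trans t1 _; rewrite ge_min lexx orbT.
  by rewrite distrC; apply: lt_le_trans t1 _; rewrite ge_min lexx.
- move=> x t px tp Sx; have [xd Sx' px'] := phiP x px.
  by apply: (uniq x) => //; apply: lt_trans d2d.
Unshelve. all: by end_near. Qed.

End local.

(** * The Hessian of a sheet and the principal curvatures *)

Lemma is_derive_inv {R : realType} (V : normedModType R) (f : V -> R) x v t :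
  f x != 0 -> is_derive x v f t ->
  is_derive x v (fun y => (f y)^-1) (- (f x) ^- 2 *: t).
Proof.
move=> fx0 [fd <-]; split; first exact: derivableV.
by rewrite deriveV.
Qed.

Lemma is_derive_row {R : realType} (V : normedModType R) n (G : V -> 'rV[R]_n) x v
    (z : 'rV[R]_n) :
  (forall k, is_derive x v (fun y => G y 0 k) (z 0 k)) -> is_derive x v G z.
Proof.
move=> Gk; have Gd : derivable G x v.
  by apply/derivable_mxP => i k; rewrite (ord1 i); have [] := Gk k.
split=> //; rewrite derive_mx//; apply/rowP => k; rewrite mxE.
by have [_ <-] := Gk k.
Qed.

Lemma is_derive_coord {R : realType} (V : normedModType R) n (G : V -> 'rV[R]_n) x v
    (z : 'rV[R]_n) k :
  is_derive x v G z -> is_derive x v (fun y => G y 0 k) (z 0 k).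
Proof.
move=> [Gd <-]; rewrite derive_mx// mxE; apply: derivableP.
by move/derivable_mxP: Gd; exact.
Qed.

Lemma dotrC {R : realType} n (x y : 'rV[R]_n) : dotr x y = dotr y x.
Proof. by apply: eq_bigr => i _; rewrite mulrC. Qed.

Lemma dotr_mx {R : realType} n (x y : 'rV[R]_n) : dotr x y = (x *m y^T) 0 0.
Proof. by rewrite mxE; apply: eq_bigr => i _; rewrite mxE. Qed.

Lemma dotr_sumr {R : realType} n (I : finType) (x : 'rV[R]_n) (c : I -> R) (v : I -> 'rV[R]_n) :
  dotr x (\sum_i c i *: v i) = \sum_i c i * dotr x (v i).
Proof.
rewrite dotr_mx raddf_sum/= mulmx_sumr summxE; apply: eq_bigr => i _.
by rewrite linearZ/= -scalemxAr mxE dotr_mx.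
Qed.

Section curvature.
Context {R : realType} {n : nat} {S : set (ambient R n)}.
Context {nu : ambient R n -> ambient R n}.
Hypotheses (hS : hypersurface S) (hnu : unit_normal S nu).
Hypothesis hneg : forall p, S p -> (nu p).2 < 0.
Implicit Types (p : ambient R n) (x y w : 'rV[R]_n).
Implicit Types (U : set (ambient R n)) (N : ambient R n -> ambient R n).
Variables (g : 'rV[R]_n -> R) (x : 'rV[R]_n).
Hypotheses (gc : {for x, continuous g}) (gS : \forall y \near x, S (y, g y)).
Let p := (x, g x).
Let q := grad nu p.

(** Moving [x] along [w] moves the point of the graph along the tangent vector [(w, <q, w>)]. On the
    graph [nu] coincides with its smooth extension [N], to which the chain rule applies with [rho]
    the increment of [g]. *)
Lemma normal_derive U N w (L : ambient R n -> R) :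
  (forall a (y z : ambient R n), L (a *: (y - z)) = a * (L y - L z)) -> continuous L ->
  smooth_extension S nu p U N ->
  is_derive x w (fun y => L (nu (y, g y))) (L ('D_(w, dotr q w) N p)).
Proof.
move=> Ll Lc [Uo Up sm NE].
have c1 : c1_at (L \o N) p by exact: smooth_on_c1 sm.
have gd := sheet_derive hS hnu hneg w gc gS.
have yc : (y, g y) @[y --> x] --> p by exact: cvg_pair_nbhs (@cvg_id _ (nbhs x)) gc.
have Un : \forall y \near x, U (y, g y).
  by apply: yc; apply: open_nbhs_nbhs.
have e1 : L ('D_(w, dotr q w) N p) = 'D_(w, dotr q w) (L \o N) p.
  have := derive_functional Ll Lc (derivableP ((sm [::] p Up).1 (w, dotr q w))).
  by case.
rewrite e1; apply: (@near_eq_is_derive _ _ _ (fun y => L (N (y, g y)))).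
  by move: Un gS; apply: filterS2 => y Uy Sy; rewrite NE.
have -> : (w, dotr q w) = (w, 0) + dotr q w *: (0, 1) :> ambient R n.
  by apply: injective_projections; rewrite /= ?scaler0 ?addr0// add0r [_ *: 1]mulr1.
rewrite derive_dirD// derive_dirZ//.
have gd0 : is_derive (0:R) (1:R) (fun t : R => g (x + t *: w) - g x) (dotr q w).
  rewrite -[dotr q w]subr0; apply: is_deriveB.
    by apply: (is_derive_line g x w 0 _).1; rewrite scale0r addr0.
have rho0 : g (x + (0:R) *: w) - g x = 0 by rewrite scale0r addr0 subrr.
have := chain2 (derivableP (@c1_at_derivable _ _ _ _ (w, 0) c1)) (c1 (0, 1)).1
   (c1 (0, 1)).2 rho0 gd0.
have -> : (fun t : R => (L \o N) (p + t *: (w, 0) + (g (x + t *: w) - g x) *: (0, 1))) =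
   (fun t : R => (fun y => L (N (y, g y))) (x + t *: w)).
  apply/funext => t /=; congr (L (N _)).
  apply: injective_projections => /=; first by rewrite scaler0 addr0.
  by rewrite [t *: 0]mulr0 addr0 [_ *: 1]mulr1 addrC subrK.
move=> H; have := (is_derive_line (fun y => L (N (y, g y))) x w 0 _).2 H.
by rewrite scale0r addr0.
Qed.

Let L1 k (p : ambient R n) := p.1 0 k.

Let L1l k a (y z : ambient R n) : L1 k (a *: (y - z)) = a * (L1 k y - L1 k z).
Proof. by rewrite /L1 !mxE. Qed.

Let L1c k : continuous (L1 k).
Proof.
move=> z; apply: (@cvg_comp _ _ _ fst (fun M : 'rV[R]_n => M 0 k)); first exact: cvg_fst.
exact: coord_continuous.
Qed.

Let L2l a (y z : ambient R n) : (a *: (y - z)).2 = a * (y.2 - z.2).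
Proof. by []. Qed.

Let L2c : continuous (snd : ambient R n -> R).
Proof. by move=> z; exact: cvg_snd. Qed.

Let n2 := (nu p).2.
Let Sp : S p.
Proof. exact: nbhs_singleton gS. Qed.

Let n20 : n2 != 0.
Proof. by rewrite lt_eqF//; exact: (hneg Sp). Qed.

Lemma grad_derive U N w : smooth_extension S nu p U N ->
  is_derive x w (fun y => grad nu (y, g y))
   (- n2^-1 *: (('D_(w, dotr q w) N p).1 + ('D_(w, dotr q w) N p).2 *: q)).
Proof.
move=> ext; apply: is_derive_row => k.
have d1 := normal_derive w (@L1l k) (@L1c k) ext.
have d2 := normal_derive w L2l L2c ext.
set b := 'D_(_, _) N p in d1 d2 *.
have d3 := @is_derive_inv _ _ (fun y => (nu (y, g y)).2) x w _ n20 d2.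
have -> : (fun y => grad nu (y, g y) 0 k) =
  - ((fun y => ((nu (y, g y)).2)^-1) * (fun y => L1 k (nu (y, g y)))).
  by apply/funext => y; rewrite /grad mxE/= mulNr.
apply: is_derive_eq; rewrite /L1 !mxE /n2 /p; have := n20; rewrite /n2 /p.
move: (nu (x, g x)).2 ((nu (x, g x)).1 0 k) b.1 b.2 => m m' b1 b2 m0.
by rewrite /GRing.scale/=; field.
Qed.

Lemma normal_extension : exists U N, smooth_extension S nu p U N.
Proof. exact: hnu.1 Sp. Qed.

(** [A] is the Hessian of [g]. Its linearity in [w] comes from the smooth extension of the normal,
    since [(w, <q, w>)] is linear in [w]. *)
Lemma grad_derive_mx : exists A : 'M[R]_n,
  forall w, is_derive x w (fun y => grad nu (y, g y)) (w *m A).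
Proof.
have [U [N ext]] := normal_extension.
have [D [DE Dd]] : exists D : 'rV[R]_n -> 'rV[R]_n, (forall w k, D w 0 k = - n2^-1 *
    (L1 k ('D_(w, dotr q w) N p) + ('D_(w, dotr q w) N p).2 * q 0 k)) /\
    forall w, is_derive x w (fun y => grad nu (y, g y)) (D w).
  exists (fun w => - n2^-1 *: (('D_(w, dotr q w) N p).1 + ('D_(w, dotr q w) N p).2 *: q)).
  split=> [w k|w]; last exact: grad_derive ext.
  by rewrite [LHS]mxE; congr (_ * _); rewrite [LHS]mxE; congr (_ + _); exact: mxE.
exists (\matrix_j D (delta_mx 0 j)) => w.
have -> : w *m \matrix_j D (delta_mx 0 j) = D w; last exact: Dd.
have [Uo Up sm NE] := ext.
have wE : w = \sum_j w 0 j *: delta_mx 0 j by exact: row_sum_delta.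
have lin (L : ambient R n -> R) :
    (forall a (y z : ambient R n), L (a *: (y - z)) = a * (L y - L z)) -> continuous L ->
    L ('D_(w, dotr q w) N p) =
    \sum_j w 0 j * L ('D_(delta_mx 0 j, dotr q (delta_mx 0 j)) N p).
  move=> Ll Lc; have c1 : c1_at (L \o N) p by exact: smooth_on_c1 sm.
  have e1 v : L ('D_v N p) = 'D_v (L \o N) p.
    by have := derive_functional Ll Lc (derivableP ((sm [::] p Up).1 v)); case.
  under eq_bigr do rewrite e1.
  rewrite e1 -(derive_dir_sum _ _ c1); congr ('D_ _ _ _).
  apply: injective_projections.
    by rewrite raddf_sum/= [LHS]wE.
  by rewrite raddf_sum/= [in LHS]wE dotr_sumr.
apply/rowP => k; rewrite [LHS]mxE DE.
rewrite (lin _ (@L1l k) (@L1c k)) (lin _ L2l L2c) mulr_suml -big_split mulr_sumr.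
by apply: eq_bigr => j _; rewrite [X in _ * X]mxE DE /=; ring.
Qed.

(** A tangent vector is [(w, <q, w>)], so the horizontal parts of an orthonormal principal frame are
    orthonormal for the metric. Differentiating [q = - nu_1 / nu_2] turns [d nu(v) = lam v] into
    [w A = - (lam / nu_2) w metric]. *)
Lemma curvature_spectrum A lam :
  (forall w, is_derive x w (fun y => grad nu (y, g y)) (w *m A)) ->
  principal_curvatures S nu p lam -> spectrum q A (- n2^-1 *: lam).
Proof.
move=> dA [v [vt vo vd]].
have n0 := n20.
pose W : 'M[R]_n := \matrix_i (v i).1.
have vE i : v i = ((v i).1, dotr q (v i).1).
  have := (hnu.2 p Sp).2 (v i); move=> /(_ (vt i)); rewrite /dot => E.
  apply: injective_projections => //=; apply: (mulfI n0).
  apply/eqP; rewrite -subr_eq0 -E addrC; apply/eqP; congr (_ + _).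
  rewrite /dotr mulr_sumr -sumrN; apply: eq_bigr => j _.
  by rewrite /q/grad !mxE -/n2; field.
have wA i : (v i).1 *m A = (- n2^-1 * lam 0 i) *: ((v i).1 *m metric q).
  have [U [N [ext DN]]] := vd i.
  have := grad_derive (v i).1 ext; rewrite -vE DN => -[_ E].
  have [_ E'] := dA (v i).1; rewrite -E' E.
  have -> : (lam 0 i *: v i).1 = lam 0 i *: (v i).1 by [].
  have -> : (lam 0 i *: v i).2 = lam 0 i * dotr q (v i).1 by rewrite {1}vE.
  rewrite /metric mulmxDr mulmx1 -[RHS]scalerA; congr (_ *: _).
  rewrite [RHS]scalerDr -scalerA; congr (_ + _ *: _).
  by rewrite mulmxA dotrC dotr_mx; apply/rowP => k; rewrite mxE [RHS]mxE big_ord1.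
have WM : W *m metric q *m W^T = 1%:M.
  apply/matrixP => i j; rewrite [RHS]mxE -vo /dot (vE i) (vE j)/=.
  rewrite /metric mulmxDr mulmxDl mulmx1 mxE; congr (_ + _).
    by rewrite mxE; apply: eq_bigr => k _; rewrite !mxE.
  rewrite mulmxA -mulmxA mxE big_ord1 dotrC.
  congr (_ * _); rewrite mxE; apply: eq_bigr => k _; rewrite !mxE//.
exists W; split => //.
have WA : W *m A = diag_mx (- n2^-1 *: lam) *m W *m metric q.
  apply/row_matrixP => i; rewrite !row_mul row_diag_mx -!mulmxA -scalemxAl -rowE.
  by rewrite [in RHS]row_mul !rowK wA [in RHS]mxE.
have MW : metric q *m W^T *m W = 1%:M by apply: mulmx1C; rewrite mulmxA.
by rewrite -[LHS]mul1mx -MW -mulmxA WA !mulmxA.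
Qed.

(** The factor [- 1 / nu_2] is positive, so homogeneity gives [f mu = - f lam / nu_2 = 1]. The lists
    [lam] and [lam'] may differ, and positivity passes from one to the other through the common form
    [A]. *)
Lemma sheet_curvature (Gamma : set 'rV[R]_n) f :
  admissible Gamma f -> strictly_convex S nu -> translator Gamma f S nu ->
  exists A mu, [/\ forall w, is_derive x w (fun y => grad nu (y, g y)) (w *m A),
    spectrum q A mu, Gamma_plus mu & f mu = 1].
Proof.
move=> hf hconv htr; have [A dA] := grad_derive_mx.
have [lam [pc Gl fl]] := htr p Sp.
have [lam' [pc' Gl']] := hconv p Sp.
have sp := curvature_spectrum dA pc; have sp' := curvature_spectrum dA pc'.
have s0 : 0 < - n2^-1 by rewrite -invrN invr_gt0 oppr_gt0; exact: hneg Sp.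
exists A, (- n2^-1 *: lam); split=> //.
  by apply: (spectrum_pos sp sp') => i; rewrite mxE mulr_gt0.
rewrite (adm_homog hf)// fl /dot/= mulr1 /dotr big1 ?add0r; last by move=> i _; rewrite mxE mulr0.
by rewrite mulrNN mulVf// n20.
Qed.
End curvature.

(** * Curve length and completeness *)

Section length.
Context {R : realType} {n : nat}.
Implicit Types (S : set (ambient R n)) (p q : ambient R n).
Local Notation mu := (@lebesgue_measure R).

Lemma integral_derive (H dH : R -> R) : (forall t, is_derive t (1 : R) H (dH t)) ->
  continuous dH -> (\int[mu]_(t in `[0%R, 1%R]) (dH t)%:E = (H 1 - H 0)%:E)%E.
Proof.
move=> HD dHc; have Hc : continuous H.
  by move=> t; have [/derivable1_diffP/differentiable_continuous] := HD t.
rewrite (@continuous_FTC2 _ dH H)//.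
- exact: continuous_subspaceT.
- split.
  + by move=> t _; have [] := HD t.
  + by apply: cvg_at_right_filter; exact: Hc.
  + by apply: cvg_at_left_filter; exact: Hc.
- by move=> t _; rewrite derive1E; have [_ ->] := HD t.
Qed.

Lemma le_integral_continuous (a b : R -> R) : continuous a -> continuous b ->
  (forall t, 0 <= t <= 1 -> a t <= b t) ->
  (\int[mu]_(t in `[0%R, 1%R]) (a t)%:E <= \int[mu]_(t in `[0%R, 1%R]) (b t)%:E)%E.
Proof.
move=> ac bc ab; apply: le_integral => //.
- apply: continuous_compact_integrable; first exact: segment_compact.
  exact: continuous_subspaceT.
- apply: continuous_compact_integrable; first exact: segment_compact.
  exact: continuous_subspaceT.
- by move=> t; rewrite inE/= in_itv/= => t01; rewrite lee_fin ab.
Qed.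

Lemma sum_continuous {T : topologicalType} {W : normedModType R} (I : Type) (r : seq I)
    (F : I -> T -> W) :
  (forall i, continuous (F i)) -> continuous (fun x => \sum_(i <- r) F i x).
Proof.
move=> Fc; elim: r => [|i r IH] x.
  have -> : (fun x => \sum_(i <- [::]) F i x) = cst 0.
    by apply/funext => y; rewrite big_nil.
  exact: cst_continuous.
have -> : (fun x => \sum_(j <- i :: r) F j x) = (fun x => F i x + \sum_(j <- r) F j x).
  by apply/funext => y; rewrite big_cons.
by apply: cvgD; [exact: Fc|exact: IH].
Qed.

Lemma enorm_continuous : continuous (@enorm R n).
Proof.
move=> p; apply: (@cvg_comp _ _ _ (fun p => dot p p) Num.sqrt); last exact: sqrt_continuous.
apply: cvgD; last by apply: cvgM; exact: cvg_snd.
apply: (@sum_continuous (ambient R n) _ _ _ (fun i (p : ambient R n) => p.1 0 i * p.1 0 i)).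
have c i : continuous (fun p : ambient R n => p.1 0 i).
  by move=> z; apply: (@cvg_comp _ _ _ fst (fun M : 'rV[R]_n => M 0 i));
    [exact: cvg_fst|exact: coord_continuous].
by move=> i z; apply: cvgM; exact: c.
Qed.

Lemma dotr_ge0 m (x : 'rV[R]_m) : 0 <= dotr x x.
Proof. by apply: sumr_ge0 => i _; rewrite -expr2 sqr_ge0. Qed.

Lemma coord_sqr_le m (x : 'rV[R]_m) i : x 0 i ^+ 2 <= dotr x x.
Proof.
rewrite /dotr (bigD1 i)//= -expr2 lerDl sumr_ge0// => j _.
by rewrite -expr2 sqr_ge0.
Qed.

Lemma coord_le_enorm (p : ambient R n) i : `|p.1 0 i| <= enorm p.
Proof.
rewrite -sqrtr_sqr /enorm ler_sqrt; last by rewrite addr_ge0 ?dotr_ge0// -expr2 sqr_ge0.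
by rewrite /dot ler_wpDr ?coord_sqr_le// -expr2 sqr_ge0.
Qed.

Lemma snd_le_enorm (p : ambient R n) : `|p.2| <= enorm p.
Proof.
rewrite -sqrtr_sqr /enorm ler_sqrt; last by rewrite addr_ge0 ?dotr_ge0// -expr2 sqr_ge0.
by rewrite /dot expr2 ler_wpDl ?dotr_ge0.
Qed.

(** Along a curve, the increment of [L] is the integral of [L] of the velocity, hence at most the
    length. Applied to coordinates, it turns intrinsic convergence into convergence in the ambient
    space. *)
Lemma functional_le_dist S p q (L : ambient R n -> R) :
  (forall a (y z : ambient R n), L (a *: (y - z)) = a * (L y - L z)) -> continuous L ->
  (forall z, `|L z| <= enorm z) ->
  (`|L p - L q|%:E <= intrinsic_dist S p q)%E.
Proof.
move=> Ll Lc Le; apply: le_ereal_inf_tmp => _ [c [cd cc cS <- <-] <-].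
have d t : is_derive t (1 : R) (fun t => L (c t)) (L (derive1 c t)).
  by rewrite derive1E; apply: (derive_functional Ll Lc); apply: derivableP.
have Lcc : continuous (fun t => L (derive1 c t)).
  by move=> t; apply: (@cvg_comp _ _ _ (derive1 c) L); [exact: cc|exact: Lc].
have ec : continuous (fun t => enorm (derive1 c t)).
  by move=> t; apply: (@cvg_comp _ _ _ (derive1 c) (@enorm R n));
    [exact: cc|exact: enorm_continuous].
have := integral_derive d Lcc.
case: (ler0P (L (c 0) - L (c 1))) => s0 E.
  rewrite opprB -E; apply: le_integral_continuous => // t _.
  exact: le_trans (ler_norm _) (Le _).
have d' t : is_derive t (1 : R) (fun t => - L (c t)) (- L (derive1 c t)).
  by apply: is_deriveN.
have Lcc' : continuous (fun t => - L (derive1 c t)).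
  by move=> t; apply: cvgN; exact: Lcc.
have := integral_derive d' Lcc'; rewrite opprK addrC => <-.
apply: le_integral_continuous => // t _.
by apply: le_trans (Le _); rewrite -normrN ler_norm.
Qed.

Lemma is_derive_pair (V W : normedModType R) (a : R -> V) (b : R -> W) t da db :
  is_derive t (1 : R) a da -> is_derive t (1 : R) b db ->
  is_derive t (1 : R) (fun s => (a s, b s)) (da, db).
Proof.
move=> [ad <-] [bd <-].
have L := cvg_pair_nbhs ad bd.
by split; [apply/cvg_ex; eexists; exact: L|apply/cvg_lim => //; exact: L].
Qed.

End length.

Section graph_path.
Context {R : realType} {n : nat}.
Variables (S : set (ambient R n)) (y e : 'rV[R]_n) (G dG : R -> R) (m : R).
Hypothesis e1 : dotr e e = 1.
(** With K = 1 + 2|m| and G' <= m one has K - 2G' >= 1, hence sqrt(1 + G'^2) <= K - G' = F'. So [F]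
    dominates arc length even where G' is very negative. *)
Let F (t : R) : R := (1 + 2 * `|m|) * t - G t.

(* A parametrisation of [[t1, t2]] that never leaves it, so that curves defined
   only over that segment give C^1 curves on the whole line. *)
Let theta (t1 t2 s : R) := t1 + (t2 - t1) * ((1 - cos (pi * s)) / 2).

Let theta_derive t1 t2 s :
  is_derive s (1 : R) (theta t1 t2) ((t2 - t1) * (pi * sin (pi * s) / 2)).
Proof.
have d0 : is_derive s (1 : R) (fun s : R => pi * s) (pi : R).
  have -> : (fun s : R => pi * s) = (fun s => s * pi) by apply/funext => z; rewrite mulrC.
  exact: is_derive_mulr.
have d1 : is_derive s (1 : R) (fun s : R => cos (pi * s)) (- sin (pi * s) * pi).
  exact: (@is_derive1_comp R cos (fun s => pi * s)).
have d2 : is_derive s (1 : R) (fun s : R => ((t2 + t1) / 2) + (- ((t2 - t1) / 2)) *: cos (pi * s))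
    (0 + (- ((t2 - t1) / 2)) *: (- sin (pi * s) * pi)).
  by apply: is_deriveD.
have -> : theta t1 t2 = (fun s : R => ((t2 + t1) / 2) + (- ((t2 - t1) / 2)) *: cos (pi * s)).
  by apply/funext => z; rewrite /theta /GRing.scale/=; field.
apply: is_derive_eq; rewrite /GRing.scale/=; by field.
Qed.

Let theta0 t1 t2 : theta t1 t2 0 = t1.
Proof. by rewrite /theta mulr0 cos0 subrr mul0r mulr0 addr0. Qed.

Let theta1 t1 t2 : theta t1 t2 1 = t2.
Proof. by rewrite /theta mulr1 cospi; field. Qed.

Let theta_in lo hi t1 t2 s : lo <= t1 <= hi -> lo <= t2 <= hi ->
  lo <= theta t1 t2 s <= hi.
Proof.
move=> /andP[a1 b1] /andP[a2 b2]; rewrite /theta.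
have := cos_le1 (pi * s); have := cos_geN1 (pi * s); move: (cos _) => c c1 c2.
set l := _ / 2; have l0 : 0 <= l by rewrite divr_ge0// subr_ge0.
have l1 : 0 <= 1 - l by rewrite /l; lra.
have -> : t1 + (t2 - t1) * l = (1 - l) * t1 + l * t2 by ring.
apply/andP; split.
  have -> : lo = (1 - l) * lo + l * lo by ring.
  by apply: lerD; apply: ler_wpM2l.
have -> : hi = (1 - l) * hi + l * hi by ring.
by apply: lerD; apply: ler_wpM2l.
Qed.

(** The speed of the graph is at most the derivative of [F], and [theta] runs monotonically from
    [t1] to [t2], so the bound integrates to a difference of values of [F]. The sign [sg] covers the
    case [t2 < t1]. *)
Lemma graph_path_dist (lo hi t1 t2 : R) : lo <= t1 <= hi -> lo <= t2 <= hi ->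
  (forall t, lo <= t <= hi -> [/\ is_derive t (1 : R) G (dG t), {for t, continuous dG},
     S (y + t *: e, G t) & dG t <= m]) ->
  (intrinsic_dist S (y + t1 *: e, G t1)%R (y + t2 *: e, G t2)%R <= (`|F t2 - F t1|%R)%:E)%E.
Proof.
move=> t1I t2I H.
pose th := theta t1 t2.
have thI s : lo <= th s <= hi by exact: theta_in.
pose dth s := (t2 - t1) * (pi * sin (pi * s) / 2).
have thd s : is_derive s (1 : R) th (dth s) by exact: theta_derive.
have thc : continuous th.
  by move=> s; have [/derivable1_diffP/differentiable_continuous] := thd s.
have dthc : continuous dth.
  move=> s; apply: cvgMl_tmp; apply: cvgMr_tmp; apply: cvgMl_tmp.
  apply: (@cvg_comp _ _ _ (fun s => pi * s) sin); last exact: continuous_sin.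
  by apply: cvgMl_tmp; exact: cvg_id.
have Gd s : is_derive s (1 : R) (G \o th) (dG (th s) * dth s).
  have [Gd _ _ _] := H _ (thI s).
  exact: is_derive1_comp.
have dGc : continuous (fun s => dG (th s)).
  move=> s; apply: (@cvg_comp _ _ _ th dG); first exact: thc.
  by have [_ + _ _] := H _ (thI s).
have dGthc : continuous (fun s => dG (th s) * dth s).
  by move=> s; apply: cvgM; [exact: dGc|exact: dthc].
pose c s : ambient R n := (y + th s *: e, G (th s)).
have cd s : is_derive s (1 : R) c (dth s *: e, dG (th s) * dth s).
  suff Ad : is_derive s (1 : R) (fun s => y + th s *: e) (dth s *: e).
    exact: (is_derive_pair Ad (Gd s)).
  apply: is_derive_row => k; rewrite mxE.
  have -> : (fun s => (y + th s *: e) 0 k) = (fun s => y 0 k + e 0 k *: th s).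
    by apply/funext => z; rewrite !mxE mulrC.
  rewrite -[dth s * _]add0r [dth s * _]mulrC.
  by apply: is_deriveD.
have cE : derive1 c = fun s => (dth s *: e, dG (th s) * dth s).
  by apply/funext => s; rewrite derive1E; have [_ ->] := cd s.
have cC : C1_curve S (y + t1 *: e, G t1) (y + t2 *: e, G t2) c.
  split.
  - by move=> s; have [] := cd s.
  - rewrite cE => s; apply: cvg_pair_nbhs; last exact: dGthc.
    by apply: cvgZr_tmp; exact: dthc.
  - by move=> s _; have [] := H _ (thI s).
  - by rewrite /c /th theta0.
  - by rewrite /c /th theta1.
apply: (@le_trans _ _ (curve_length c)).
  by apply: ereal_inf_lbound; exists c.
pose sg : R := if t1 <= t2 then 1 else -1.
pose K := 1 + 2 * `|m|.
have Hd s : is_derive s (1 : R) (fun s => sg *: (K *: th s - (G \o th) s))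
    (sg *: (K *: dth s - dG (th s) * dth s)).
  have h1 := is_deriveZ K (thd s); have h2 := is_deriveB h1 (Gd s).
  exact: (is_deriveZ sg h2).
have Hc : continuous (fun s => sg *: (K *: dth s - dG (th s) * dth s)).
  move=> s; apply: cvgZl_tmp; apply: cvgB; last exact: dGthc.
  by apply: cvgZl_tmp; exact: dthc.
have ec : continuous (fun s => enorm (derive1 c s)).
  move=> s; apply: (@cvg_comp _ _ _ (derive1 c) (@enorm R n)); last exact: enorm_continuous.
  by have [_ + _ _ _] := cC; exact.
apply: (@le_trans _ _ (sg *: (K *: th 1 - (G \o th) 1) - sg *: (K *: th 0 - (G \o th) 0))%:E).
  rewrite -(integral_derive Hd Hc); apply: le_integral_continuous => // s s01.
  have -> : derive1 c s = (dth s *: e, dG (th s) * dth s) by rewrite cE.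
  have d0 : 0 <= sg * dth s.
    rewrite /dth mulrA mulr_ge0//.
      rewrite /sg; case: ifPn => [|]; rewrite ?mul1r ?subr_ge0// -ltNge => /ltW.
      by rewrite mulN1r oppr_ge0 subr_le0.
    rewrite divr_ge0// mulr_ge0 ?pi_ge0// sin_ge0_pi//.
    by move/andP: s01 => [s0 s1]; rewrite mulr_ge0 ?pi_ge0//= ler_piMr// pi_ge0.
  have da : `|dth s| = sg * dth s.
    rewrite -(ger0_norm d0) [RHS]normrM /sg; case: ifP => _; by rewrite ?normrN normr1 mul1r.
  have [_ _ _ dm] := H _ (thI s).
  have -> : enorm (dth s *: e, dG (th s) * dth s) = Num.sqrt (1 + dG (th s) ^+ 2) * `|dth s|.
    rewrite /enorm /dot/=.
    have -> : dotr (dth s *: e) (dth s *: e) = dth s ^+ 2.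
      rewrite -[RHS]mulr1 -e1 /dotr mulr_sumr; apply: eq_bigr => i _.
      by rewrite !mxE; ring.
    have -> : dth s ^+ 2 + dG (th s) * dth s * (dG (th s) * dth s) =
       (1 + dG (th s) ^+ 2) * dth s ^+ 2 by ring.
    by rewrite sqrtrM ?sqrtr_sqr// addr_ge0// sqr_ge0.
  have -> : sg *: (K *: dth s - dG (th s) * dth s) = (K - dG (th s)) * `|dth s|.
    by rewrite da /GRing.scale/=; ring.
  apply: ler_wpM2r => //.
  have mm : m <= `|m| by exact: ler_norm.
  have m0 : 0 <= `|m| by [].
  rewrite -[leRHS]ger0_norm; last by rewrite /K; lra.
  rewrite -sqrtr_sqr; apply: ler_wsqrtr.
  by rewrite /K; nra.
rewrite lee_fin /th /= theta0 theta1.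
rewrite -scalerBr; apply: le_trans (ler_norm _) _.
by rewrite normrZ /sg; case: ifP => _; rewrite ?normrN normr1 mul1r; exact: lexx.
Qed.

(* [F] is increasing with slope at least 1 and bounded below, so lengths along
   the graph are controlled by the oscillation of [F], which tends to 0. *)
Lemma graph_limit (delta M : R) : complete_hypersurface S -> 0 < delta ->
  (forall t, 0 < t < delta -> [/\ is_derive t (1 : R) G (dG t), {for t, continuous dG},
     S (y + t *: e, G t), dG t <= m & G t <= M]) ->
  exists2 l, S (y, l) & G @ (0:R)^'+ --> l.
Proof.
move=> cS d0 H.
have Finc s t : 0 < s -> s <= t -> t < delta -> F s <= F t.
  move=> s0; rewrite le_eqVlt => /predU1P[->//|st] td.
  have FD r : s <= r <= t -> is_derive r (1 : R) F ((1 + 2 * `|m|) *: (1:R) - dG r).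
    move=> /andP[sr rt]; have [|Gd _ _ _ _] := H r.
      by rewrite (lt_le_trans s0 sr) (le_lt_trans rt td).
    have := is_deriveB (is_deriveZ (1 + 2 * `|m|) (is_derive_id r (1:R))) Gd; exact.
  have [||r rI E] := @MVT R F (fun r => (1 + 2 * `|m|) *: (1:R) - dG r) s t st.
  - by move=> r; rewrite in_itv/= => /andP[sr rt]; apply: FD; rewrite !ltW.
  - by apply: derivable_within_continuous => r; rewrite in_itv/= => /FD[].
  rewrite -subr_ge0 E mulr_ge0// ?subr_ge0 ?(ltW st)//.
  move: rI; rewrite in_itv/= => /andP[sr rt].
  have [|_ _ _ dm _] := H r; first by rewrite (lt_trans s0 sr) (lt_trans rt td).
  rewrite [_ *: 1]mulr1; have := ler_norm m; have : 0 <= `|m| by []; lra.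
pose I := inf [set F t | t in [set t | 0 < t < delta]].
have lbF t : 0 < t < delta -> - M <= F t.
  move=> /[dup] tI /H[_ _ _ _ GM]; move/andP: tI => [t0 _].
  rewrite /F; have : 0 <= (1 + 2 * `|m|) * t by rewrite mulr_ge0// ?(ltW t0)// addr_ge0// mulr_ge0.
  by lra.
have hI : has_inf [set F t | t in [set t | 0 < t < delta]].
  split; first by exists (F (delta / 2)), (delta / 2) => //=; lra.
  by exists (- M) => _ [t /= tI <-]; exact: lbF.
have FI t : 0 < t < delta -> I <= F t.
  by move=> tI; apply: ge_inf; [exact: hI.2|exists t].
have Fadh ep : 0 < ep -> exists2 t0, 0 < t0 < delta & forall t, 0 < t <= t0 -> F t < I + ep.
  move=> ep0; have [_ [t0 /= t0I <-] Ft0] := inf_adherent ep0 hI.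
  exists t0 => // t /andP[t00 tt0]; apply: le_lt_trans Ft0.
  by apply: Finc => //; move/andP: t0I => [].
(* The shift by 2 keeps the first sample strictly below [delta]. *)
pose ts (k : nat) : R := delta / k.+2%:R.
have ts0 k : 0 < ts k by rewrite divr_gt0.
have tsd k : ts k < delta by rewrite ltr_pdivrMr// ltr_pMr// ltr1n.
have tsI k : 0 < ts k < delta by rewrite ts0 tsd.
have tss t0 : 0 < t0 -> exists N, forall k, (N <= k)%N -> ts k <= t0.
  move=> t00; exists (Num.truncn (delta / t0)) => k Nk.
  rewrite ler_pdivrMr// mulrC -ler_pdivrMr//.
  apply: ltW; apply: lt_le_trans (truncnS_gt _) _.
  by rewrite ler_nat ltnS (leq_trans Nk).
pose xs k : ambient R n := (y + ts k *: e, G (ts k)).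
have xsS k : S (xs k) by have [] := H _ (tsI k).
have xsdist i j : (intrinsic_dist S (xs i) (xs j) <= (`|F (ts j) - F (ts i)|)%:E)%E.
  pose lo := Num.min (ts i) (ts j); pose hi := Num.max (ts i) (ts j).
  apply: (@graph_path_dist lo hi).
  - by rewrite ge_min lexx le_max lexx.
  - by rewrite ge_min lexx orbT le_max lexx orbT.
  - move=> t /andP[lt th]; have [|? ? ? ? _] := H t; last by split.
    rewrite (lt_le_trans _ lt) ?lt_min ?ts0//=.
    by rewrite (le_lt_trans th)// gt_max !tsd.
have [|p Sp plim] := cS xs xsS.
  move=> ep ep0; have [t0 /andP[t00 _] Ft0] := Fadh _ ep0.
  have [N hN] := tss _ t00; exists N => i j Ni Nj.
  apply: le_lt_trans (xsdist i j) _; rewrite lte_fin.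
  have h1 := FI _ (tsI i); have h2 := FI _ (tsI j).
  have h3 : F (ts i) < I + ep by apply: Ft0; rewrite ts0 hN.
  have h4 : F (ts j) < I + ep by apply: Ft0; rewrite ts0 hN.
  by rewrite ltr_norml; apply/andP; split; lra.
have coordlim ep : 0 < ep -> exists N, forall k, (N <= k)%N ->
    (forall j, `|(xs k).1 0 j - p.1 0 j| < ep) /\ `|(xs k).2 - p.2| < ep.
  move=> ep0; have [N hN] := plim _ ep0; exists N => k Nk.
  split=> [j|]; rewrite -lte_fin; apply: le_lt_trans (hN k Nk).
    apply: (@functional_le_dist _ _ S (xs k) p (fun p => p.1 0 j)).
    - by move=> a z1 z2; rewrite !mxE.
    - by move=> z; apply: (@cvg_comp _ _ _ fst (fun M : 'rV[R]_n => M 0 j));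
        [exact: cvg_fst|exact: coord_continuous].
    - by move=> z; exact: coord_le_enorm.
  apply: (@functional_le_dist _ _ S (xs k) p snd) => //.
  - by move=> z; exact: cvg_snd.
  - by move=> z; exact: snd_le_enorm.
have small_eq (a b : R) : (forall ep, 0 < ep -> `|a - b| < ep) -> a = b.
  move=> h; apply/eqP; rewrite -subr_eq0 -normr_eq0; apply: contraT => n0.
  by have := h `|a - b|; rewrite lt_def n0 normr_ge0 ltxx => /(_ isT).
have ej j : `|e 0 j| <= 1.
  rewrite -(@ler_pXn2r _ 2)// ?nnegrE// expr1n -normrX ger0_norm ?sqr_ge0//.
  by rewrite -e1 coord_sqr_le.
have p1E : p.1 = y.
  apply/rowP => j; apply: small_eq => ep ep0.
  have ep20 : 0 < ep / 2 by rewrite divr_gt0.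
  have [N1 h1] := coordlim _ ep20; have [N2 h2] := tss _ ep20.
  have := (h1 _ (leq_maxl N1 N2)).1 j; have := h2 _ (leq_maxr N1 N2).
  rewrite /xs/= !mxE; set t := ts _ => t2 t3.
  have : `|t * e 0 j| <= ep / 2.
    rewrite normrM (gtr0_norm (ts0 _)); apply: le_trans t2.
    by rewrite ler_piMr// ltW.
  by move: t3; rewrite !(ltr_norml, ler_norml) => /andP[? ?] /andP[? ?]; apply/andP; split; lra.
(* [F t = K t - G t] tends to its infimum [I] at 0, so the heights [G t] tend to [- I]. *)
have IE : p.2 = - I.
  apply: small_eq => ep ep0.
  have ep20 : 0 < ep / 3 by rewrite divr_gt0.
  have ep30 : 0 < ep / 3 / (1 + 2 * `|m|) by rewrite divr_gt0// ltr_pwDl// mulr_ge0.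
  have [t0 /andP[t00 _] Ft0] := Fadh _ ep20.
  have [N1 h1] := coordlim _ ep20; have [N2 h2] := tss _ t00.
  have [N3 h3] := tss _ ep30.
  pose N := maxn N1 (maxn N2 N3).
  have := (h1 N (leq_maxl _ _)).2.
  have := h2 N (leq_trans (leq_maxl _ _) (leq_maxr _ _)).
  have := h3 N (leq_trans (leq_maxr _ _) (leq_maxr _ _)).
  rewrite ler_pdivlMr ?ltr_pwDl ?mulr_ge0// /xs/=; move: (ts0 N) (FI _ (tsI N)).
  set t := ts N => t0' FIt a1 a2 a3.
  have := Ft0 t; rewrite t0' a2 => /(_ isT) a4.
  have a5 : 0 <= (1 + 2 * `|m|) * t.
    by rewrite mulr_ge0// ?(ltW t0')// addr_ge0// mulr_ge0.
  move: a3 FIt a4; rewrite /F ltr_norml => /andP[? ?] FIt a4.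
  by rewrite ltr_norml; apply/andP; split; lra.
exists p.2; first by rewrite -p1E; case: (p) Sp.
have Fl : F @ (0:R)^'+ --> I.
  apply/cvgrPdist_lt => ep ep0; have [t0 /andP[t00 t0d] Ft0] := Fadh _ ep0.
  near=> t.
  have t0' : 0 < t by near: t; exact: nbhs_right_gt.
  have tt0 : t <= t0 by near: t; exact: nbhs_right_le.
  have h1 := FI t; rewrite t0' (le_lt_trans tt0 t0d) in h1.
  have h2 := Ft0 t; rewrite t0' tt0 in h2.
  by rewrite ltr_norml; have := h1 isT; have := h2 isT => ? ?; apply/andP; split; lra.
have Kl : (fun t => (1 + 2 * `|m|) * t) @ (0:R)^'+ --> (1 + 2 * `|m|) * 0.
  by apply: cvgMl_tmp; apply: cvg_at_right_filter; exact: cvg_id.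
have L : (fun t : R => (1 + 2 * `|m|) * t - F t) @ (0:R)^'+ --> p.2.
  rewrite IE -[X in _ --> X]sub0r -[X in _ --> X - _](mulr0 (1 + 2 * `|m|)).
  exact: cvgB Kl Fl.
suff -> : G = (fun t : R => (1 + 2 * `|m|) * t - F t) by exact: L.
by apply/funext => t; rewrite /F opprB addrCA subrr addr0.
Unshelve. all: by end_near. Qed.

End graph_path.

(** * Continuation of graphs *)

Lemma translator_neg {R : realType} {n : nat} (Gamma : set 'rV[R]_n) f
    (S : set (ambient R n)) nu : admissible Gamma f -> translator Gamma f S nu ->
  forall p, S p -> (nu p).2 < 0.
Proof.
move=> hf htr p Sp; have [lam [_ Gl fl]] := htr p Sp.
have := adm_pos hf Gl; rewrite fl /dot/= mulr1 /dotr big1 ?add0r ?oppr_gt0//.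
by move=> i _; rewrite mxE mulr0.
Qed.

Lemma spectrum_qform_pos {R : realType} {n : nat} q A mu (w : 'rV[R]_n) :
  spectrum q A mu -> Gamma_plus mu -> w != 0 -> 0 < qform A w.
Proof.
move=> [W [WM AE]] mu0 w0; have [-> _] := spectrum_qform w WM AE.
set c := w *m metric q *m W^T => e3.
have [j cj] : exists j, c 0 j != 0.
  by apply: rV_neq0; apply: contra_neq w0 => c0; rewrite e3 c0 mul0mx.
apply: (@sumr_gt0_at _ _ _ j) => [k|]; first by rewrite mulr_ge0 ?sqr_ge0 ?ltW.
by rewrite mulr_gt0// exprn_even_gt0.
Qed.

Lemma rV_ballP {R : realType} {n : nat} (x y : 'rV[R]_n) (e : R) : 0 < e ->
  ball x e y <-> forall j, `|x 0 j - y 0 j| < e.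
Proof.
move=> e0; rewrite -ball_normE /ball_/= /Num.Def.normr/= mx_normrE.
split=> [h j|h].
  apply: le_lt_trans h; apply: le_trans (le_bigmax _ _ (0, j)).
  by rewrite !mxE.
by apply: bigmax_lt => //= -[i j] _ /=; rewrite (ord1 i) !mxE; exact: h.
Qed.

Lemma ball_segment {R : realType} (V : normedModType R) (y x z : V) (e t : R) :
  ball y e x -> ball y e z -> 0 <= t <= 1 -> ball y e (x + t *: (z - x)).
Proof.
rewrite -!ball_normE /ball_/= => yx yz /andP[t0 t1].
have -> : y - (x + t *: (z - x)) = (1 - t) *: (y - x) + t *: (y - z).
  rewrite scalerBl scale1r -addrA -scalerN -scalerDr [- (y - x)]opprB subrKA.
  by rewrite opprD addrA -scalerN opprB.
apply: le_lt_trans (ler_normD _ _) _; rewrite !normrZ ger0_norm ?subr_ge0// ger0_norm//.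
move: t0; rewrite le_eqVlt => /predU1P[<-|t0]; first by rewrite mul0r addr0 subr0 mul1r.
have -> : e = (1 - t) * e + t * e by ring.
apply: ler_ltD; last by rewrite ltr_pM2l.
by rewrite ler_wpM2l ?subr_ge0// ltW.
Qed.

Lemma dotr_linear {R : realType} n (w : 'rV[R]_n) (a : R) (y z : 'rV[R]_n) :
  dotr (a *: (y - z)) w = a * (dotr y w - dotr z w).
Proof.
rewrite !dotr_mx -scalemxAl mulmxBl; rewrite mxE; congr (_ * _).
by rewrite mxE [X in _ + X]mxE.
Qed.

Lemma dotr_continuous {R : realType} n (w : 'rV[R]_n) :
  continuous (fun y : 'rV[R]_n => dotr y w).
Proof.
apply: (@sum_continuous R _ _ _ _ (fun i (y : 'rV[R]_n) => y 0 i * w 0 i)) => i z.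
have c := @coord_continuous R 1 n 0 i z.
exact: (cvgM c (cvg_cst (w 0 i))).
Qed.

Section sheets.
Context {R : realType} {n : nat} {S : set (ambient R n)}.
Context {nu : ambient R n -> ambient R n}.
Context {Gamma : set 'rV[R]_n} {f : 'rV[R]_n -> R}.
Hypotheses (hf : admissible Gamma f) (hS : hypersurface S) (hnu : unit_normal S nu).
Hypotheses (hconv : strictly_convex S nu) (htr : translator Gamma f S nu).
Let hneg := translator_neg hf htr.
Implicit Types (x y z w : 'rV[R]_n) (g h : 'rV[R]_n -> R).

Lemma sheet_germ g h x : {for x, continuous g} -> {for x, continuous h} ->
  S (x, g x) -> g x = h x ->
  \forall y \near x, S (y, g y) -> S (y, h y) -> g y = h y.
Proof.
move=> gc hc Sx gh; have [e [eta [phi [e0 eta0 _ u]]]] := window_exists hS hnu hneg Sx.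
have n1 : \forall y \near x, ball x e y by exact: nbhsx_ballx.
have n2 : \forall y \near x, `|g x - g y| < eta by move/cvgrPdist_lt: gc; apply.
have n3 : \forall y \near x, `|h x - h y| < eta by move/cvgrPdist_lt: hc; apply.
move: n1 n2 n3; apply: filterS3 => y y1 y2 y3 Sg Sh.
by rewrite (u y (g y)) 1?distrC// (u y (h y)) 1?distrC//= gh.
Qed.

(** Connectedness of the segment: the set where the two sheets agree is open by uniqueness inside a
    window and closed by continuity. *)
Lemma sheet_unique g h x z :
  (forall t : R, 0 <= t <= 1 -> let w := x + t *: (z - x) in
    [/\ S (w, g w), S (w, h w), {for w, continuous g} & {for w, continuous h}]) ->
  g z = h z -> g x = h x.
Proof.
move=> H gz; pose w (t : R) := x + t *: (z - x).
have wc : continuous w.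
  by move=> t; apply: cvgD; [exact: cvg_cst|apply: cvgZr_tmp; exact: cvg_id].
pose A : set R := [set` `[0%R, 1%R]]; pose B := [set t | A t /\ g (w t) = h (w t)].
have AP t : A t -> 0 <= t <= 1 by rewrite /A/= in_itv.
suff BA : B = A.
  have : A 0 by rewrite /A/= in_itv/= lexx ler01.
  by rewrite -BA /B/= /w scale0r addr0 => -[].
have nB t : A t -> g (w t) = h (w t) -> \forall s \near t, A s -> g (w s) = h (w s).
  move=> At gh; have [Sg Sh gc hc] := H t (AP _ At).
  have N : \forall s \near t, S (w s, g (w s)) -> S (w s, h (w s)) -> g (w s) = h (w s).
    exact: wc t _ (sheet_germ gc hc Sg gh).
  apply: filterS N => s K As; have [Sg' Sh' _ _] := H s (AP _ As).
  exact: K.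
apply: (@segment_connected R 0 1).
- by exists 1; split; [rewrite /A/= in_itv/= lexx ler01|rewrite /w scale1r addrC subrK].
- exists (interior [set s | A s -> g (w s) = h (w s)]); first exact: open_interior.
  apply/seteqP; split=> t.
    by move=> [At gh]; split => //; exact: nB.
  by move=> [At /interior_subset K]; split => //; exact: K.
- exists (closure B); first exact: closed_closure.
  apply/seteqP; split=> t; first by move=> Bt; split; [case: Bt|exact: subset_closure].
  move=> [At cB]; split => //; have [Sg Sh gc hc] := H t (AP _ At).
  apply/eqP; apply: contraT => ne.
  have : \forall s \near t, g (w s) - h (w s) != 0.
    have c : (fun s => g (w s) - h (w s)) @ t --> g (w t) - h (w t).
      apply: cvgB; [apply: (@cvg_comp _ _ _ w g)|apply: (@cvg_comp _ _ _ w h)].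
      + exact: wc. + exact: gc. + exact: wc. + exact: hc.
    by move/cvgr_neq0: c; apply; rewrite subr_eq0.
  by move=> /cB[s [[_ ->]]]/=; rewrite subrr eqxx.
Qed.

Definition sheet_at g x := {for x, continuous g} /\ \forall y \near x, S (y, g y).

(** The slope along a line has the Hessian form at [w] as its derivative, which strict convexity
    makes positive. *)
Lemma sheet_line g x w : let q t := dotr (grad nu (x + t *: w, g (x + t *: w))) w in
  forall t : R, sheet_at g (x + t *: w) -> w != 0 ->
  is_derive t (1 : R) (fun t : R => g (x + t *: w)) (q t) /\
  exists2 c, 0 < c & is_derive t (1 : R) q c.
Proof.
move=> q t [gc gS] w0; split.
  by apply: (is_derive_line g x w t _).1; exact: (sheet_derive hS hnu hneg).
have [A [mu [dA sp mu0 _]]] := sheet_curvature hS hnu hneg gc gS hf hconv htr.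
exists (qform A w); first exact: spectrum_qform_pos sp mu0 w0.
apply: (is_derive_line (fun y => dotr (grad nu (y, g y)) w) x w t _).1.
have := derive_functional (dotr_linear w) (@dotr_continuous _ _ w) (dA w).
by rewrite /qform -dotr_mx.
Qed.

(** If the midpoint lay above both ends, the mean value theorem would give a positive slope followed
    by a negative one, while the slope increases. *)
Lemma sheet_chord g x w (k : R) : w != 0 -> 0 < k ->
  (forall t : R, - k <= t <= k -> sheet_at g (x + t *: w)) ->
  g x <= Num.max (g (x + k *: w)) (g (x + (- k) *: w)).
Proof.
move=> w0 k0 H; rewrite leNgt; apply/negP; rewrite gt_max => /andP[h1 h2].
pose G (t : R) := g (x + t *: w).
pose q t := dotr (grad nu (x + t *: w, g (x + t *: w))) w.
have G0 : G 0 = g x by rewrite /G scale0r addr0.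
have D t : - k <= t <= k -> is_derive t (1 : R) G (q t) /\
    exists2 c, 0 < c & is_derive t (1 : R) q c by move=> /H h; exact: sheet_line.
have I (t a b : R) : a < t < b -> - k <= a -> b <= k -> - k <= t <= k.
  by move=> /andP[a1 a2] a3 a4; rewrite !ltW// ?(le_lt_trans a3)// (lt_le_trans a2).
have mk0 : - k < 0 by rewrite oppr_lt0.
have IV (t a b : R) : a <= t <= b -> - k <= a -> b <= k -> - k <= t <= k.
  by move=> /andP[a1 a2] a3 a4; rewrite (le_trans a3)//= (le_trans a2).
have mvtG a b : a < b -> - k <= a -> b <= k ->
    exists2 c, a < c < b & G b - G a = q c * (b - a).
  move=> ab ka bk; have [||c cI E] := @MVT R G q a b ab.
  - by move=> t; rewrite in_itv/= => /I h; apply (D _ (h ka bk)).1.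
  - apply: derivable_within_continuous => t; rewrite in_itv/= => /IV h.
    by have [[]] := D _ (h ka bk).
  by exists c => //; move: cI; rewrite in_itv.
have [c1 /[dup] c1I /andP[c10 c1k] E1] := mvtG 0 k k0 (ltW mk0) (lexx k).
have [c2 /[dup] c2I /andP[c20 c2k] E2] := mvtG (- k) 0 mk0 (lexx _) (ltW k0).
have q1 : q c1 < 0.
  have : q c1 * (k - 0) < 0 by rewrite -E1 G0 subr_lt0.
  by rewrite subr0 pmulr_llt0.
have q2 : 0 < q c2.
  have : 0 < q c2 * (0 - - k) by rewrite -E2 G0 subr_gt0.
  by rewrite sub0r opprK pmulr_lgt0.
have c21 : c2 < c1 by exact: lt_trans c2k c10.
have qd t : c2 <= t <= c1 -> derivable q t 1 /\ 0 < 'D_1 q t.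
  move=> /andP[t1 t2]; have [|_ [c c0 [qd qE]]] := D t.
    by rewrite (le_trans (ltW c20))//= (le_trans t2)// ltW.
  by split => //; rewrite qE.
have [||c cI E] := @MVT R q (fun t => 'D_1 q t) c2 c1 c21.
- by move=> t; rewrite in_itv/= => /andP[a1 a2]; apply/derivableP/(qd t _).1; rewrite !ltW.
- by apply: derivable_within_continuous => t; rewrite in_itv/= => /qd[].
have : 0 < q c1 - q c2.
  rewrite E mulr_gt0 ?subr_gt0//; move: cI; rewrite in_itv/= => /andP[a1 a2].
  by apply: (qd c _).2; rewrite !ltW.
by rewrite subr_gt0 => /(lt_trans q2)/(lt_trans q1); rewrite ltxx.
Qed.

End sheets.

(** * Extension of the end over half-spaces *)

Lemma coord_le_enormr {R : realType} {n : nat} (x : 'rV[R]_n) i : `|x 0 i| <= enormr x.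
Proof.
rewrite -sqrtr_sqr /enormr ler_sqrt; first exact: coord_sqr_le.
exact: dotr_ge0.
Qed.

Lemma enormr_continuous {R : realType} {n : nat} : continuous (@enormr R n).
Proof.
move=> x; apply: (@cvg_comp _ _ _ (fun x => dotr x x) Num.sqrt); last exact: sqrt_continuous.
apply: (@sum_continuous R _ _ _ _ (fun i (y : 'rV[R]_n) => y 0 i * y 0 i)) => i z.
have c := @coord_continuous R 1 n 0 i z.
exact: (cvgM c c).
Qed.

Section entire.
Context {R : realType} {n : nat} {S : set (ambient R n)}.
Context {nu : ambient R n -> ambient R n}.
Context {Gamma : set 'rV[R]_n} {f : 'rV[R]_n -> R}.
Hypotheses (hf : admissible Gamma f) (hS : hypersurface S) (hnu : unit_normal S nu).
Hypotheses (hconv : strictly_convex S nu) (htr : translator Gamma f S nu).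
Hypothesis hcomplete : complete_hypersurface S.
Let hneg := translator_neg hf htr.
Variables (i0 i1 : 'I_n) (r : R) (u : 'rV[R]_n -> R).
Hypotheses (i01 : i0 != i1) (r0 : 0 < r).
Hypothesis uS : forall x, r < enormr x -> S (x, u x) /\ forall t, S (x, t) -> t = u x.
Implicit Types (x y z w : 'rV[R]_n) (g h : 'rV[R]_n -> R) (a b : R).
Let e0 : 'rV[R]_n := delta_mx 0 i0.
Let e1 : 'rV[R]_n := delta_mx 0 i1.

Let e0E x (t : R) j : (x + t *: e0) 0 j = x 0 j + t *+ (j == i0).
Proof. by rewrite !mxE eqxx/= mulr_natr. Qed.

Let e1E x (t : R) j : (x + t *: e1) 0 j = x 0 j + t *+ (j == i1).
Proof. by rewrite !mxE eqxx/= mulr_natr. Qed.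

Lemma delta_neq0 i : delta_mx 0 i != 0 :> 'rV[R]_n.
Proof.
apply/eqP => /rowP/(_ i); rewrite !mxE !eqxx => /eqP; exact/negP/oner_neq0.
Qed.

Lemma exterior_sheet x : r < enormr x -> sheet_at (S := S) u x.
Proof.
move=> rx; have near_ext : \forall y \near x, r < enormr (y : 'rV[R]_n).
  by move/cvgr_gt: (enormr_continuous (x := x)); apply.
split; last by move: near_ext; apply: filterS => y /uS[].
have [Sx _] := uS rx.
have [e [eta [phi [e_gt0 eta0 phiS _]]]] := window_exists hS hnu hneg Sx.
have n1 : \forall y \near x, ball x e y by exact: nbhsx_ballx.
have E : \forall y \near x, phi y = u y.
  by move: n1 near_ext; apply: filterS2 => y /phiS[Sy _ _] /uS[_]; apply.
have [_ _ pc] := phiS x (ballxx _ e_gt0).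
rewrite /prop_for/continuous_at -(nbhs_singleton E).
by apply: cvg_trans pc; exact: near_eq_cvg E.
Qed.

(** Agreement with the end of S is automatic, as S has a single point over each [x] of norm greater
    than [r]. *)
Definition good a := exists g, forall x : 'rV[R]_n, a < x 0 i0 ->
  S (x, g x) /\ {for x, continuous g}.

Lemma halfspace_near a x : a < x 0 i0 -> \forall y \near x, a < (y : 'rV[R]_n) 0 i0.
Proof. by move/cvgr_gt: (@coord_continuous R 1 n 0 i0 x); exact. Qed.

Lemma good_sheet g a : (forall x : 'rV[R]_n, a < x 0 i0 -> S (x, g x) /\ {for x, continuous g}) ->
  forall x : 'rV[R]_n, a < x 0 i0 -> sheet_at (S := S) g x.
Proof.
move=> H x ax; split; first by have [] := H x ax.
by have := halfspace_near ax; apply: filterS => y /H[].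
Qed.

(** Moving [x] by [T] along [e0] reaches the region where S has one sheet without leaving either
    half-space; agreement there propagates back along the segment. *)
Lemma good_unique g h a b :
  (forall x : 'rV[R]_n, a < x 0 i0 -> S (x, g x) /\ {for x, continuous g}) ->
  (forall x : 'rV[R]_n, b < x 0 i0 -> S (x, h x) /\ {for x, continuous h}) ->
  forall x : 'rV[R]_n, a < x 0 i0 -> b < x 0 i0 -> g x = h x.
Proof.
move=> Hg Hh x ax bx.
pose T : R := `|x 0 i0| + r + 1; have T0 : 0 <= T by rewrite !addr_ge0// ltW.
pose z := x + T *: e0.
apply: (@sheet_unique _ _ _ _ _ _ hf hS hnu htr g h x z).
  move=> t /andP[t0 t1] w.
  have wE : w 0 i0 = x 0 i0 + t * T.
    have zx : z - x = T *: e0 by rewrite /z addrAC subrr add0r.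
    by rewrite /w zx scalerA e0E eqxx.
  have xw : x 0 i0 <= w 0 i0 by rewrite wE lerDl mulr_ge0.
  by have [? ?] := Hg w (lt_le_trans ax xw); have [? ?] := Hh w (lt_le_trans bx xw).
have zr : r < z 0 i0.
  rewrite /z e0E eqxx mulr1n /T; have := ler_norm (- x 0 i0); rewrite normrN; lra.
have xz : x 0 i0 <= z 0 i0 by rewrite /z e0E eqxx mulr1n lerDl.
have ez : r < enormr z.
  by apply: lt_le_trans zr _; apply: le_trans (coord_le_enormr z i0); exact: ler_norm.
have [_ uz] := uS ez.
by rewrite (uz _ (Hg z (lt_le_trans ax xz)).1) (uz _ (Hh z (lt_le_trans bx xz)).1).
Qed.

(** Each [x] is served by a chosen half-space [B x]. The choice may jump, but near [x] the sheet
    chosen at [x] is still defined, and uniqueness identifies it with the others. *)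
Lemma good_glue (J : set R) : (forall b, J b -> good b) ->
  exists g, forall (x : 'rV[R]_n) b, J b -> b < x 0 i0 -> S (x, g x) /\ {for x, continuous g}.
Proof.
move=> Jg.
have /choice[G HG] : forall b, exists g : 'rV[R]_n -> R, J b ->
    forall x : 'rV[R]_n, b < x 0 i0 -> S (x, g x) /\ {for x, continuous g}.
  move=> b; have [Jb|nJ] := pselect (J b); last by exists (fun=> 0) => /nJ.
  by have [g Hg] := Jg b Jb; exists g.
have /choice[B HB] : forall x : 'rV[R]_n, exists b,
    (exists2 b, J b & b < x 0 i0) -> J b /\ b < x 0 i0.
  move=> x; have [[b Jb bx]|nb] := pselect (exists2 b, J b & b < x 0 i0); first by exists b.
  by exists 0 => /nb.
exists (fun x => G (B x) x) => x b Jb bx.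
have [JB Bx] := HB x (ex_intro2 _ _ b Jb bx).
have [S1 c1] := HG _ JB x Bx; split => //.
have E : \forall y \near x, G (B x) y = G (B y) y.
  have := halfspace_near Bx; apply: filterS => y By.
  have [JB' By'] := HB y (ex_intro2 _ _ (B x) JB By).
  exact: (good_unique (HG _ JB) (HG _ JB')).
by apply: cvg_trans c1; exact: near_eq_cvg E.
Qed.

Lemma good_inf a : (forall b, a < b -> good b) -> good a.
Proof.
move=> H; have [g Hg] := @good_glue [set b | a < b] H.
exists g => x ax; apply: (Hg x ((a + x 0 i0) / 2)) => /=; lra.
Qed.

Lemma good_far : good r.
Proof.
exists u => x rx; have rx' : r < enormr x.
  by apply: lt_le_trans rx _; apply: le_trans (coord_le_enormr x i0); exact: ler_norm.
by have [] := exterior_sheet rx'; have [] := uS rx'.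
Qed.

Lemma good_mono a b : a <= b -> good a -> good b.
Proof. by move=> ab [g Hg]; exists g => x bx; apply: Hg; exact: le_lt_trans bx. Qed.

Definition extends g a y (e : R) := exists phi, forall x : 'rV[R]_n, ball y e x ->
  [/\ S (x, phi x), {for x, continuous phi} & a < x 0 i0 -> phi x = g x].

Lemma extends_at g a y :
  (forall x : 'rV[R]_n, a < x 0 i0 -> S (x, g x) /\ {for x, continuous g}) ->
  y 0 i0 = a -> exists2 e, 0 < e & extends g a y e.
Proof.
move=> Hg ya; have sh := good_sheet Hg.
have [ry|yr] := ltP r (enormr y).
  have /nbhs_ballP[e /= e_gt0 he] : \forall x \near y, r < enormr x.
    by move/cvgr_gt: (enormr_continuous (x := y)); apply.
  exists e => //; exists u => x /he rx; have [Sx Ux] := uS rx.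
  by split => //; [have [] := exterior_sheet rx|move=> /Hg[/Ux]].
have line (t : R) : 0 < t -> a < (y + t *: e0) 0 i0.
  by move=> t0; rewrite e0E eqxx mulr1n ya ltrDl.
pose G (t : R) := g (y + t *: e0).
pose dG (t : R) := dotr (grad nu (y + t *: e0, g (y + t *: e0))) e0.
have D (t : R) : 0 < t -> is_derive t (1 : R) G (dG t) /\
    exists2 c, 0 < c & is_derive t (1 : R) dG c.
  by move=> /line/sh h; exact: (sheet_line hf hS hnu hconv htr h (delta_neq0 i0)).
have dGle (t : R) : 0 < t < 1 -> dG t <= dG 1.
  move=> /andP[t0 t1].
  have qd (s : R) : t <= s <= 1 -> derivable dG s 1 /\ 0 < 'D_1 dG s.
    move=> /andP[s1 s2]; have [_ [c c0 [qd qE]]] := D s (lt_le_trans t0 s1).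
    by split => //; rewrite qE.
  have [||c cI E] := @MVT R dG (fun t => 'D_1 dG t) t 1 t1.
  - by move=> s; rewrite in_itv/= => /andP[a1 a2]; apply/derivableP/(qd s _).1; rewrite !ltW.
  - by apply: derivable_within_continuous => s; rewrite in_itv/= => /qd[].
  rewrite -subr_ge0 E mulr_ge0// ?subr_ge0 ?(ltW t1)//.
  by move: cI; rewrite in_itv/= => /andP[a1 a2]; apply/ltW/(qd c _).2; rewrite !ltW.
(* Since the coordinate [i1] of [y] is at most [r] in absolute value, a shift by [k] or [- k] takes
   it beyond [r], into the end of S, whatever [t] is. *)
pose k : R := 2 * r + 1; have k0 : 0 < k by have := r0; rewrite /k; lra.
have y1 : `|y 0 i1| <= r by exact: le_trans (coord_le_enormr y i1) yr.
have ext (t s : R) : s = k \/ s = - k -> r < enormr ((y + s *: e1) + t *: e0).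
  move=> sk; apply: lt_le_trans (coord_le_enormr _ i1).
  rewrite e0E eq_sym (negbTE i01) mulr0n addr0 e1E eqxx mulr1n.
  move: y1; rewrite ler_norml => /andP[h1 h2].
  by have := r0; case: sk => ->; rewrite ltr_normr /k => ?; apply/orP; [left|right]; lra.
have bnd (s : R) : s = k \/ s = - k ->
    exists M, forall t : R, 0 < t < 1 -> u ((y + s *: e1) + t *: e0) <= M.
  move=> sk.
  have [|c _ hc] := @EVT_max R (fun t => u ((y + s *: e1) + t *: e0)) 0 1 ler01.
    apply: continuous_subspaceT => t.
    apply: (@cvg_comp _ _ _ (fun t : R => (y + s *: e1) + t *: e0) u).
      by apply: cvgD; [exact: cvg_cst|apply: cvgZr_tmp; exact: cvg_id].
    by have [] := exterior_sheet (ext t s sk).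
  exists (u ((y + s *: e1) + c *: e0)) => t /andP[t0 t1]; apply: hc.
  by rewrite in_itv/= !ltW.
have [M1 hM1] := bnd k (or_introl erefl); have [M2 hM2] := bnd (- k) (or_intror erefl).
have GM (t : R) : 0 < t < 1 -> G t <= Num.max M1 M2.
  move=> /[dup] t01 /andP[t0 t1].
  have swap (s : R) : y + t *: e0 + s *: e1 = y + s *: e1 + t *: e0 by rewrite addrAC.
  have hsh (s : R) : sheet_at (S := S) g (y + t *: e0 + s *: e1).
    apply: sh; rewrite e1E (negbTE i01) mulr0n addr0; exact: line.
  have := sheet_chord hf hS hnu hconv htr (delta_neq0 i1) k0 (fun s _ => hsh s).
  have gu (s : R) : s = k \/ s = - k -> g (y + t *: e0 + s *: e1) = u (y + s *: e1 + t *: e0).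
    move=> sk; rewrite -swap; have := ext t s sk; rewrite -swap => /uS[_]; apply.
    by have [_ /nbhs_singleton] := hsh s.
  rewrite !gu; [|by right|by left].
  rewrite le_max => /orP[h|h]; rewrite le_max.
    by apply/orP; left; apply: le_trans h (hM1 _ t01).
  by apply/orP; right; apply: le_trans h (hM2 _ t01).
have e01 : dotr e0 e0 = 1.
  rewrite /dotr (bigD1 i0)//= !mxE !eqxx mulr1 big1 ?addr0// => j ji.
  by rewrite !mxE (negbTE ji) mulr0.
have [|l Sl Gl] := @graph_limit R n S y e0 G dG (dG 1) e01 1 (Num.max M1 M2) hcomplete ltr01.
  move=> t /[dup] t01 /andP[t0 t1]; have [Gd [c _ [dGd _]]] := D t t0.
  split=> //; [|by have [] := Hg _ (line t t0)|exact: dGle|exact: GM].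
  by move/derivable1_diffP/differentiable_continuous : dGd.
have [e [eta [phi [e_gt0 eta0 phiS phiU]]]] := window_exists hS hnu hneg Sl.
exists e => //; exists phi => x xe; have [Sx _ cx] := phiS x xe; split => // ax.
(* The window identifies only points of S with height near [l], so [phi] and [g] are first compared
   at a point of the normal where [g] is within [eta] of [l]. Agreement then spreads over the convex
   intersection of the ball with the half-space. *)
have [t [t0 te tl]] : exists t : R, [/\ 0 < t, t < e & `|l - G t| < eta].
  have n1 : \forall t \near (0:R)^'+, 0 < t by exact: nbhs_right_gt.
  have n2 : \forall t \near (0:R)^'+, t < e by exact: nbhs_right_lt.
  have n3 : \forall t \near (0:R)^'+, `|l - G t| < eta by move/cvgrPdist_lt: Gl; apply.
  have : \forall t \near (0:R)^'+, [/\ 0 < t, t < e & `|l - G t| < eta].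
    by move: n1 n2 n3; apply: filterS3.
  by move=> /filter_ex[t ht]; exists t.
pose z := y + t *: e0.
have ze : ball y e z.
  apply/rV_ballP => // j; rewrite e0E opprD addrA subrr sub0r normrN.
  by case: eqP => _; rewrite ?mulr1n ?mulr0n ?normr0// gtr0_norm.
apply: (@sheet_unique _ _ _ _ _ _ hf hS hnu htr phi g x z); last first.
  by apply/esym/phiU => //=; [rewrite distrC|have [] := Hg _ (line t t0)].
move=> s s01 w; have we : ball y e w by exact: ball_segment.
have aw : a < w 0 i0.
  have := line t t0; rewrite -/z => az; move/andP: s01 => [s0 s1].
  have -> : w 0 i0 = x 0 i0 + s * (z 0 i0 - x 0 i0).
    by rewrite /w mxE [X in _ + X]mxE [X in _ * X]mxE [X in _ * (_ + X)]mxE.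
  have -> : a = (1 - s) * a + s * a by ring.
  have -> : x 0 i0 + s * (z 0 i0 - x 0 i0) = (1 - s) * x 0 i0 + s * z 0 i0 by ring.
  move: s0; rewrite le_eqVlt => /predU1P[<-|s0]; first by rewrite subr0 !mul1r !mul0r !addr0.
  by rewrite ler_ltD// ?ltr_pM2l// ler_wpM2l ?subr_ge0// ltW.
by have [? _ ?] := phiS w we; have [? ?] := Hg w aw.
Qed.

Lemma ball_coord0 y y' x e : 0 < e -> (forall j, j != i0 -> y' 0 j = x 0 j) ->
  ball y e x -> `|y 0 i0 - y' 0 i0| < e -> ball y e y'.
Proof.
move=> e_gt0 yx /(rV_ballP _ _ e_gt0) h h0; apply/rV_ballP => // j.
by have [->//|ji] := eqVneq j i0; rewrite yx.
Qed.

Lemma extends_agree g a e y y' phi phi' x :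
  (forall x : 'rV[R]_n, a < x 0 i0 -> S (x, g x) /\ {for x, continuous g}) -> 0 < e ->
  (forall x : 'rV[R]_n, ball y e x ->
    [/\ S (x, phi x), {for x, continuous phi} & a < x 0 i0 -> phi x = g x]) ->
  (forall x : 'rV[R]_n, ball y' e x ->
    [/\ S (x, phi' x), {for x, continuous phi'} & a < x 0 i0 -> phi' x = g x]) ->
  y 0 i0 = a -> y' 0 i0 = a ->
  ball y e x -> ball y' e x -> phi x = phi' x.
Proof.
move=> Hg e_gt0 H H' ya ya' yx yx'.
pose z := x + (a - x 0 i0 + e / 2) *: e0.
have z0 : z 0 i0 = a + e / 2 by rewrite /z e0E eqxx mulr1n; ring.
have zj j : j != i0 -> z 0 j = x 0 j.
  by move=> ji; rewrite /z e0E (negbTE ji) mulr0n addr0.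
have e2 : 0 < e / 2 by rewrite divr_gt0.
have ze : `|a - z 0 i0| < e.
  by rewrite z0 opprD addrA subrr sub0r normrN gtr0_norm// ltr_pdivrMr// ltr_pMr// ltr1n.
have yz : ball y e z by apply: (ball_coord0 e_gt0 zj yx); rewrite ya.
have yz' : ball y' e z by apply: (ball_coord0 e_gt0 zj yx'); rewrite ya'.
have az : a < z 0 i0 by rewrite z0 ltrDl.
apply: (@sheet_unique _ _ _ _ _ _ hf hS hnu htr phi phi' x z).
  move=> t t01 w.
  have [S1 c1 _] := H w (ball_segment yx yz t01).
  by have [S2 c2 _] := H' w (ball_segment yx' yz' t01).
by have [_ _ ->] := H z yz => //; have [_ _ ->] := H' z yz'.
Qed.

(** The part of the hyperplane in a large cube is compact, which gives a common radius. Any other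
    point of the hyperplane has a coordinate of modulus above [r + 1]; with [e < 1] its ball lies in
    the end of S, and [u] is the extension. *)
Lemma extends_uniform g a :
  (forall x : 'rV[R]_n, a < x 0 i0 -> S (x, g x) /\ {for x, continuous g}) ->
  exists2 e, 0 < e & forall y, y 0 i0 = a -> extends g a y e.
Proof.
move=> Hg.
pose I (i : 'I_n) : set R := [set` if i == i0 then `[a, a]%R else `[- (r + 1), r + 1]%R].
pose K := [set v : 'rV[R]_n | forall i, I i (v 0 i)].
have cK : compact K by apply: rV_compact => i; rewrite /I; case: ifP => _; exact: segment_compact.
have nc : \forall e \near (0:R)^'+, forall y, K y -> extends g a y e.
  apply: (iffLR (compact_near_coveringP K) cK R (0:R)^'+ (fun e y => extends g a y e)) => y Ky.
  have ya : y 0 i0 = a.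
    by have := Ky i0; rewrite /I eqxx/= in_itv/= => /andP[h1 h2]; apply/eqP; rewrite eq_le h1 h2.
  have [e e_gt0 [phi hphi]] := extends_at Hg ya.
  have e2 : 0 < e / 2 by rewrite divr_gt0.
  exists (ball y (e / 2), [set d | d < e / 2]) => /=.
    by split; [exact: nbhsx_ballx|exact: nbhs_right_lt].
  move=> [y' d] /= [y1 d1]; exists phi => x xd; apply: hphi.
  apply: (@le_ball _ _ y (e / 2 + e / 2)); first by rewrite -splitr.
  by apply: ball_triangle y1 _; apply: le_ball xd; exact: ltW.
have [e [e_gt0 e1' he]] : exists e : R, [/\ 0 < e, e < 1 & forall y, K y -> extends g a y e].
  have n1 : \forall e \near (0:R)^'+, 0 < e by exact: nbhs_right_gt.
  have n2 : \forall e \near (0:R)^'+, e < 1 by exact: nbhs_right_lt.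
  have : \forall e \near (0:R)^'+, [/\ 0 < e, e < 1 & forall y, K y -> extends g a y e].
    by move: n1 n2 nc; apply: filterS3.
  by move=> /filter_ex[e he]; exists e.
exists e => // y ya; have [Ky|nKy] := pselect (K y); first exact: he.
have [j hj] : exists j, r + 1 < `|y 0 j|.
  apply: contrapT => /forallNP h; apply: nKy => j; rewrite /I; case: eqP => [->|_].
    by rewrite /= in_itv/= ya lexx.
  by rewrite /= in_itv/= -ler_norml leNgt; apply/negP/h.
exists u => x yx; have rx : r < enormr x.
  apply: lt_le_trans (coord_le_enormr x j).
  move/(rV_ballP _ _ e_gt0)/(_ j): yx => yx.
  have := ler_norm (`|y 0 j| - `|x 0 j|).
  have := lerB_dist (y 0 j) (x 0 j); lra.
have [Sx Ux] := uS rx.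
by split => //; [have [] := exterior_sheet rx|move=> /Hg[/Ux]].
Qed.

(** A point of the new strip uses the extension centred at its projection [pr x] to the hyperplane.
    Overlapping extensions agree, so near [x] the single extension centred at [pr x] may be used. *)
Lemma good_open a : good a -> exists2 e, 0 < e & good (a - e).
Proof.
move=> [g Hg]; have [e e_gt0 He] := extends_uniform Hg.
exists e => //.
have /choice[Phi HPhi] : forall y : 'rV[R]_n, exists phi : 'rV[R]_n -> R, y 0 i0 = a ->
    forall x : 'rV[R]_n, ball y e x ->
    [/\ S (x, phi x), {for x, continuous phi} & a < x 0 i0 -> phi x = g x].
  move=> y; have [ya|nya] := pselect (y 0 i0 = a); last by exists u.
  by have [phi hphi] := He y ya; exists phi.
pose pr x := x + (a - x 0 i0) *: e0.
have pra x : pr x 0 i0 = a by rewrite /pr e0E eqxx mulr1n; ring.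
have prb x : `|a - x 0 i0| < e -> ball (pr x) e x.
  move=> h; apply/rV_ballP => // j; rewrite /pr e0E; case: eqP => [->|_].
    by rewrite mulr1n addrAC subrr add0r.
  by rewrite mulr0n addr0 subrr normr0.
exists (fun x => if a < x 0 i0 then g x else Phi (pr x) x) => x ax.
have [ax'|ax'] := ltP a (x 0 i0).
  have [Sx gc] := Hg x ax'; split => //.
  have E : \forall y \near x, g y = if a < y 0 i0 then g y else Phi (pr y) y.
    by have := halfspace_near ax'; apply: filterS => y ->.
  rewrite /prop_for/continuous_at ax'.
  by apply: cvg_trans gc; exact: near_eq_cvg E.
have xe : `|a - x 0 i0| < e by rewrite ger0_norm ?subr_ge0//; move: ax; lra.
have xb := prb x xe; have [Sx cx _] := HPhi (pr x) (pra x) x xb.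
split => //.
have E : \forall y \near x, Phi (pr x) y = if a < y 0 i0 then g y else Phi (pr y) y.
  have n1 : \forall y \near x, ball (pr x) e y.
    by apply: open_nbhs_nbhs; split => //; exact: ball_open.
  have := halfspace_near ax; move: n1; apply: filterS2 => y yb ay.
  case: ifPn => [ay'|]; first by have [_ _ ->] := HPhi _ (pra x) y yb.
  rewrite -leNgt => ay'.
  have ye : `|a - y 0 i0| < e by rewrite ger0_norm ?subr_ge0//; move: ay; lra.
  exact: (extends_agree Hg e_gt0 (HPhi _ (pra x)) (HPhi _ (pra y)) (pra x) (pra y) yb (prb y ye)).
rewrite /prop_for/continuous_at ltNge ax' /=.
by apply: cvg_trans cx; exact: near_eq_cvg E.
Qed.

Lemma good_all c : good c.
Proof.
apply: contrapT => nc; pose B := [set a | good a].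
have hB : has_inf B.
  split; first by exists r; exact: good_far.
  by exists c => a Ba; rewrite leNgt; apply/negP => ac; apply: nc; apply: good_mono Ba; exact: ltW.
have : good (inf B).
  apply: good_inf => b ib; have [a Ba ab] := inf_lt hB.1 ib.
  exact: good_mono (ltW ab) Ba.
move=> /good_open[e e_gt0 ge].
have : inf B <= inf B - e by apply: ge_inf => //; exact: hB.2.
by rewrite lerBrDr gerDl leNgt e_gt0.
Qed.

Lemma entire_sheet : exists g, forall x, S (x, g x) /\ {for x, continuous g}.
Proof.
have [g Hg] := @good_glue setT (fun b _ => good_all b).
by exists g => x; apply: (Hg x (x 0 i0 - 1)) => //; rewrite ltrBlDr ltrDl.
Qed.

End entire.

(** * Connectedness from the single end *)

Lemma near_coords {R : realType} {n : nat} (p : ambient R n) (e eta : R) :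
  0 < e -> 0 < eta -> \forall c \near p, ball p.1 e c.1 /\ `|c.2 - p.2| < eta.
Proof.
move=> e0 eta0; have m0 : 0 < Num.min e eta by rewrite lt_min e0.
have := nbhsx_ballx p _ m0; apply: filterS => c [c1 c2].
split; first by apply: le_ball c1; rewrite ge_min lexx.
move: c2; rewrite -ball_normE /ball_/= distrC => /lt_le_trans; apply.
by rewrite ge_min lexx orbT.
Qed.

Section single_graph.
Context {R : realType} {n : nat} {S : set (ambient R n)}.
Context {nu : ambient R n -> ambient R n}.
Context {Gamma : set 'rV[R]_n} {f : 'rV[R]_n -> R}.
Hypotheses (hf : admissible Gamma f) (hS : hypersurface S) (hnu : unit_normal S nu).
Hypothesis htr : translator Gamma f S nu.
Let hneg := translator_neg hf htr.
Variable i0 : 'I_n.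

(* Translators project openly to R^n, so a coordinate has no maximum. *)
Lemma component_noncompact q : S q ->
  ~ exists L : set (ambient R n), [/\ compact L, L `<=` S & connected_component S q `<=` L].
Proof.
move=> Sq [L [cL LS CL]]; pose C := connected_component S q.
have Cq : C q by exact: connected_component_refl.
have clL : closed L by apply: compact_closed cL; exact: norm_hausdorff.
have clCL : closure C `<=` L by rewrite (closure_id L).1//; exact: closure_subset.
have cC : compact (closure C).
  by apply: subclosed_compact clCL => //; exact: closed_closure.
have cont : continuous (fun p : ambient R n => p.1 0 i0).
  by move=> z; apply: (@cvg_comp _ _ _ fst (fun M : 'rV[R]_n => M 0 i0));
    [exact: cvg_fst|exact: coord_continuous].
have [|p pC pmax] := @compact_EVT_max _ R _ (closure C) _ cC (continuous_subspaceT cont).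
  by exists q; exact: subset_closure.
rewrite inE in pC; have Sp := LS _ (clCL _ pC).
have [e [eta [phi [e0 eta0 phiS phiU]]]] := window_exists hS hnu hneg Sp.
(* The maximum point [p] is only in the closure of the component. A point [c] of the component
   inside the window of [p] is joined, along the sheet, to a point with a larger coordinate. *)
have [c [Cc [/= ce ceta]]] := pC _ (near_coords p e0 eta0).
have Sc := connected_component_sub Cc.
have cE : c = (c.1, phi c.1).
  by rewrite -(phiU c.1 c.2 ce ceta) //; case: (c) Sc.
pose x := p.1 + (e / 2) *: delta_mx 0 i0.
have xe : ball p.1 e x.
  apply/rV_ballP => // j; rewrite !mxE eqxx/= opprD addrA subrr sub0r normrN.
  case: eqP => _; rewrite ?mulr0 ?normr0// mulr1 gtr0_norm ?divr_gt0//.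
  by rewrite ltr_pdivrMr// ltr_pMr// ltr1n.
pose w (t : R) := c.1 + t *: (x - c.1).
pose B : set (ambient R n) := [set (w t, phi (w t)) | t in [set` `[0%R, 1%R]]].
have we t : [set` `[0%R, 1%R]] t -> ball p.1 e (w t).
  by rewrite /= in_itv/=; exact: ball_segment.
have Bc : connected B.
  apply: connected_continuous_connected; first exact: segment_connected.
  apply/subspace_continuousP => t t01; apply: cvg_within_filter.
  have wc : w s @[s --> t] --> w t.
    by apply: cvgD; [exact: cvg_cst|apply: cvgZr_tmp; exact: cvg_id].
  have [_ _ pc] := phiS _ (we _ t01).
  exact: cvg_pair_nbhs wc (cvg_comp w phi wc pc).
have Bin0 : B c.
  by exists 0; rewrite /= ?in_itv/= ?lexx ?ler01// /w scale0r addr0 -cE.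
have BS : B `<=` S.
  by move=> _ [t /we te <-]; have [] := phiS _ te.
have Cx : C (x, phi x).
  apply: connected_component_trans Cc _.
  apply: (connected_component_max Bin0 BS Bc).
  by exists 1; rewrite /= ?in_itv/= ?lexx ?ler01// /w scale1r addrC subrK.
have := pmax (x, phi x); rewrite inE => /(_ (subset_closure Cx)) /=.
rewrite /x !mxE !eqxx mulr1 gerDl leNgt => /negP; apply.
by rewrite divr_gt0.
Qed.

(** For the empty compact set, the ends are the noncompact components. All components of S are such,
    so S is connected, and coincidence with the graph of [g] is open and closed in it. *)
Lemma single_end_graph g : single_end S ->
  (forall x, S (x, g x) /\ {for x, continuous g}) -> S = graph_over setT g.
Proof.
move=> hend Hg; apply/seteqP; split=> [q Sq|[x t] [_ /= ->]]; last by have [] := Hg x.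
split=> //.
have [C [_ Cu]] := hend set0 compact0 (sub0set S).
have comp p : S p -> C = connected_component S p.
  move=> Sp; apply: Cu; rewrite /noncompact_component setD0; split; first by exists p.
  exact: component_noncompact.
have [S0 _] := Hg 0.
pose B := [set p | C p /\ p.2 = g p.1].
have gc : continuous g by move=> x; have [] := Hg x.
have CS : C `<=` S by rewrite (comp _ Sq); exact: connected_component_sub.
have BC : B = C.
  have cC : connected C by rewrite (comp _ Sq); exact: component_connected.
  apply: cC.
  - by exists (0, g 0); split => //; rewrite (comp _ S0); exact: connected_component_refl.
  - exists (interior [set p | S p -> p.2 = g p.1]); first exact: open_interior.
    apply/seteqP; split=> p; last by move=> [Cp /interior_subset h]; split => //; exact/h/CS.
    move=> [Cp pg]; split => //; have Sp := CS _ Cp.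
    have [e [eta [phi [e0 eta0 phiS phiU]]]] := window_exists hS hnu hneg Sp.
    have n1 := near_coords p e0 eta0.
    have n3 : \forall c \near p, `|g c.1 - p.2| < eta.
      have h : (fun c : ambient R n => g c.1) @ p --> g p.1.
        by apply: (@cvg_comp _ _ _ fst g); [exact: cvg_fst|exact: gc].
      rewrite pg; move/cvgrPdist_lt: h => /(_ eta eta0).
      by apply: filterS => c; rewrite distrC.
    move: n1 n3; apply: filterS2 => c [c1 c2] c3 Sc.
    rewrite (phiU c.1 c.2)//; last by case: (c) Sc.
    by rewrite (phiU c.1 (g c.1))//; have [] := Hg c.1.
  - exists ((fun p : ambient R n => p.2 - g p.1) @^-1` [set x | x = 0]).
      apply: preimage_closed; last exact: closed_eq.
      move=> p _; apply: cvgB; first exact: cvg_snd.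
      by apply: (@cvg_comp _ _ _ fst g); [exact: cvg_fst|exact: gc].
    apply/seteqP; split=> p [Cp] /= E; split=> //; first by rewrite E subrr.
    by apply/eqP; rewrite -subr_eq0 E.
have : C q by rewrite (comp _ Sq); exact: connected_component_refl.
by rewrite -BC => -[].
Qed.

End single_graph.

(** * Comparison of entire solutions *)

Lemma is_derive_precomp {R : realType} (V V' W : normedModType R) (L : V -> V') (u : V' -> W)
    x w d : (forall (h : R), L (h *: w + x) = h *: L w + L x) ->
  is_derive (L x) (L w) u d -> is_derive x w (u \o L) d.
Proof.
move=> Ll; have E : (fun h : R => h^-1 *: (((u \o L) \o shift x) (h *: w) - (u \o L) x)) =
    (fun h : R => h^-1 *: ((u \o shift (L x)) (h *: L w) - u (L x))).
  by apply/funext => h /=; rewrite Ll.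
by move=> [d1 <-]; split; rewrite /derivable/derive E.
Qed.

Lemma second_derivative_test {R : realType} (h h1 : R -> R) (c : R) :
  (forall t, is_derive t (1 : R) h (h1 t)) -> is_derive (0 : R) (1 : R) h1 c ->
  (\forall t \near (0:R), h t <= h 0) -> h1 0 = 0 /\ c <= 0.
Proof.
move=> hd h1d /nbhs_ballP[e /= e0 hmax].
have he t : - e < t < e -> h t <= h 0.
  by move=> te; apply: hmax; rewrite -ball_normE /ball_/= sub0r normrN ltr_norml.
have h10 : h1 0 = 0.
  have [||||_ E] := @derive1_at_max R h (- e) e 0.
  - by rewrite (@le_trans _ _ 0)// ?oppr_le0 ltW.
  - by move=> t _; have [] := hd t.
  - by rewrite in_itv/= oppr_lt0 e0.
  - by move=> t; rewrite in_itv/=; exact: he.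
  by have [_ <-] := hd 0.
split => //; rewrite leNgt; apply/negP => c0.
have q := is_derive_quot h1d.
have : \forall t \near (0:R)^', 0 < t^-1 * (h1 (0 + t *: (1:R)) - h1 0).
  by move/cvgr_gt: q; apply.
move=> /nbhs_ballP[d /= d0 hpos].
pose t := Num.min (d / 2) (e / 2); have t0 : 0 < t by rewrite lt_min !divr_gt0.
have td : t < d by rewrite gt_min ltr_pdivrMr// ltr_pMr// ltr1n.
have te : t < e by rewrite gt_min [X in _ || X]ltr_pdivrMr// ltr_pMr// ltr1n orbT.
have [|s sI E] := MVT t0 (fun s _ => hd s).
  by apply: derivable_within_continuous => s _; have [] := hd s.
move: sI; rewrite in_itv/= => /andP[s0 st].
have : 0 < s^-1 * (h1 (0 + s *: (1:R)) - h1 0).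
  apply: hpos; last by rewrite gt_eqF.
  by rewrite -ball_normE /ball_/= sub0r normrN gtr0_norm// (lt_trans st).
rewrite add0r [s *: 1]mulr1 h10 subr0 pmulr_rgt0 ?invr_gt0// => hs.
have : h t <= h 0 by apply: he; rewrite te andbT (@lt_trans _ _ 0)// oppr_lt0.
by rewrite -subr_le0 E subr0 leNgt mulr_gt0.
Qed.

Section comparison.
Context {R : realType} {n : nat} {Gamma : set 'rV[R]_n} {f : 'rV[R]_n -> R}.
Hypothesis hf : admissible Gamma f.
Implicit Types (u v : 'rV[R]_n -> R) (q : 'rV[R]_n -> 'rV[R]_n) (A : 'rV[R]_n -> 'M[R]_n).

(** [q] and [A] are the gradient and the Hessian of [u]. The level [s] replaces 1 so that dilations
    of a solution are covered. *)
Definition solution (s : R) u q A := forall x,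
  [/\ forall w, is_derive x w u (dotr (q x) w), forall w, is_derive x w q (w *m A x)
    & exists mu, [/\ spectrum (q x) (A x) mu, Gamma_plus mu & f mu = s]].

(** The dilation keeps the gradient, hence the metric, and multiplies the Hessian by [s];
    homogeneity of [f] does the rest. *)
Lemma solution_scale s u q A : 0 < s -> solution 1 u q A ->
  solution s (fun x => s^-1 *: u (s *: x)) (fun x => q (s *: x)) (fun x => s *: A (s *: x)).
Proof.
move=> s0 H x; have [du dq [mu [sp mu0 f1]]] := H (s *: x).
have Ll w h : s *: (h *: w + x) = h *: (s *: w) + s *: x.
  by rewrite scalerDr !scalerA mulrC.
split=> [w|w|].
- have := is_derive_precomp (L := fun x => s *: x) (Ll w) (du (s *: w)).
  move=> /(is_deriveZ (s^-1)).
  have -> : s^-1 *: dotr (q (s *: x)) (s *: w) = dotr (q (s *: x)) w; last first.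
    by move=> D; exact D.
  rewrite !dotr_mx linearZ/= -scalemxAr mxE.
  by rewrite [LHS]mulrA mulVf ?mul1r// gt_eqF.
- have := is_derive_precomp (L := fun x => s *: x) (Ll w) (dq (s *: w)).
  by rewrite -scalemxAl scalemxAr.
- exists (s *: mu); split; first exact: spectrumZ.
    by move=> i; rewrite mxE mulr_gt0.
  by rewrite (adm_homog hf s0 (adm_Gamma_plus hf mu0)) f1 mulr1.
Qed.

Lemma solution_rot u q A (Q : 'M[R]_n) : Q *m Q^T = 1%:M -> solution 1 u q A ->
  solution 1 (fun x => u (x *m Q)) (fun x => q (x *m Q) *m Q^T)
    (fun x => Q *m A (x *m Q) *m Q^T).
Proof.
move=> QQ H x; have [du dq [mu [sp mu0 f1]]] := H (x *m Q).
have Ll w (h : R) : (h *: w + x) *m Q = h *: (w *m Q) + x *m Q.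
  by rewrite mulmxDl scalemxAl.
split=> [w|w|].
- have := is_derive_precomp (L := fun x => x *m Q) (Ll w) (du (w *m Q)).
  by rewrite !dotr_mx trmx_mul mulmxA.
- have d := is_derive_precomp (L := fun x => x *m Q) (Ll w) (dq (w *m Q)).
  apply: is_derive_row => k.
  have Lk (a : R) (y z : 'rV[R]_n) :
      ((a *: (y - z)) *m Q^T) 0 k = a * ((y *m Q^T) 0 k - (z *m Q^T) 0 k).
    by rewrite -scalemxAl mulmxBl mxE; congr (_ * _); rewrite mxE [X in _ + X]mxE.
  have Lc : continuous (fun y : 'rV[R]_n => (y *m Q^T) 0 k).
    have -> : (fun y : 'rV[R]_n => (y *m Q^T) 0 k) = (fun y => \sum_i y 0 i * Q^T i k).
      by apply/funext => y; rewrite mxE.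
    apply: (@sum_continuous R _ _ _ _ (fun i (y : 'rV[R]_n) => y 0 i * Q^T i k)) => i z.
    have c := @coord_continuous R 1 n 0 i z.
    exact: (cvgM c (cvg_cst (Q^T i k))).
  have := derive_functional Lk Lc d.
  by rewrite !mulmxA.
- by exists mu; split => //; exact: spectrum_rot.
Qed.

(** At a local maximum of [v - u] the gradients agree, so both Hessians are measured by the same
    metric, and the Hessian of [v] is the smaller form. *)
Lemma solution_max s1 s2 v qv Av u qu Au x :
  solution s1 v qv Av -> solution s2 u qu Au ->
  (\forall y \near x, v y - u y <= v x - u x) -> s1 <= s2.
Proof.
move=> Hv Hu xmax.
have test w : dotr (qv x) w - dotr (qu x) w = 0 /\ dotr (w *m Av x) w - dotr (w *m Au x) w <= 0.
  have xE : x = x + (0 : R) *: w by rewrite scale0r addr0.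
  pose h t := v (x + t *: w) - u (x + t *: w).
  pose h1 t := dotr (qv (x + t *: w)) w - dotr (qu (x + t *: w)) w.
  have [|||h10 h20] := @second_derivative_test R h h1
      (dotr (w *m Av x) w - dotr (w *m Au x) w).
  - move=> t; apply: is_deriveB.
      by apply: (is_derive_line v x w t _).1; have [+ _ _] := Hv (x + t *: w); exact.
    by apply: (is_derive_line u x w t _).1; have [+ _ _] := Hu (x + t *: w); exact.
  - apply: is_deriveB.
      apply: (is_derive_line (fun y => dotr (qv y) w) x w 0 _).1; rewrite -xE.
      have [_ + _] := Hv x; move=> /(_ w).
      exact: (derive_functional (dotr_linear w) (@dotr_continuous _ _ w)).
    apply: (is_derive_line (fun y => dotr (qu y) w) x w 0 _).1; rewrite -xE.
    have [_ + _] := Hu x; move=> /(_ w).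
    exact: (derive_functional (dotr_linear w) (@dotr_continuous _ _ w)).
  - have wc : x + t *: w @[t --> (0:R)] --> x + (0:R) *: w.
      by apply: cvgD; [exact: cvg_cst|apply: cvgZr_tmp; exact: cvg_id].
    rewrite -xE in wc; rewrite /h -xE; exact: wc _ xmax.
  by move: h10; rewrite /h1 -xE.
have qE : qv x = qu x.
  apply/rowP => i; have [/eqP] := test (delta_mx 0 i).
  have dE y : dotr y (delta_mx 0 i) = y 0 i.
    rewrite /dotr (bigD1 i)//= mxE !eqxx mulr1 big1 ?addr0// => j ji.
    by rewrite mxE (negbTE ji) mulr0.
  by rewrite !dE subr_eq0 => /eqP.
have [_ _ [mu1 [sp1 p1 <-]]] := Hv x; have [_ _ [mu2 [sp2 p2 <-]]] := Hu x.
rewrite qE in sp1; apply: (speed_spectrum_le hf sp1 sp2 p1 p2) => w.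
by have [_] := test w; rewrite subr_le0 /qform -!dotr_mx.
Qed.

(* Enlarging [u] by [s > 1] makes it a strict subsolution, which on a large
   compact set stays close to [u]; no strong maximum principle is needed. *)
Lemma solution_le u qu Au v qv Av :
  solution 1 u qu Au -> solution 1 v qv Av -> continuous u -> continuous v ->
  (forall ep : R, 0 < ep -> exists rho, forall x : 'rV[R]_n, rho < enormr x -> `|u x - v x| < ep) ->
  forall x, u x <= v x.
Proof.
move=> Hu Hv uc vc dec x0; rewrite leNgt; apply/negP => vu.
pose d := u x0 - v x0; have d0 : 0 < d by rewrite subr_gt0.
(* On the faces of the cube, which the [+ 1] in [rad] puts beyond [rho], [H s] stays below d/4 +
   d/8, while [H s x0] exceeds d - d/8. The maximum is therefore interior. *)
have [rho Hrho] := dec (d / 4) (divr_gt0 d0 (ltr0Sn _ 3)).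
pose rad := Num.max rho (enormr x0) + 1.
pose K := [set y : 'rV[R]_n | forall i, [set` `[- rad, rad]%R] (y 0 i)].
have cK : compact K.
  by apply: (@rV_compact R n (fun=> [set` `[- rad, rad]%R])) => i; exact: segment_compact.
pose H (s : R) (y : 'rV[R]_n) := s^-1 *: u (s *: y) - v y.
have Hnear : \forall s \near (1:R), forall y, K y -> `|H s y - (u y - v y)| < d / 8.
  apply: (iffLR (compact_near_coveringP K) cK R (nbhs (1:R))
    (fun s y => `|H s y - (u y - v y)| < d / 8)) => y Ky.
  have c : (fun p : 'rV[R]_n * R => p.2^-1 *: u (p.2 *: p.1) - u p.1) @ (y, 1 : R) --> (0:R).
    have -> : 0 = (1:R)^-1 *: u ((1:R) *: y) - u y by rewrite invr1 !scale1r subrr.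
    have c2 : (fun p : 'rV[R]_n * R => p.2) @ (y, 1 : R) --> (1:R) by exact: cvg_snd.
    have c1 : (fun p : 'rV[R]_n * R => p.1) @ (y, 1 : R) --> y by exact: cvg_fst.
    apply: cvgB; last exact: cvg_comp c1 (uc y).
    apply: cvgZ; first by apply: cvgV => //; exact: oner_neq0.
    apply: (@cvg_comp _ _ _ (fun p : 'rV[R]_n * R => p.2 *: p.1) u); last exact: uc.
    exact: cvgZ.
  have : \forall p \near (y, 1 : R), `|p.2^-1 *: u (p.2 *: p.1) - u p.1| < d / 8.
    move/cvgrPdist_lt: c => /(_ (d / 8) (divr_gt0 d0 (ltr0Sn _ 7))).
    by apply: filterS => p; rewrite sub0r normrN.
  have HE (p : 'rV[R]_n * R) : H p.2 p.1 - (u p.1 - v p.1) = p.2^-1 *: u (p.2 *: p.1) - u p.1.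
    by rewrite /H opprB addrA subrK.
  have N : (\forall p \near (y, 1 : R), `|p.2^-1 *: u (p.2 *: p.1) - u p.1| < d / 8) ->
      \forall p \near (y, 1 : R), `|H p.2 p.1 - (u p.1 - v p.1)| < d / 8.
    by apply: filterS => p; rewrite HE.
  by move=> /N.
have [s [s1 Hs]] : exists s : R, 1 < s /\ forall y, K y -> `|H s y - (u y - v y)| < d / 8.
  have n1 : \forall s \near (1:R)^'+, 1 < s by exact: nbhs_right_gt.
  have n2 : \forall s \near (1:R)^'+, forall y, K y -> `|H s y - (u y - v y)| < d / 8.
    exact: cvg_at_right_filter Hnear.
  have : \forall s \near (1:R)^'+, 1 < s /\ forall y, K y -> `|H s y - (u y - v y)| < d / 8.
    by move: n1 n2; apply: filterS2.
  by move=> /filter_ex[s hs]; exists s.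
have Kx0 : K x0.
  move=> i; rewrite /= in_itv/= -ler_norml; apply: le_trans (coord_le_enormr x0 i) _.
  by rewrite /rad ler_wpDr// le_max lexx orbT.
have Hc : continuous (H s).
  move=> y; have sc : s *: z @[z --> y] --> s *: y.
    exact: (cvgZ (cvg_cst s) (@cvg_id _ (nbhs y))).
  exact: (cvgB (cvgM (cvg_cst s^-1) (cvg_comp _ u sc (uc (s *: y)))) (vc y)).
have [|x1 x1K x1max] := @compact_EVT_max _ R (H s) K _ cK (continuous_subspaceT Hc).
  by exists x0.
rewrite inE in x1K.
have h0 : d - d / 8 < H s x0.
  by have := Hs _ Kx0; rewrite -/d ltr_norml => /andP[]; lra.
have h1 : H s x0 <= H s x1 by apply: x1max; rewrite inE.
have int i : `|x1 0 i| < rad.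
  rewrite lt_def; have := x1K i; rewrite /= in_itv/= -ler_norml => ->; rewrite andbT.
  apply/eqP => e; have /Hrho : rho < enormr x1.
    apply: lt_le_trans (coord_le_enormr x1 i); rewrite -e /rad.
    by apply: (@le_lt_trans _ _ (Num.max rho (enormr x0))); rewrite ?le_max ?lexx// ltrDl.
  have := Hs _ x1K; rewrite !ltr_norml => /andP[_ a] /andP[_ b].
  by have := le_trans (ltW h0) h1; move: a b d0; rewrite -/(d / 4); lra.
have loc : \forall y \near x1, H s y <= H s x1.
  have : \forall y \near x1, forall i, `|(y : 'rV[R]_n) 0 i| < rad.
    have F i : \forall y \near x1, `|(y : 'rV[R]_n) 0 i| < rad.
      have c : (fun y : 'rV[R]_n => `|y 0 i|) @ x1 --> `|x1 0 i|.
        exact: cvg_norm (@coord_continuous R 1 n 0 i x1).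
      by move/cvgr_lt: c; apply.
    exact: (@filter_forall (matrix R 1 n) _ (fun i (y : matrix R 1 n) => `|y 0 i| < rad)
      (nbhs x1) _ F).
  apply: filterS => y yr; apply: x1max; rewrite inE => i.
  by rewrite /= in_itv/= -ler_norml ltW.
have := solution_max (solution_scale (lt_trans ltr01 s1) Hu) Hv loc.
by rewrite leNgt s1.
Qed.

End comparison.

(** * Radial solutions *)

Lemma is_derive_even {R : realType} (V : normedModType R) (u : V -> R) x v c :
  (\forall t \near (0:R), u (x + t *: v) = u (x - t *: v)) -> is_derive x v u c -> c = 0.
Proof.
move=> even d.
have d0 : is_derive (0:R) (1:R) (fun t : R => u (x + t *: v)) c.
  by apply: (is_derive_line u x v 0 c).1; rewrite scale0r addr0.
have dN := is_derive_dirZ (-1) d.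
have d1 : is_derive (0:R) (1:R) (fun t : R => u (x + t *: (-1 *: v))) (-1 * c).
  by apply: (is_derive_line u x (-1 *: v) 0 (-1 * c)).1; rewrite scale0r addr0.
have d2 : is_derive (0:R) (1:R) (fun t : R => u (x + t *: (-1 *: v))) c.
  apply: (near_eq_is_derive _ d0); move: even; apply: filterS => t ->.
  by rewrite scalerA mulrN1 scaleNr.
have [_ h1] := d1; have [_ h2] := d2; rewrite h1 in h2.
by move: h2; lra.
Qed.

Section radial.
Context {R : realType} {n : nat} {S : set (ambient R n)}.
Context {nu : ambient R n -> ambient R n}.
Context {Gamma : set 'rV[R]_n} {f : 'rV[R]_n -> R}.
Hypotheses (hf : admissible Gamma f) (hnd : nondegenerate_speed Gamma f).
Hypotheses (hS : hypersurface S) (hnu : unit_normal S nu).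
Hypotheses (hconv : strictly_convex S nu) (htr : translator Gamma f S nu).
Let hneg := translator_neg hf htr.
Variables (D : set 'rV[R]_n) (u : 'rV[R]_n -> R).
Hypothesis SE : S = graph_over D u.
Hypothesis urad : forall x y, dotr x x = dotr y y -> D x -> D y /\ u y = u x.
Hypothesis hn : (1 < n)%N.
Let i0 : 'I_n := Ordinal (ltnW hn).
Let i1 : 'I_n := Ordinal hn.
Let e0 : 'rV[R]_n := delta_mx 0 i0.
Let q x := grad nu (x, u x).
Let p (t : R) := dotr (q (t *: e0)) e0.

Lemma graph_open x : D x -> \forall y \near x, D y.
Proof.
move=> Dx; have Sx : S (x, u x) by rewrite SE.
have [e [eta [phi [e_gt0 _ phiS _]]]] := window_exists hS hnu hneg Sx.
have := nbhsx_ballx x e e_gt0; apply: filterS => y /phiS[].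
by rewrite SE => -[].
Qed.

Lemma graph_sheet x : D x -> sheet_at (S := S) u x.
Proof.
move=> Dx; have Sx : S (x, u x) by rewrite SE.
have [e [eta [phi [e_gt0 _ phiS _]]]] := window_exists hS hnu hneg Sx.
split; last by have := graph_open Dx; apply: filterS => y Dy; rewrite SE.
have E : \forall y \near x, phi y = u y.
  have := nbhsx_ballx x e e_gt0; apply: filterS => y /phiS[].
  by rewrite SE => -[].
have [_ _ pc] := phiS x (ballxx _ e_gt0).
rewrite /prop_for/continuous_at -(nbhs_singleton E).
by apply: cvg_trans pc; exact: near_eq_cvg E.
Qed.

Lemma dotr_delta (x : 'rV[R]_n) i : dotr x (delta_mx 0 i) = x 0 i.
Proof.
rewrite /dotr (bigD1 i)//= mxE !eqxx mulr1 big1 ?addr0// => j ji.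
by rewrite mxE (negbTE ji) mulr0.
Qed.

Lemma dotrD_sqr (x v : 'rV[R]_n) (t : R) : dotr x v = 0 ->
  dotr (x + t *: v) (x + t *: v) = dotr x x + t ^+ 2 * dotr v v.
Proof.
move=> xv; have -> : dotr (x + t *: v) (x + t *: v) =
   dotr x x + 2 * t * dotr x v + t ^+ 2 * dotr v v.
  by rewrite /dotr !mulr_sumr -!big_split/=; apply: eq_bigr => i _; rewrite !mxE; ring.
by rewrite xv mulr0 addr0.
Qed.

(** The points [x + t v] and [x - t v] have the same norm, so [u] is even in [t] along [v]. *)
Lemma radial_orth x v : D x -> dotr x v = 0 -> dotr (q x) v = 0.
Proof.
move=> Dx xv; have [uc uS] := graph_sheet Dx.
apply: (@is_derive_even _ _ u x v); last exact: (sheet_derive hS hnu hneg).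
have n1 (s : R) : \forall t \near (0:R), D (x + t *: (s *: v)).
  have c : x + t *: (s *: v) @[t --> (0:R)] --> x.
    rewrite -[X in _ --> X]addr0 -(scale0r (s *: v)).
    exact: (cvgD (cvg_cst x) (cvgZ (@cvg_id _ (nbhs (0:R))) (cvg_cst (s *: v)))).
  exact: c _ (graph_open Dx).
have := n1 1; apply: filterS => t; rewrite scale1r => Dt.
have E : dotr (x + t *: v) (x + t *: v) = dotr (x - t *: v) (x - t *: v).
  by rewrite -scaleNr !dotrD_sqr// sqrrN.
by have [_ ->] := urad E Dt.
Qed.

Lemma radial_grad x k : D x -> q x 0 k * x 0 i0 = q x 0 i0 * x 0 k.
Proof.
(* The infinitesimal rotation in the plane of the coordinates [k] and [i0], tangent to the sphere
   through [x]. *)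
move=> Dx; pose v : 'rV[R]_n := x 0 i0 *: delta_mx 0 k - x 0 k *: delta_mx 0 i0.
have dv y : dotr y v = y 0 k * x 0 i0 - y 0 i0 * x 0 k.
  have -> : dotr y v = x 0 i0 * dotr y (delta_mx 0 k) - x 0 k * dotr y (delta_mx 0 i0).
    by rewrite /dotr !mulr_sumr -sumrB; apply: eq_bigr => i _; rewrite !mxE; ring.
  by rewrite !dotr_delta; ring.
have := radial_orth Dx (v := v); rewrite !dv mulrC subrr => /(_ erefl)/eqP.
by rewrite subr_eq0 => /eqP.
Qed.

Let e0i k : e0 0 k = (k == i0)%:R.
Proof. by rewrite mxE eqxx. Qed.

(* Differentiating the proportionality of [q x] and [x] gives the Hessian. *)
Lemma radial_hessian t : 0 < t -> D (t *: e0) -> exists c : R, exists A mu,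
  [/\ 0 < c, 0 < p t, is_derive t (1 : R) p c,
      spectrum (q (t *: e0)) A mu /\ Gamma_plus mu /\ f mu = 1
    & q (t *: e0) = p t *: e0 /\
      forall i j, A i j = if i == j then (if i == i0 then c else p t / t) else 0].
Proof.
move=> t0 Dt; set x := t *: e0.
have [uc uS] := graph_sheet Dt.
have [A [mu [dA sp mu0 f1]]] := sheet_curvature hS hnu hneg uc uS hf hconv htr.
have tn0 : t != 0 by rewrite gt_eqF.
have xi k : x 0 k = t * (k == i0)%:R by rewrite /x mxE; congr (_ * _); exact: e0i.
have qp : q x 0 i0 = p t by rewrite /p dotr_delta.
have qk k : k != i0 -> q x 0 k = 0.
  move=> ki; have := radial_grad k Dt; rewrite -/x !xi eqxx mulr1 (negbTE ki) !mulr0.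
  by move/eqP; rewrite mulf_eq0 (negbTE tn0) orbF => /eqP.
have qE : q x = p t *: e0.
  apply/rowP => k; rewrite [RHS]mxE (_ : e0 0 k = (k == i0)%:R); last exact: e0i.
  by case: eqP => [->|/eqP/qk->]; rewrite ?mulr1 ?mulr0.
have wA (w : 'rV[R]_n) k : k != i0 -> (w *m A) 0 k = p t * w 0 k / t.
  move=> ki.
  have dq i : is_derive x w (fun y => q y 0 i) ((w *m A) 0 i) by exact: is_derive_coord (dA w).
  have dx i : is_derive x w (fun y : 'rV[R]_n => y 0 i) (w 0 i).
    exact: is_derive_coord (is_derive_id x w).
  have d1 := is_deriveM (dq k) (dx i0); have d2 := is_deriveM (dq i0) (dx k).
  have [_ e1] := d1; have [_ e2] := d2.
  have E : 'D_w ((fun y => q y 0 k) * (fun y : 'rV[R]_n => y 0 i0)) x =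
           'D_w ((fun y => q y 0 i0) * (fun y : 'rV[R]_n => y 0 k)) x.
    apply: near_eq_derive; have := graph_open Dt; apply: filterS => y Dy.
    exact: radial_grad.
  move: E; rewrite e1 e2 /GRing.scale/= qk// !xi eqxx (negbTE ki) qp !mulr1 !mulr0 !mul0r.
  rewrite add0r addr0 => <-.
  by rewrite mulrAC mulfV// mul1r.
have As := spectrum_sym sp.
have Ae i j : A i j = ((delta_mx 0 i : 'rV[R]_n) *m A) 0 j.
  rewrite [RHS]mxE (bigD1 i)//= mxE !eqxx mul1r big1 ?addr0// => k ki.
  by rewrite mxE (negbTE ki) mul0r.
have Aij i j : A i j = if i == j then (if i == i0 then A i0 i0 else p t / t) else 0.
  have [<-|ij] := eqVneq i j.
    have [->//|ii] := eqVneq i i0.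
    by rewrite Ae wA// mxE !eqxx mulr1.
  have [ji|ji] := eqVneq j i0; last by rewrite Ae wA// mxE (eq_sym j) (negbTE ij) andbF mulr0 mul0r.
  have ii : i != i0 by rewrite -ji.
  by rewrite -As mxE Ae wA// mxE (negbTE ij) andbF mulr0 mul0r.
have qf i : qform A (delta_mx 0 i) = A i i.
  by rewrite /qform -dotr_mx dotr_delta -Ae.
exists (A i0 i0), A, mu; split => //.
- by rewrite -qf; exact: spectrum_qform_pos sp mu0 (delta_neq0 i0).
- have : 0 < A i1 i1 by rewrite -qf; exact: spectrum_qform_pos sp mu0 (delta_neq0 i1).
  by rewrite Aij eqxx/= pmulr_lgt0 ?invr_gt0.
- have -> : p = (fun s => q (0 + s *: e0) 0 i0).
    by apply/funext => s; rewrite /p dotr_delta add0r.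
  apply: (is_derive_line (fun y => q y 0 i0) 0 e0 t _).1; rewrite add0r.
  by rewrite Ae; exact: is_derive_coord (dA e0).
Qed.

(** Eigenvalues, relative to the metric, of the Hessian of a radial function at radius [t], with
    slope [s] and derivative [c] of the slope: one radial entry and n - 1 tangential ones. *)
Definition profile_curv (c s t : R) : 'rV[R]_n :=
  \row_i (if i == i0 then c / (1 + s ^+ 2) else s / t).

Lemma radial_ode t : 0 < t -> D (t *: e0) -> exists2 c : R, 0 < c &
  [/\ 0 < p t, is_derive t (1 : R) p c & f (profile_curv c (p t) t) = 1].
Proof.
move=> t0 Dt; have [c [A [mu [c0 p0 pd [sp [mu0 f1]] [qE Aij]]]]] := radial_hessian t0 Dt.
exists c => //; split=> //.
set m := profile_curv _ _ _.
have s0 : 0 < 1 + p t ^+ 2 by rewrite ltr_pwDl// sqr_ge0.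
pose d k : R := if k == i0 then 1 + p t ^+ 2 else 1.
have d0 k : 0 < d k by rewrite /d; case: ifP.
have ME : metric (q (t *: e0)) = diag_mx (\row_k d k).
  apply/matrixP => i j; have -> : metric (q (t *: e0)) i j =
      (i == j)%:R + (p t * (i == i0)%:R) * (p t * (j == i0)%:R).
    rewrite qE /metric mxE [X in X + _]mxE [X in _ + X]mxE big_ord1.
    by congr (_ + _ * _); rewrite !mxE !eqxx.
  rewrite mxE [(\row_k _) _ _]mxE /d; have [<-|ij] := eqVneq i j; rewrite ?mulr1n ?mulr0n ?add0r.
    by case: eqP => _; rewrite ?mulr1 ?mulr0 ?addr0// expr2.
  by have [ii|_] := eqVneq i i0; rewrite ?mulr0 ?mul0r// -ii eq_sym (negbTE ij) !mulr0.
have sq k : (Num.sqrt (d k))^-1 * d k * (Num.sqrt (d k))^-1 = 1.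
  have h : Num.sqrt (d k) != 0 by rewrite gt_eqF// sqrtr_gt0.
  rewrite -{2}(sqr_sqrtr (ltW (d0 k))); by field.
have sp' : spectrum (q (t *: e0)) A m.
  exists (diag_mx (\row_k (Num.sqrt (d k))^-1)); rewrite ME tr_diag_mx !mulmx_diag; split.
    rewrite -diag_const_mx; congr diag_mx; apply/rowP => k; rewrite !mxE; exact: sq.
  apply/matrixP => i j; rewrite Aij mxE; have [_|_] := eqVneq i j; last by rewrite mulr0n.
  have -> : forall r : 'rV[R]_n, r 0 i *+ 1 = r 0 i by [].
  rewrite !mxE.
  have -> : d i * (Num.sqrt (d i))^-1 * (if i == i0 then c / (1 + p t ^+ 2) else p t / t) *
      (Num.sqrt (d i))^-1 * d i = ((Num.sqrt (d i))^-1 * d i * (Num.sqrt (d i))^-1) *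
      (d i * (if i == i0 then c / (1 + p t ^+ 2) else p t / t)) by ring.
  by rewrite sq mul1r /d; case: ifP => _; rewrite ?mul1r// mulrC divfK// gt_eqF.
have m0 : Gamma_plus m by exact: spectrum_pos sp' sp mu0.
(* The explicit list [m] and the list [mu] carrying the equation belong to the same form; comparing
   in both directions shows that [f] takes the same value on them. *)
apply/eqP; rewrite eq_le -f1; apply/andP; split.
  exact: (speed_spectrum_le hf sp' sp m0 mu0 (fun w => lexx _)).
exact: (speed_spectrum_le hf sp sp' mu0 m0 (fun w => lexx _)).
Qed.

(* Nondegeneracy bounds the slope: [p / t * f(0, e) <= f(_, p / t e) = 1]. *)
Lemma radial_slope t : 0 < t -> D (t *: e0) -> p t <= t / f (zero_e R n).
Proof.
move=> t0 Dt; have [c c0 [p0 _ f1]] := radial_ode t0 Dt.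
have [Gz fz] := hnd.
have s0 : 0 < p t / t by rewrite divr_gt0.
rewrite ler_pdivlMr//; have -> : p t * f (zero_e R n) = p t / t * f (zero_e R n) * t.
  by field; rewrite gt_eqF.
rewrite ger_pMl// -(adm_homog hf s0 Gz) -f1.
have c'0 : 0 < c / (1 + p t ^+ 2) by rewrite divr_gt0// ltr_pwDl// sqr_ge0.
have zE (a : R) : (p t / t) *: zero_e R n + a *: delta_mx 0 i0 =
    \row_i (if i == i0 then a else p t / t).
  apply/rowP => i; rewrite !mxE eqxx/= -[i == i0]/(_ == _ :> nat).
  by case: eqP => _; rewrite /= ?mulr0 ?mulr1 ?add0r ?addr0.
rewrite /profile_curv -zE; apply: (speed_coord_mono hf (ltW c'0) _).1.
(* The starting point [a = 0] lies outside the positive cone; nondegeneracy and the cone property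
   put it in [Gamma]. *)
move=> a /andP[a0 a1]; move: a0; rewrite le_eqVlt => /predU1P[<-|a0].
  by rewrite mul0r scale0r addr0; exact: (adm_cone hf s0 Gz).
apply: (adm_Gamma_plus hf) => i; rewrite zE mxE; case: ifP => // _.
exact: mulr_gt0.
Qed.

End radial.

(** * The domain of a radial translator *)

Lemma real_induction {R : realType} (P : R -> Prop) (a b : R) : a <= b ->
  P a ->
  (forall t, a <= t <= b -> P t -> exists2 e, 0 < e & forall s, t <= s < t + e -> P s) ->
  (forall t, a < t <= b -> (forall s, a <= s < t -> P s) -> P t) -> P b.
Proof.
move=> ab Pa right close.
pose E := [set t | a <= t <= b /\ forall s, a <= s <= t -> P s].
have hE : has_sup E.
  split; last by exists b => t [/andP[]].
  exists a; split; first by rewrite lexx.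
  by move=> s; rewrite -eq_le => /eqP <-.
have Ea : E a.
  split; first by rewrite lexx.
  by move=> s; rewrite -eq_le => /eqP <-.
have asup : a <= sup E by apply: ub_le_sup => //; exact: hE.2.
have supb : sup E <= b by apply: ge_sup; [exact: hE.1|move=> t [/andP[]]].
have below s : a <= s < sup E -> P s.
  move=> /andP[as_ /(sup_gt hE.1)[t [_ Et] st]].
  by apply: Et; rewrite as_ ltW.
have Psup : P (sup E).
  move: asup; rewrite le_eqVlt => /predU1P[<-//|asup].
  by apply: close => //; rewrite asup supb.
have [e e0 He] := right (sup E) (introT andP (conj asup supb)) Psup.
have [bs|sb] := leP b (sup E).
  by have -> : b = sup E by apply/eqP; rewrite eq_le bs.
have all s : a <= s < sup E + e -> P s.
  move=> /andP[as_ se]; have [ss|ss] := ltP s (sup E); first by apply: below; rewrite as_.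
  by apply: He; rewrite ss.
pose t := Num.min b (sup E + e / 2).
have te : t < sup E + e.
  by rewrite gt_min [X in _ || X]ltrD2l ltr_pdivrMr// ltr_pMr// ltr1n orbT.
have : t <= sup E.
  apply: ub_le_sup; first exact: hE.2.
  split; first by rewrite le_min ab ge_min lexx (le_trans asup)// lerDl divr_ge0// ltW.
  by move=> s /andP[s1 s2]; apply: all; rewrite s1 (le_lt_trans s2).
by rewrite leNgt lt_min sb ltrDl divr_gt0.
Qed.

Lemma atan_lt {R : realType} (a b : R) : a < b -> atan a < atan b.
Proof.
move=> ab; have [|c _ E] := MVT ab (fun x _ => is_derive1_atan x).
  by apply: continuous_subspaceT => x; exact: continuous_atan.
by rewrite -subr_gt0 E mulr_gt0 ?subr_gt0// invr_gt0 ltr_pwDl// sqr_ge0.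
Qed.

Section radial_domain.
Context {R : realType} {n : nat} {S : set (ambient R n)}.
Context {nu : ambient R n -> ambient R n}.
Context {Gamma : set 'rV[R]_n} {f : 'rV[R]_n -> R}.
Hypotheses (hf : admissible Gamma f) (hnd : nondegenerate_speed Gamma f).
Hypotheses (hS : hypersurface S) (hnu : unit_normal S nu).
Hypotheses (hconv : strictly_convex S nu) (htr : translator Gamma f S nu).
Hypothesis hcomplete : complete_hypersurface S.
Variables (D : set 'rV[R]_n) (u : 'rV[R]_n -> R).
Hypothesis SE : S = graph_over D u.
Hypothesis urad : forall x y, dotr x x = dotr y y -> D x -> D y /\ u y = u x.
Hypothesis hn : (1 < n)%N.
Let i0 : 'I_n := Ordinal (ltnW hn).
Let e0 : 'rV[R]_n := delta_mx 0 i0.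
Let p (t : R) := dotr (grad nu (t *: e0, u (t *: e0))) e0.
Let U (t : R) := u (t *: e0).

Let U_derive t : D (t *: e0) -> is_derive t (1 : R) U (p t) /\ derivable p t 1.
Proof.
move=> Dt; have sh := graph_sheet hf hS hnu htr SE Dt.
have := sheet_line hf hS hnu hconv htr (x := 0) (w := e0) (t := t) (g := u).
rewrite add0r => /(_ sh (delta_neq0 i0)).
have E : (fun t : R => u (0 + t *: e0)) = U by apply/funext => s; rewrite add0r.
have E' : (fun t : R => dotr (grad nu (0 + t *: e0, u (0 + t *: e0))) e0) = p.
  by apply/funext => s; rewrite add0r.
by rewrite E E' => -[h1 [c _ [h2 _]]].
Qed.

(** The radius [y0] is approached from above or from below according to [sg], which is 1 or -1. The
    slope bound keeps the graph at finite height and length, and completeness supplies a point of S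
    over the limit. *)
Lemma ray_closed (sg y0 delta : R) : sg ^+ 2 = 1 -> 0 < delta -> 0 <= y0 ->
  (forall t, 0 < t < delta -> 0 < y0 + sg * t /\ D ((y0 + sg * t) *: e0)) ->
  D (y0 *: e0).
Proof.
move=> sg1 d0 y00 H.
have fz := hnd.2.
(* The slope bound at the largest radius that can occur. *)
pose m := (y0 + delta) / f (zero_e R n).
have asg : `|sg| = 1.
  by apply/eqP; rewrite -(@eqrXn2 _ 2)// ?expr1n -?normrX ?sg1 ?normr1.
have m0 : 0 <= m by rewrite divr_ge0 ?(ltW fz)// addr_ge0// ltW.
have pm t : 0 < t < delta -> `|sg * p (y0 + sg * t)| <= m.
  move=> /[dup] /andP[t0 td] /H[yt Dt]; rewrite normrM asg mul1r.
  have [c _ [p0 _ _]] := radial_ode hf hS hnu hconv htr SE urad yt Dt.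
  rewrite gtr0_norm//.
  apply: le_trans (radial_slope hf hnd hS hnu hconv htr SE urad yt Dt) _.
  rewrite /m ler_pM2r ?invr_gt0// lerD2l.
  apply: le_trans (ler_norm _) _; rewrite normrM asg mul1r gtr0_norm//; exact: ltW.
pose G t := U (y0 + sg * t).
have Gd t : 0 < t < delta -> is_derive t (1 : R) G (sg * p (y0 + sg * t)) /\
    {for t, continuous (fun t => sg * p (y0 + sg * t))}.
  move=> /H[yt Dt]; have [h1 h2] := U_derive Dt.
  have dl : is_derive t (1 : R) (fun t : R => y0 + sg * t) sg.
    have -> : (fun t : R => y0 + sg * t) = cst y0 + (fun s => s * sg).
      by apply/funext => s /=; rewrite mulrC.
    by rewrite -[X in is_derive _ _ _ X]add0r; apply: is_deriveD; exact: is_derive_mulr.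
  split.
    by rewrite mulrC; exact: (@is_derive1_comp R U (fun t : R => y0 + sg * t)).
  have lc : {for t, continuous (fun t : R => y0 + sg * t)}.
    by have [/derivable1_diffP/differentiable_continuous] := dl.
  have pc : {for (y0 + sg * t), continuous p}.
    by move/derivable1_diffP/differentiable_continuous: h2.
  exact: (cvgM (cvg_cst sg) (cvg_comp (fun t : R => y0 + sg * t) p lc pc)).
pose t1 := delta / 2; have t1d : 0 < t1 < delta by rewrite /t1; lra.
have GM t : 0 < t < delta -> G t <= G t1 + m * delta.
  move=> td.
  have close a b : 0 < a < delta -> 0 < b < delta -> a < b -> `|G b - G a| <= m * delta.
    move=> /andP[a0 ad] /andP[b0 bd] ab.
    have rng c : a <= c <= b -> 0 < c < delta.
      by move=> /andP[c1 c2]; rewrite (lt_le_trans a0)//= (le_lt_trans c2).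
    have [||c cI ->] := @MVT R G (fun t => sg * p (y0 + sg * t)) a b ab.
    - move=> c; rewrite in_itv/= => /andP[c1 c2]; apply: (Gd _ _).1; apply: rng.
      by rewrite !ltW.
    - by apply: derivable_within_continuous => c; rewrite in_itv/= => /rng/Gd[[]].
    rewrite normrM ler_pM//.
      by apply: pm; move: cI; rewrite in_itv/= => /andP[c1 c2]; apply: rng; rewrite !ltW.
    by rewrite ger0_norm ?subr_ge0 ?(ltW ab)//; lra.
  case: (ltgtP t t1) => [tt|tt|->].
  - by have := close _ _ td t1d tt; rewrite ler_norml => /andP[]; lra.
  - by have := close _ _ t1d td tt; rewrite ler_norml => /andP[]; lra.
  - by rewrite lerDl mulr_ge0// ltW.
have e01 : dotr (sg *: e0) (sg *: e0) = 1.
  rewrite dotr_mx linearZ/= -scalemxAl -scalemxAr scalerA -expr2 sg1 scale1r -dotr_mx.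
  by rewrite dotr_delta mxE !eqxx.
have [|l Sl _] := @graph_limit R n S (y0 *: e0) (sg *: e0) G
    (fun t => sg * p (y0 + sg * t)) m e01 delta (G t1 + m * delta) hcomplete d0.
  move=> t td; have [g1 g2] := Gd t td; have [_ Dt] := H t td.
  split=> //; last exact: GM.
  - have -> : y0 *: e0 + t *: (sg *: e0) = (y0 + sg * t) *: e0.
      by rewrite scalerA -scalerDl mulrC.
    by rewrite SE; split.
  - exact: le_trans (ler_norm _) (pm _ td).
by move: Sl; rewrite SE => -[].
Qed.

Lemma ray_open (y0 : R) : D (y0 *: e0) ->
  exists2 e, 0 < e & forall s, `|s - y0| < e -> D (s *: e0).
Proof.
move=> Dy; have c : s *: e0 @[s --> y0] --> y0 *: e0.
  exact: (cvgZ (@cvg_id _ (nbhs y0)) (cvg_cst e0)).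
have /nbhs_ballP[e /= e_gt0 he] : \forall s \near y0, D (s *: e0).
  exact: c _ (graph_open hf hS hnu htr SE Dy).
by exists e => // s se; apply: he; rewrite -ball_normE /ball_/= distrC.
Qed.

Lemma ray_norm (x : 'rV[R]_n) : dotr x x = dotr (enormr x *: e0) (enormr x *: e0).
Proof.
rewrite [RHS]dotr_mx linearZ/= -scalemxAl -scalemxAr scalerA mxE -dotr_mx dotr_delta.
by rewrite mxE !eqxx mulr1 -expr2 sqr_sqrtr// dotr_ge0.
Qed.

(** A positive radius in the domain exists by openness. Real induction goes outward from it and,
    after the change of sign of the variable, inward down to 0. *)
Lemma radial_domain : D = setT.
Proof.
have [[x0 t0] Sx] := hS.1; have Dx0 : D x0 by move: Sx; rewrite SE => -[].
have D0 := (urad (ray_norm x0) Dx0).1.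
have r00 : 0 <= enormr x0 by exact: sqrtr_ge0.
have [r [r0 Dr]] : exists r : R, 0 < r /\ D (r *: e0).
  have [e e_gt0 he] := ray_open D0; exists (enormr x0 + e / 2); split.
    by rewrite ltr_pwDr// divr_gt0.
  by apply: he; rewrite addrAC subrr add0r gtr0_norm ?divr_gt0// ltr_pdivrMr// ltr_pMr// ltr1n.
have ray t : 0 <= t -> D (t *: e0).
  move=> t_ge0; have [rt|tr] := leP r t.
    apply: (@real_induction R (fun s => D (s *: e0)) r t rt Dr).
    - move=> s _ Ds; have [e e_gt0 he] := ray_open Ds; exists e => // s' /andP[s1 s2].
      by apply: he; rewrite ger0_norm ?subr_ge0// ltrBlDl.
    - move=> s /andP[rs st] Hs; apply: (@ray_closed (-1) s (s - r)).
      + by rewrite sqrrN expr1n.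
      + by rewrite subr_gt0.
      + exact: ltW (lt_trans r0 rs).
      + move=> a /andP[a0 ar]; split; first by move: r0; lra.
        by apply: Hs; apply/andP; split; lra.
  have := @real_induction R (fun s => D ((- s) *: e0)) (- r) (- t).
  rewrite !opprK; apply => //; first by rewrite lerN2 ltW.
  - move=> s _ Ds; have [e e_gt0 he] := ray_open Ds; exists e => // s' /andP[s1 s2].
    by apply: he; rewrite ltr_norml; apply/andP; split; lra.
  - move=> s /andP[rs st] Hs; apply: (@ray_closed 1 (- s) (s + r)).
    + by rewrite expr1n.
    + by move: rs; lra.
    + by move: st; lra.
    + move=> a /andP[a0 ar]; split; first by move: st; lra.
      have -> : - s + 1 * a = - (s - a) by ring.
      by apply: Hs; apply/andP; split; lra.
apply/seteqP; split => // x _.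
have := ray _ (sqrtr_ge0 (dotr x x)); rewrite -/(enormr x).
by move=> /(urad (esym (ray_norm x)))[].
Qed.

End radial_domain.

(** * Rotations and uniqueness *)

Section reflections.
Context {R : realType} {n : nat}.
Implicit Types (x y v : 'rV[R]_n).

(** Two block triangular factors reduce the same matrix [B] to the two sides. *)
Lemma det_rank1 v y : \det (1%:M + v^T *m y) = 1 + dotr y v.
Proof.
pose B : 'M[R]_(n + 1) := block_mx 1%:M (- v^T) y 1%:M.
have E1 : block_mx 1%:M v^T 0 1%:M *m B = block_mx (1%:M + v^T *m y) 0 y 1%:M.
  by rewrite mulmx_block !mul1mx !mulmx1 !mul0mx !add0r addNr.
have E2 : block_mx 1%:M 0 (- y) 1%:M *m B = block_mx 1%:M (- v^T) 0 (1%:M + y *m v^T).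
  by rewrite mulmx_block !mul1mx !mulmx1 !mul0mx !addr0 mulmxN mulNmx opprK addNr addrC.
have := congr1 determinant E1; have := congr1 determinant E2.
rewrite !det_mulmx det_ublock det_lblock det_lblock !det_ublock !det1 !mul1r !mulr1.
by move=> -> <-; rewrite det_mx11 mxE [X in X + _]mxE eqxx -dotr_mx.
Qed.

(** The Householder reflection in the hyperplane orthogonal to [v], acting on row vectors. *)
Definition reflection v : 'M[R]_n := 1%:M + (- (2 / dotr v v) *: v)^T *m v.

Lemma reflectionE v x : x *m reflection v = x - (2 * dotr x v / dotr v v) *: v.
Proof.
rewrite /reflection mulmxDr mulmx1 mulmxA; congr (_ + _).
apply/rowP => i; rewrite mxE big_ord1 linearZ/= -scalemxAr mxE -dotr_mx !mxE.
by ring.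
Qed.

Lemma reflection_det v : v != 0 -> \det (reflection v) = -1.
Proof.
move=> v0; have d0 : dotr v v != 0.
  have [i vi] := rV_neq0 v0; rewrite gt_eqF//.
  by apply: lt_le_trans (coord_sqr_le v i); rewrite exprn_even_gt0.
rewrite /reflection det_rank1.
have -> : dotr v (- (2 / dotr v v) *: v) = - (2 / dotr v v) * dotr v v.
  by rewrite /dotr mulr_sumr; apply: eq_bigr => i _; rewrite !mxE; ring.
by field.
Qed.

Lemma reflection_orth v : v != 0 -> reflection v *m (reflection v)^T = 1%:M.
Proof.
move=> v0; have d0 : dotr v v != 0.
  have [i vi] := rV_neq0 v0; rewrite gt_eqF//.
  by apply: lt_le_trans (coord_sqr_le v i); rewrite exprn_even_gt0.
have -> : (reflection v)^T = reflection v.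
  rewrite /reflection raddfD/= trmx1 trmx_mul trmxK; congr (_ + _).
  by rewrite -scalemxAr [(_ *: v)^T]linearZ /= -scalemxAl.
apply/row_matrixP => i; rewrite row_mul rowE [RHS]rowE mulmx1.
rewrite [delta_mx 0 i *m _]reflectionE reflectionE.
set x : 'rV[R]_n := delta_mx 0 i; set c := 2 * dotr x v / dotr v v.
have -> : dotr (x - c *: v) v = - dotr x v.
  have -> : dotr (x - c *: v) v = dotr x v - c * dotr v v.
    by rewrite /dotr mulr_sumr -sumrB; apply: eq_bigr => j _; rewrite !mxE; ring.
  by rewrite /c; field.
rewrite mulrN mulNr -/c scaleNr opprK subrK.
by [].
Qed.

Lemma reflection_swap x y : x != y -> dotr x x = dotr y y -> x *m reflection (x - y) = y.
Proof.
move=> xy xx; rewrite reflectionE.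
have v0 : x - y != 0 by rewrite subr_eq0.
have d0 : dotr (x - y) (x - y) != 0.
  have [i vi] := rV_neq0 v0; rewrite gt_eqF//.
  by apply: lt_le_trans (coord_sqr_le _ i); rewrite exprn_even_gt0.
have E1 : dotr (x - y) (x - y) = dotr x x - 2 * dotr x y + dotr y y.
  by rewrite /dotr mulr_sumr -sumrB -big_split; apply: eq_bigr => j _; rewrite !mxE/=; ring.
have E2 : dotr x (x - y) = dotr x x - dotr x y.
  by rewrite /dotr -sumrB; apply: eq_bigr => j _; rewrite !mxE/=; ring.
have -> : 2 * dotr x (x - y) = dotr (x - y) (x - y) by rewrite E1 E2 xx; ring.
by rewrite divff// scale1r opprB addrCA subrr addr0.
Qed.

(** The reflection along [x - y] takes [x] to [y] with determinant -1. A second reflection, along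
    some [v] orthogonal to [y], fixes [y] and restores determinant 1; [v] exists because n >= 2. *)
Lemma rotation_exists x y : (1 < n)%N -> dotr x x = dotr y y ->
  exists Q : 'M[R]_n, [/\ Q *m Q^T = 1%:M, \det Q = 1 & x *m Q = y].
Proof.
move=> hn xx; have [->|xy] := eqVneq x y.
  by exists 1%:M; rewrite trmx1 !mulmx1 det1.
have [v v0 yv] : exists2 v, v != 0 & dotr y v = 0.
  have [y0|yn0] := eqVneq y 0.
    exists (delta_mx 0 (Ordinal hn)); first exact: delta_neq0.
    by rewrite y0 dotr_delta mxE.
  have [i yi] := rV_neq0 yn0.
  have [j ji] : exists j : 'I_n, j != i.
    have [->|i0] := eqVneq i (Ordinal hn); last by exists (Ordinal hn); rewrite eq_sym.
    by exists (Ordinal (ltnW hn)).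
  exists (y 0 j *: delta_mx 0 i - y 0 i *: delta_mx 0 j).
    apply/eqP => /rowP/(_ j); rewrite !mxE !eqxx (negbTE ji) mulr0 mulr1 sub0r => /eqP.
    by rewrite oppr_eq0 (negbTE yi).
  have -> : dotr y (y 0 j *: delta_mx 0 i - y 0 i *: delta_mx 0 j) =
      y 0 j * dotr y (delta_mx 0 i) - y 0 i * dotr y (delta_mx 0 j).
    by rewrite /dotr !mulr_sumr -sumrB; apply: eq_bigr => k _; rewrite !mxE; ring.
  by rewrite !dotr_delta mulrC subrr.
have xy0 : x - y != 0 by rewrite subr_eq0.
exists (reflection (x - y) *m reflection v); split.
- by rewrite trmx_mul mulmxA -(mulmxA (reflection _)) reflection_orth// mulmx1 reflection_orth.
- by rewrite det_mulmx !reflection_det// mulrNN mulr1.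
- by rewrite mulmxA reflection_swap// reflectionE yv mulr0 mul0r scale0r subr0.
Qed.

End reflections.

(** * Uniqueness of the radial profile *)

Section uniqueness.
Context {R : realType} {n : nat} {Gamma : set 'rV[R]_n} {f : 'rV[R]_n -> R}.
Hypotheses (hf : admissible Gamma f) (hn : (1 < n)%N).
Let i0 : 'I_n := Ordinal (ltnW hn).
Let i1 : 'I_n := Ordinal hn.
Let e0 : 'rV[R]_n := delta_mx 0 i0.

Definition entire_radial S nu (u : 'rV[R]_n -> R) :=
  [/\ hypersurface S, unit_normal S nu, strictly_convex S nu, translator Gamma f S nu &
   S = graph_over setT u /\ forall x y, dotr x x = dotr y y -> u y = u x].

Definition profile_slope (nu : ambient R n -> ambient R n) (u : 'rV[R]_n -> R) (t : R) :=
  dotr (grad nu (t *: e0, u (t *: e0))) e0.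

Lemma profile_facts S nu u (p := profile_slope nu u) : entire_radial S nu u ->
  [/\ forall t, is_derive t (1 : R) (fun t => u (t *: e0)) (p t),
      forall t, derivable p t 1, p 0 = 0 &
      forall t, 0 < t -> exists2 c, 0 < c & [/\ 0 < p t, is_derive t (1 : R) p c &
        f (profile_curv hn c (p t) t) = 1]].
Proof.
move=> [hS hnu hconv htr [SE urad]].
have urad' (x y : 'rV[R]_n) : dotr x x = dotr y y -> setT x -> setT y /\ u y = u x.
  by move=> xy _; split => //; exact: urad.
have sh x := graph_sheet hf hS hnu htr SE (x := x) I.
have line t : is_derive t (1 : R) (fun t => u (t *: e0)) (p t) /\ derivable p t 1.
  have := sheet_line hf hS hnu hconv htr (x := 0) (w := e0) (t := t) (g := u).
  move=> /(_ (sh _) (delta_neq0 i0)).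
  have E : (fun t : R => u (0 + t *: e0)) = (fun t => u (t *: e0)).
    by apply/funext => s; rewrite add0r.
  have E' : (fun t : R => dotr (grad nu (0 + t *: e0, u (0 + t *: e0))) e0) = p.
    by apply/funext => s; rewrite add0r.
  by rewrite E E' add0r => -[h1 [c _ [h2 _]]].
split.
- by move=> t; exact: (line t).1.
- by move=> t; exact: (line t).2.
- rewrite /p /profile_slope scale0r.
  apply: (radial_orth hf hS hnu htr SE urad' (x := 0)) => //.
  by rewrite dotrC dotr_mx linear0 mulmx0 mxE.
- move=> t t0; exact: (radial_ode hf hS hnu hconv htr SE urad' t0 (I : setT (t *: e0))).
Qed.

(* At a positive maximum of [atan p1 - atan p2] the first curvature would have to
   drop, while both curvature vectors lie on the level set [f = 1]. *)
Lemma profile_le S1 nu1 u1 S2 nu2 u2 (t0 : R) :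
  entire_radial S1 nu1 u1 -> entire_radial S2 nu2 u2 -> 0 <= t0 ->
  profile_slope nu1 u1 t0 <= profile_slope nu2 u2 t0.
Proof.
move=> E1 E2 t00; set p1 := profile_slope nu1 u1; set p2 := profile_slope nu2 u2.
have [_ d1 z1 o1] := profile_facts E1; have [_ d2 z2 o2] := profile_facts E2.
rewrite -/p1 in d1 z1 o1; rewrite -/p2 in d2 z2 o2.
rewrite leNgt; apply/negP => lt21.
pose h t := atan (p1 t) - atan (p2 t).
have pc (p : R -> R) : (forall t, derivable p t 1) -> continuous (fun t => atan (p t)).
  move=> pd t; have c : {for t, continuous p}.
    by apply/differentiable_continuous/derivable1_diffP.
  exact: (cvg_comp p atan c (@continuous_atan R (p t))).
have hc : continuous h by move=> t; apply: cvgB; exact: pc.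
have [t1 t1I hmax] := EVT_max t00 (continuous_subspaceT hc).
have h0 : 0 < h t0 by rewrite subr_gt0 atan_lt.
have h1 : 0 < h t1.
  by apply: lt_le_trans h0 _; apply: hmax; rewrite in_itv/= t00 lexx.
move: t1I; rewrite in_itv/= => /andP[t1_ge0 t1t0].
(* Both slopes vanish on the axis, so a positive maximum avoids the singular radius. *)
have t1_gt0 : 0 < t1.
  rewrite lt_neqAle t1_ge0 andbT; apply: contraTneq h1 => <-.
  by rewrite /h z1 z2 subrr ltxx.
have p21 : p2 t1 < p1 t1.
  rewrite ltNge; apply: contraTN h1; rewrite -leNgt subr_le0 le_eqVlt.
  by move=> /predU1P[->//|/atan_lt/ltW].
have [c1 c10 [p10 pd1 f1]] := o1 _ t1_gt0; have [c2 c20 [p20 pd2 f2]] := o2 _ t1_gt0.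
have q10 : 0 < 1 + p1 t1 ^+ 2 by rewrite ltr_pwDl// sqr_ge0.
have q20 : 0 < 1 + p2 t1 ^+ 2 by rewrite ltr_pwDl// sqr_ge0.
have hd : is_derive t1 (1 : R) h ((1 + p1 t1 ^+ 2)^-1 * c1 - (1 + p2 t1 ^+ 2)^-1 * c2).
  have a1 := is_derive1_comp (is_derive1_atan (p1 t1)) pd1.
  have a2 := is_derive1_comp (is_derive1_atan (p2 t1)) pd2.
  exact: (is_deriveB a1 a2).
have neg : (1 + p1 t1 ^+ 2)^-1 * c1 - (1 + p2 t1 ^+ 2)^-1 * c2 < 0.
  rewrite subr_lt0 ltNge; apply/negP => le21.
  suff : f (profile_curv hn c2 (p2 t1) t1) < f (profile_curv hn c1 (p1 t1) t1).
    by rewrite f1 f2 ltxx.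
  have lt' : p2 t1 / t1 < p1 t1 / t1 by rewrite ltr_pM2r ?invr_gt0.
  (* Strictness comes from a tangential entry, present since n >= 2. *)
  apply: (@speed_strict_mono _ _ _ _ hf _ _ i1).
  - by move=> i; rewrite mxE; case: ifP => _; rewrite divr_gt0.
  - move=> i; rewrite !mxE; case: ifP => _; last exact: ltW.
    by rewrite mulrC [leRHS]mulrC.
  - by rewrite !mxE.
(* The maximum may sit at the right end [t0], so the contradiction is drawn from a step to the
   left. *)
have : \forall t \near (0:R)^', t^-1 * (h (t1 + t *: (1:R)) - h t1) < 0.
  by move/cvgr_lt: (is_derive_quot hd); apply.
move=> /nbhs_ballP[d /= d0 hneg].
pose t := Num.min (d / 2) t1; have t_gt0 : 0 < t by rewrite lt_min t1_gt0 divr_gt0.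
have td : t < d by rewrite gt_min ltr_pdivrMr// ltr_pMr// ltr1n.
have : (- t)^-1 * (h (t1 + (- t) *: (1:R)) - h t1) < 0.
  apply: hneg; last by rewrite oppr_eq0 gt_eqF.
  by rewrite -ball_normE /ball_/= opprK add0r gtr0_norm.
rewrite [_ *: 1]mulr1 invrN mulNr oppr_lt0 pmulr_rgt0 ?invr_gt0// subr_gt0 ltNge => /negP; apply.
apply: hmax; rewrite in_itv/= subr_ge0 ge_min lexx orbT/=.
by rewrite lerBlDr (le_trans t1t0)// lerDl ltW.
Qed.

Lemma entire_radial_unique S1 nu1 u1 S2 nu2 u2 :
  entire_radial S1 nu1 u1 -> entire_radial S2 nu2 u2 ->
  forall x, u1 x - u2 x = u1 0 - u2 0.
Proof.
move=> E1 E2 x.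
have [l1 _ _ _] := profile_facts E1; have [l2 _ _ _] := profile_facts E2.
have pE t : 0 <= t -> profile_slope nu1 u1 t = profile_slope nu2 u2 t.
  by move=> t_ge0; apply/eqP; rewrite eq_le (profile_le E1 E2 t_ge0) (profile_le E2 E1 t_ge0).
have [_ _ _ _ [_ r1]] := E1; have [_ _ _ _ [_ r2]] := E2.
have xE : dotr (enormr x *: e0) (enormr x *: e0) = dotr x x by rewrite -ray_norm.
rewrite (r1 _ _ xE) (r2 _ _ xE); set t := enormr x.
have t_ge0 : 0 <= t by exact: sqrtr_ge0.
pose h s := u1 (s *: e0) - u2 (s *: e0).
have hd s : is_derive s (1 : R) h (profile_slope nu1 u1 s - profile_slope nu2 u2 s).
  by apply: is_deriveB.
have [|c cI E] := MVT_segment t_ge0 (fun s _ => hd s).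
  by apply: derivable_within_continuous => s _; have [] := hd s.
move: cI E; rewrite in_itv/= => /andP[c0 _].
rewrite pE// subrr mul0r /h scale0r => /eqP; rewrite subr_eq0 => /eqP; exact.
Qed.

End uniqueness.

(** * From the asymptotic expansion to the bowl *)

Lemma mulmx_continuous {R : realType} {m n : nat} (Q : 'M[R]_(m, n)) :
  continuous (fun x : 'rV[R]_m => x *m Q).
Proof.
have -> : (fun x : 'rV[R]_m => x *m Q) = (fun x => \sum_i x 0 i *: row i Q).
  by apply/funext => x; rewrite mulmx_sum_row.
apply: (@sum_continuous R _ _ _ _ (fun i (x : 'rV[R]_m) => x 0 i *: row i Q)) => i x.
have c := @coord_continuous R 1 m 0 i x.
exact: (cvgZ c (cvg_cst (row i Q))).
Qed.

Lemma enormr_orth {R : realType} {n : nat} (x : 'rV[R]_n) (Q : 'M[R]_n) :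
  Q *m Q^T = 1%:M -> dotr (x *m Q) (x *m Q) = dotr x x.
Proof.
by move=> QQ; rewrite !dotr_mx trmx_mul mulmxA -(mulmxA x) QQ mulmx1.
Qed.

(** The model expansion depends on |x| alone, which [Q] preserves, so it cancels in
    [u x - u (x *m Q)]. Beyond radius 2|C|/ep each of the two remainders is below ep/2. *)
Lemma exterior_graph {R : realType} {n : nat} (f : 'rV[R]_n -> R) (S : set (ambient R n)) :
  asymptotic_to_bowl f S -> exists r u, [/\ 0 < r,
    forall x, r < enormr x -> S (x, u x) /\ forall t, S (x, t) -> t = u x
    & forall Q : 'M[R]_n, Q *m Q^T = 1%:M -> forall ep : R, 0 < ep ->
        exists rho, forall x, rho < enormr x -> `|u x - u (x *m Q)| < ep].
Proof.
move=> [r [D [u [r0 SE hD [C [M hC]]]]]]; exists r, u; split => // [x rx|Q QQ ep ep0].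
  have big t : r < enorm (x, t).
    apply: lt_le_trans rx _; rewrite /enormr /enorm /dot/= ler_wsqrtr// lerDl.
    by rewrite -expr2 sqr_ge0.
  have SP t : S (x, t) <-> graph_over D u (x, t).
    have : (S `&` [set p | r < enorm p]) (x, t) <->
        (graph_over D u `&` [set p | r < enorm p]) (x, t) by rewrite SE.
    by move=> [h1 h2]; split=> h; [have [] := h1 (conj h (big t))|have [] := h2 (conj h (big t))].
  split; first by apply/SP; split => //; exact: hD.
  by move=> t /SP[].
exists (Num.max M (2 * `|C| / ep)) => x.
have eQ : enormr (x *m Q) = enormr x by rewrite /enormr enormr_orth.
rewrite gt_max => /andP[Mx Cx].
have x0 : 0 < enormr x.
  by apply: le_lt_trans Cx; rewrite divr_ge0 ?(ltW ep0)// mulr_ge0.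
have := hC x Mx; have := hC (x *m Q); rewrite eQ => /(_ Mx).
set b := _ - _ * ln _ => h2 h1.
have h3 : C * (enormr x)^-1 < ep / 2.
  rewrite ltr_pdivrMr//; rewrite ltr_pdivrMr// in Cx.
  by have := ler_norm C; lra.
rewrite -(subrKA b) (le_lt_trans (ler_normD _ _))// (splitr ep).
apply: ltrD; first exact: le_lt_trans h1 h3.
by rewrite distrC; exact: le_lt_trans h2 h3.
Qed.

Theorem theorem1p2 (R : realType) (n : nat) (hn : (2 <= n)%N)
    (Gamma : set 'rV[R]_n) (f : 'rV[R]_n -> R)
    (hf : admissible Gamma f) (hnd : nondegenerate_speed Gamma f)
    (S : set (ambient R n)) (nu : ambient R n -> ambient R n)
    (hS : hypersurface S) (hnu : unit_normal S nu)
    (hconv : strictly_convex S nu) (htr : translator Gamma f S nu)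
    (hcomplete : complete_hypersurface S) (hend : single_end S)
    (hasym : asymptotic_to_bowl f S) :
  (exists B, bowl_type Gamma f B) /\
  (forall B, bowl_type Gamma f B -> exists c : R, S = vertical_translate c B).
Proof.
have hneg := translator_neg hf htr.
have [r [w [r0 wS wdec]]] := exterior_graph hasym.
have i01 : Ordinal (ltnW hn) != Ordinal hn by [].
have [g Hg] := entire_sheet hf hS hnu hconv htr hcomplete i01 r0 wS.
have SE : S = graph_over setT g.
  exact: (single_end_graph hf hS hnu htr (Ordinal hn) hend Hg).
have gc : continuous g by move=> x; have [] := Hg x.
have /choice[A HA] : forall x, exists A : 'M[R]_n,
    (forall v, is_derive x v (fun y => grad nu (y, g y)) (v *m A)) /\
    exists mu, [/\ spectrum (grad nu (x, g x)) A mu, Gamma_plus mu & f mu = 1].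
  move=> x; have gS : \forall y \near x, S (y, g y).
    by have := nbhsx_ballx x 1 ltr01; apply: filterS => y _; have [] := Hg y.
  have [A [mu [dA sp mu0 f1]]] := sheet_curvature hS hnu hneg (gc x) gS hf hconv htr.
  by exists A; split => //; exists mu.
have sol : solution (f := f) 1 g (fun x => grad nu (x, g x)) A.
  move=> x; have [dA sp] := HA x; split => // v.
  apply: (sheet_derive hS hnu hneg _ (gc x)).
  by have := nbhsx_ballx x 1 ltr01; apply: filterS => y _; have [] := Hg y.
have wg x : r < enormr x -> w x = g x.
  by move=> rx; have [_ /(_ (g x))->//] := wS x rx; have [] := Hg x.
have grot Q x : Q *m Q^T = 1%:M -> g (x *m Q) = g x.
  move=> QQ; have eQ y : enormr (y *m Q) = enormr y by rewrite /enormr enormr_orth.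
  have solQ := solution_rot QQ sol.
  have gQc : continuous (fun y : 'rV[R]_n => g (y *m Q)).
    move=> y; apply: (@cvg_comp _ _ _ (fun y : 'rV[R]_n => y *m Q) g); last exact: gc.
    exact: mulmx_continuous.
  have dec (ep : R) : 0 < ep ->
      exists rho, forall x : 'rV[R]_n, rho < enormr x -> `|g x - g (x *m Q)| < ep.
    move=> ep0; have [rho Hrho] := wdec Q QQ ep ep0.
    exists (Num.max r rho) => y; rewrite gt_max => /andP[ry rhoy].
    by rewrite -!wg ?eQ//; exact: Hrho.
  apply/eqP; rewrite eq_le; apply/andP; split.
    apply: (solution_le hf solQ sol gQc gc) => ep /dec[rho Hrho].
    by exists rho => y /Hrho; rewrite distrC.
  exact: (solution_le hf sol solQ gc gQc).
have SR : entire_radial (Gamma := Gamma) (f := f) S nu g.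
  split => //; split => // x y xy.
  have [Q [QQ _ <-]] := rotation_exists hn xy; exact: grot.
split.
  exists S; split => //; first by exists nu.
    move=> Q QQ _ x t; rewrite SE => -[_ /= ->]; split => //=; exact/esym/grot.
  by exists setT, g.
move=> B [hB hBc [nuB [hBn hBconv hBtr]] Brot [D [u BE]]].
have urad (x y : 'rV[R]_n) : dotr x x = dotr y y -> D x -> D y /\ u y = u x.
  move=> xy Dx; have [Q [QQ dQ <-]] := rotation_exists hn xy.
  have : B (x *m Q, u x) by apply: Brot => //; rewrite BE.
  by rewrite BE => -[].
have DT := radial_domain hf hnd hB hBn hBconv hBtr hBc BE urad hn.
have BR : entire_radial (Gamma := Gamma) (f := f) B nuB u.
  split => //; split => [|x y xy]; first by rewrite BE DT.
  by have [] := urad x y xy; rewrite DT.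
have uniq := entire_radial_unique hf hn SR BR.
(* The translation is the difference of heights on the axis. *)
exists (g 0 - u 0); rewrite SE BE DT; apply/seteqP; split => [[x t] [_ /= ->]|].
  exists (x, u x) => //=; congr (_, _); by rewrite -(uniq x) addrC subrK.
move=> _ [[x t] [_ /= ->] <-]; split => //=.
by rewrite -(uniq x) addrC subrK.
Qed.
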